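(* Let $P$ be a set of $m$ distinct points and $L$ a set of $n$ distinct lines in $\mathbb{R}^d$ ($d\ge 3$), such that all the points and lines lie in a common two-dimensional algebraic variety of constant degree that does not contain any 2-flat. Then $$I(P,L)=O(m+n),$$ where the constant of proportionality depends on the degree of the variety.
   Context: $I(P,L)$ denotes the number of pairs $(p,\ell)\in P\times L$ with $p\in\ell$. A 2-flat is a two-dimensional affine subspace of $\mathbb{R}^d$. The degree of a real variety is understood as the degree of its complexification. *)

(* Defs.v *)
From mathcomp Require Import all_boot all_order all_algebra.
From mathcomp Require Import finmap mpoly complex.
From mathcomp Require Import boolp classical_sets functions cardinality reals.

Set Implicit Arguments.
Unset Strict Implicit.
Unset Printing Implicit Defensive.

Import GRing.Theory.

Local Open Scope fset_scope.
Local Open Scope classical_set_scope.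
Local Open Scope ring_scope.

Section Zariski.
Variables (F : fieldType) (d : nat).
Implicit Types (A V W Z : set 'rV[F]_d) (k e : nat).

Definition mpoly_eval (p : {mpoly F[d]}) (x : 'rV[F]_d) : F :=
  p.@[fun i => x 0 i].

Definition zero_locus (S : set {mpoly F[d]}) : set 'rV[F]_d :=
  [set x | forall p, S p -> mpoly_eval p x = 0].

Definition vanishing_ideal A : set {mpoly F[d]} :=
  [set p | forall x, A x -> mpoly_eval p x = 0].

(* Varieties are zero loci; they may be reducible and need not be
   equidimensional. *)
Definition algebraic_variety V : Prop := exists S, V = zero_locus S.

Definition zariski_closure A : set 'rV[F]_d := zero_locus (vanishing_ideal A).

Definition irreducible_variety W : Prop :=
  [/\ algebraic_variety W, W !=set0 &
      forall V1 V2, algebraic_variety V1 -> algebraic_variety V2 ->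
        W `<=` V1 `|` V2 -> W `<=` V1 \/ W `<=` V2].

Definition irreducible_chain V k : Prop :=
  exists Z : nat -> set 'rV[F]_d,
    (forall i, (i <= k)%N -> irreducible_variety (Z i) /\ Z i `<=` V) /\
    (forall i, (i < k)%N -> Z i `<` Z i.+1).

(* Krull dimension; for real varieties this is the dimension of the ring
   R[x_1, ..., x_d] / I(V), i.e. the dimension of V as a semialgebraic set. *)
Definition has_dimension V k : Prop :=
  irreducible_chain V k /\ ~ irreducible_chain V k.+1.

Definition irreducible_component V W : Prop :=
  [/\ irreducible_variety W, W `<=` V &
      forall W', irreducible_variety W' -> W' `<=` V -> W `<=` W' -> W' = W].

Definition is_flat k A : Prop :=
  exists (a : 'rV[F]_d) (M : 'M[F]_(k, d)),
    row_free M /\ A = [set x | exists c : 'rV[F]_k, x = a + c *m M].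

End Zariski.

(* A generic flat of codimension k meets W in exactly e points, k = dim W.
   Codimension-k flats are given by k affine equations x *m A = b; "generic"
   means that the coefficients (A, b) avoid the zeros of some nonzero
   polynomial g (which may be taken to force A to have rank k). Over an
   algebraically closed field of characteristic 0 this is the usual degree of
   an irreducible variety. *)
Definition has_irreducible_degree (F : fieldType) (d : nat)
    (W : set 'rV[F]_d) (e : nat) : Prop :=
  exists k : nat, has_dimension W k /\
  exists g : {mpoly F[d * k + k]}, g <> 0 /\
    forall (A : 'M[F]_(d, k)) (b : 'rV[F]_k),
      mpoly_eval g (row_mx (mxvec A) b) <> 0 ->
      (W `&` [set x | x *m A = b] #= `I_e)%card.

(* The degree of a reducible variety is the sum of the degrees of all its
   irreducible components, whatever their dimensions. For an equidimensional
   variety it is the number of intersection points with a generic flat of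
   complementary dimension. *)
Definition has_degree (F : fieldType) (d : nat)
    (V : set 'rV[F]_d) (D : nat) : Prop :=
  exists (Ws : {fset (set 'rV[F]_d)}) (deg : set 'rV[F]_d -> nat),
    [/\ forall W, W \in Ws <-> irreducible_component V W,
        forall W, W \in Ws -> has_irreducible_degree W (deg W) &
        D = (\sum_(W <- Ws) deg W)%N].

(* The smallest complex variety containing V. *)
Definition complexification (R : realType) (d : nat) (V : set 'rV[R]_d) :
    set 'rV[R[i]]_d :=
  zariski_closure [set map_mx (real_complex R) x | x in V].

Definition incidences (R : realType) (d : nat)
    (P : {fset 'rV[R]_d}) (L : {fset (set 'rV[R]_d)}) : nat :=
  #|` [fset pl in (P `*` L)%fset | pl.1 \in pl.2]%fset |.

(* Main.v *)
(* Every line of L lies, once complexified, in an irreducible component W of the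
   complexification of V, and there are at most D components, each of degree
   e <= D; so it suffices to bound the incidences with the lines inside one W.

   If W is a curve, it is a single line. If W is a surface, call a point rich
   when more than 2 e^2 lines pass through it inside W. Two rich points force W
   to be a plane, and then V contains a real plane. Hence all points except one
   lie on at most 2 e^2 lines of W, and the exceptional one on at most #|L|.

   To see that two rich points p and p' force W to be a plane, project W to F^3
   by three linear forms b1, b2, y, the first two generic. The image satisfies
   a prime equation g(b1, b2, y) = 0, monic in y, and n := deg_y g = deg g is at
   most e, because a generic fiber of (b1, b2) on W has n values of y and at
   most e points. The dilation of ratio l about p maps g to a multiple of an
   equation h which agrees with g on the more than 2 e^2 >= 2 n^2 projected
   lines through p. On each plane b1 = c these lines give more common zeros of
   g and h than the degree of their resultant allows, so h = g, i.e. g is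
   homogeneous about p; likewise about p'. The dilations about p and p' compose to
   the translations along the line p p', so g is a prime form in two variables,
   i.e. linear, and on W the form y is an affine function of b1 and b2. When y
   vanishes on the directions v1, v2 of two lines of W through p, this function
   is constant; as y is otherwise arbitrary, W lies in the plane p + <v1, v2>.

   Dimensions are compared through the growth of the spaces of polynomial
   functions of degree at most n. It is at most quadratic on V because r
   algebraically independent polynomials on a real variety yield a chain of
   length r: the image of V is semialgebraic and Zariski dense, so that a generic
   level set of one of them keeps the others independent. The same bound holds on
   the complexification, and a chain of length 3 would violate it. *)

Require Import Defs.
From mathcomp Require Import all_boot all_order all_algebra.
From mathcomp Require Import finmap complex.
From mathcomp Require Import mpoly closed_field polyrcf separable.
From mathcomp Require Import ring zify.
From mathcomp Require qe_rcf ordered_qelim.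
From mathcomp Require Import boolp classical_sets functions cardinality reals.

Set Implicit Arguments.
Unset Strict Implicit.
Unset Printing Implicit Defensive.

Import Order.TTheory GRing.Theory Num.Theory.

Local Open Scope ring_scope.
Local Open Scope classical_set_scope.

(** * Polynomials on lines *)

(** Growth is used because it is defined for any set with any system of functions, and is unaffected
    by Zariski closure, by complex scalars and by the finite extensions of Noether normalization;
    chains of real varieties offer none of this. Every generic choice has to meet finitely many
    conditions at once. Each is the nonvanishing of a function that is polynomial along all lines,
    and such conditions can be multiplied. The equation of a projection describes only the closure
    of the image of [W]. That a generic zero of it really comes from a point of [W] follows from
    quantifier elimination: membership in the image depends only on which of finitely many
    polynomials vanish. The factor 2 in the threshold comes from the resultant of two equations of
    degree n: a determinant of order 2n with entries of degree at most n. Degrees are known only as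
    cardinalities of generic sections and might be 0 a priori; components that contain a line are
    shown to have positive degree, and this is what bounds their number by [D]. *)

Section PolynomialOnLines.
Variable F : numFieldType.

Lemma poly_neq0_ex (p : {poly F}) : p != 0 -> exists t, p.[t] != 0.
Proof.
move=> p0; apply/not_existsP => H.
suff: (size [seq i%:R : F | i <- iota 0 (size p)] < size p)%N.
  by rewrite size_map size_iota ltnn.
apply: max_poly_roots => //.
  by apply/allP => x _; apply/eqP; have /negP := H x; rewrite negbK => /eqP.
rewrite map_inj_uniq ?iota_uniq // => i j /eqP; rewrite eqr_nat => /eqP//.
Qed.

(** Polynomial functions without coordinates: conditions on points, on matrices and on parameters
    all fit this form. No degree is recorded, since only nonvanishing matters. *)
Definition lpoly (U : lmodType F) (f : U -> F) :=
  forall x y : U, exists p : {poly F}, forall t : F, f (x + t *: y) = p.[t].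

Section Closure.
Variable U : lmodType F.
Implicit Types f g : U -> F.

Lemma lpoly_cst c : lpoly (fun _ : U => c).
Proof. by move=> x y; exists c%:P => t; rewrite hornerC. Qed.

Lemma lpolyD f g : lpoly f -> lpoly g -> lpoly (fun x => f x + g x).
Proof.
by move=> Hf Hg x y; have [p Hp] := Hf x y; have [q Hq] := Hg x y;
  exists (p + q) => t; rewrite hornerD Hp Hq.
Qed.

Lemma lpolyM f g : lpoly f -> lpoly g -> lpoly (fun x => f x * g x).
Proof.
by move=> Hf Hg x y; have [p Hp] := Hf x y; have [q Hq] := Hg x y;
  exists (p * q) => t; rewrite hornerM Hp Hq.
Qed.

Lemma lpolyN f : lpoly f -> lpoly (fun x => - f x).
Proof.
by move=> Hf x y; have [p Hp] := Hf x y; exists (- p) => t; rewrite hornerN Hp.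
Qed.

Lemma lpolyX f n : lpoly f -> lpoly (fun x => f x ^+ n).
Proof.
by move=> Hf x y; have [p Hp] := Hf x y; exists (p ^+ n) => t;
  rewrite horner_exp Hp.
Qed.

Lemma lpoly_sum (I : eqType) (r : seq I) (f : I -> U -> F) :
  (forall i, i \in r -> lpoly (f i)) -> lpoly (fun x => \sum_(i <- r) f i x).
Proof.
elim: r => [|i r IH] H.
  by move=> x y; exists 0 => t; rewrite big_nil horner0.
move=> x y; have [p Hp] := H i (mem_head _ _) x y.
have [j Hj|q Hq] := IH _ x y; first by apply: H; rewrite inE Hj orbT.
by exists (p + q) => t; rewrite big_cons hornerD Hp Hq.
Qed.

Lemma lpoly_prod (I : eqType) (r : seq I) (f : I -> U -> F) :
  (forall i, i \in r -> lpoly (f i)) -> lpoly (fun x => \prod_(i <- r) f i x).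
Proof.
elim: r => [|i r IH] H.
  by move=> x y; exists 1 => t; rewrite big_nil hornerC.
move=> x y; have [p Hp] := H i (mem_head _ _) x y.
have [j Hj|q Hq] := IH _ x y; first by apply: H; rewrite inE Hj orbT.
by exists (p * q) => t; rewrite big_cons hornerM Hp Hq.
Qed.

(** On the line joining a point where [f] is nonzero to one where [g] is nonzero, both restrict to
    nonzero polynomials in one variable. *)
Lemma lpoly_neq0M f g : lpoly f -> lpoly g ->
  (exists x, f x != 0) -> (exists x, g x != 0) ->
  exists x, f x * g x != 0.
Proof.
move=> Hf Hg [x fx] [y gy].
have [p Hp] := Hf x (y - x); have [q Hq] := Hg x (y - x).
have p0 : p != 0.
  by apply: contraNneq fx => p0; have := Hp 0; rewrite p0 horner0 scale0r addr0 => ->.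
have q0 : q != 0.
  apply: contraNneq gy => q0; have := Hq 1.
  by rewrite q0 horner0 scale1r addrC subrK => ->.
have /poly_neq0_ex[t Ht] : p * q != 0 by rewrite mulf_neq0.
by exists (x + t *: (y - x)); rewrite Hp Hq -hornerM.
Qed.

Lemma lpoly_neq0_prod (I : eqType) (r : seq I) (f : I -> U -> F) :
  (forall i, i \in r -> lpoly (f i)) ->
  (forall i, i \in r -> exists x, f i x != 0) ->
  exists x, \prod_(i <- r) f i x != 0.
Proof.
elim: r => [|i r IH] H1 H2; first by exists 0; rewrite big_nil oner_eq0.
have h1 j : j \in r -> lpoly (f j) by move=> Hj; apply: H1; rewrite inE Hj orbT.
have [x] := lpoly_neq0M (H1 i (mem_head _ _)) (lpoly_prod h1)
  (H2 i (mem_head _ _)) (IH h1 (fun j Hj => H2 j (mem_behead (s := i :: r) Hj))).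
by move=> Hx; exists x; rewrite big_cons.
Qed.

End Closure.

Lemma lpoly_affine (U V : lmodType F) (f : V -> F) (h : {linear U -> V}) v :
  lpoly f -> lpoly (fun x => f (h x + v)).
Proof.
move=> Hf x y; have [p Hp] := Hf (h x + v) (h y); exists p => t.
by rewrite -Hp linearD linearZ /= addrAC.
Qed.

Lemma lpoly_meval (U : lmodType F) n (p : {mpoly F[n]}) (h : 'I_n -> U -> F) :
  (forall i, lpoly (h i)) -> lpoly (fun x => p.@[fun i => h i x]).
Proof.
move=> Hh x y.
have /choice[q Hq] i : exists q : {poly F}, forall t, h i (x + t *: y) = q.[t].
  exact: Hh.
exists (\sum_(m <- msupp p) p@_m *: \prod_(i < n) q i ^+ m i) => t.
rewrite mevalE horner_sum; apply: eq_bigr => m _.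
rewrite hornerZ horner_prod; congr (_ * _).
by apply: eq_bigr => i _; rewrite horner_exp Hq.
Qed.

Lemma base_expansion_inj n B (f g : nat -> nat) :
  (forall i, f i < B)%N -> (forall i, g i < B)%N ->
  (\sum_(i < n) f i * B ^ i = \sum_(i < n) g i * B ^ i)%N ->
  forall i, (i < n)%N -> f i = g i.
Proof.
elim: n f g => // n IH f g fB gB; rewrite !big_ord_recl !muln1 => E.
have shift (h : nat -> nat) :
    (\sum_(i < n) h (bump 0 i) * B ^ bump 0 i =
     (\sum_(i < n) h i.+1 * B ^ i) * B)%N.
  by rewrite big_distrl; apply: eq_bigr => i _; rewrite /bump add1n expnSr mulnA.
rewrite /= !shift in E.
have E0 : f 0%N = g 0%N.
  have := congr1 (modn^~ B) E; rewrite /= addnC modnMDl addnC modnMDl.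
  by rewrite !modn_small.
have B0 : (0 < B)%N by apply: leq_ltn_trans (fB 0%N).
move: E; rewrite E0 => /addnI /eqP; rewrite eqn_pmul2r // => /eqP E.
by case=> [//|i Hi]; apply: (IH (fun i => f i.+1) (fun i => g i.+1)).
Qed.

(* Kronecker substitution x_i = t^(B^i) separates the monomials of p. *)
Lemma mpoly_neq0_ex n (p : {mpoly F[n]}) :
  p != 0 -> exists v : 'rV[F]_n, mpoly_eval p v != 0.
Proof.
move=> p0; pose B := msize p.
pose e (m : 'X_{1..n}) := (\sum_(i < n) m i * B ^ i)%N.
have inje m m' : m \in msupp p -> m' \in msupp p -> e m = e m' -> m = m'.
  move=> Hm Hm' E; apply/mnmP => i.
  have lt (k : 'X_{1..n}) : k \in msupp p -> forall i, (nth 0%N k i < B)%N.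
    move=> Hk j; apply: leq_ltn_trans (msize_mdeg_lt Hk).
    have [jn|nj] := ltnP j n; last by rewrite nth_default // size_tuple.
    by rewrite mdegE (bigD1 (Ordinal jn)) //= (mnm_nth 0%N) leq_addr.
  rewrite !(mnm_nth 0%N).
  apply: (@base_expansion_inj n B (nth 0%N m) (nth 0%N m'));
    [exact: lt|exact: lt| |exact: ltn_ord].
  have eE k : e k = (\sum_(i < n) nth 0 k i * B ^ i)%N.
    by apply: eq_bigr => j _; rewrite (mnm_nth 0%N).
  by rewrite -!eE.
pose q : {poly F} := \sum_(m <- msupp p) p@_m *: 'X^(e m).
have [m0 Hm0] : exists m, m \in msupp p.
  by exists (mlead p); exact: mlead_supp.
have q0 : q != 0.
  suff: q`_(e m0) != 0 by apply: contra_neq => ->; rewrite coef0.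
  rewrite coef_sum (bigD1_seq m0) ?msupp_uniq //= big1_seq ?addr0.
    by rewrite coefZ coefXn eqxx mulr1 -mcoeff_msupp.
  move=> m /andP[mm0 Hm]; rewrite coefZ coefXn.
  case: eqP => [/esym E|_]; last by rewrite mulr0.
  by move: mm0; rewrite (inje _ _ Hm Hm0 E) eqxx.
have [t Ht] := poly_neq0_ex q0.
exists (\row_i t ^+ (B ^ i)); apply: contra_neq Ht.
rewrite /mpoly_eval mevalE /q horner_sum => E; rewrite -[RHS]E.
apply: eq_bigr => m _; rewrite hornerZ hornerXn; congr (_ * _).
rewrite /e expr_sum; apply: eq_bigr => i _.
by rewrite mxE -exprM mulnC.
Qed.

Lemma lpoly_mpoly_eval n (p : {mpoly F[n]}) : lpoly (mpoly_eval p).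
Proof.
apply: lpoly_meval => i; move=> x y.
exists ((x 0 i)%:P + (y 0 i)%:P * 'X) => t.
by rewrite !mxE !hornerE mulrC.
Qed.

End PolynomialOnLines.

(** * Irreducible varieties *)

Section ZariskiBasics.
Variables (F : fieldType) (d : nat).
Implicit Types (A V W Z : set 'rV[F]_d) (p q : {mpoly F[d]}).

Definition vanishes A p := forall x, A x -> mpoly_eval p x = 0.

(** The vanishing ideal is prime or the whole ring. In this form irreducibility makes sense for sets
    that are not closed, and it passes to closures and to unions of chains. *)
Definition prime_set A := forall p q, vanishes A (p * q) -> vanishes A p \/ vanishes A q.

Lemma mpoly_evalM p q x : mpoly_eval (p * q) x = mpoly_eval p x * mpoly_eval q x.
Proof. exact: mevalM. Qed.

Lemma zariski_closure_sub A : A `<=` zariski_closure A.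
Proof. by move=> x Ax p; apply. Qed.

Lemma zariski_closure_closed A : algebraic_variety (zariski_closure A).
Proof. by exists (vanishing_ideal A). Qed.

Lemma zariski_closure_min A V :
  algebraic_variety V -> A `<=` V -> zariski_closure A `<=` V.
Proof. by move=> [S ->] AV x Hx p Sp; apply: Hx => y /AV; apply. Qed.

Lemma vanishes_closure A p : vanishes A p -> vanishes (zariski_closure A) p.
Proof. by move=> H x; apply. Qed.

Lemma vanishes_sub A V p : A `<=` V -> vanishes V p -> vanishes A p.
Proof. by move=> AV H x /AV; apply: H. Qed.

Lemma closed_not_in V x : algebraic_variety V -> ~ V x ->
  exists2 p, vanishes V p & mpoly_eval p x != 0.
Proof.
move=> [S ->] /existsNP[p /not_implyP[Sp px]]; exists p; last exact/eqP.
by move=> y; apply.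
Qed.

Lemma hypersurface_closed p : algebraic_variety [set x | mpoly_eval p x = 0].
Proof.
exists [set p]; apply/seteqP; split=> x /=; first by move=> H q ->.
by apply.
Qed.

Lemma closedI V W : algebraic_variety V -> algebraic_variety W ->
  algebraic_variety (V `&` W).
Proof.
move=> [S ->] [T ->]; exists (S `|` T); apply/seteqP; split=> x /=.
  by move=> [HS HT] p [/HS|/HT].
by move=> H; split=> p Hp; apply: H; [left|right].
Qed.

Lemma irreducible_prime W : irreducible_variety W -> prime_set W.
Proof.
move=> [_ _ irr] p q H.
by apply: irr (hypersurface_closed p) (hypersurface_closed q) _ => x /H;
  rewrite mpoly_evalM => /eqP; rewrite mulf_eq0 => /orP[]/eqP; [left|right].
Qed.

Lemma prime_irreducible W : algebraic_variety W -> W !=set0 -> prime_set W ->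
  irreducible_variety W.
Proof.
move=> cW W0 pW; split=> // V1 V2 c1 c2 WV.
apply/or_asboolP/negPn; apply/negP; rewrite negb_or => /andP[].
move=> /asboolPn/existsNP[x /not_implyP[Wx V1x]].
move=> /asboolPn/existsNP[y /not_implyP[Wy V2y]].
have [p Vp px] := closed_not_in c1 V1x.
have [q Vq qy] := closed_not_in c2 V2y.
have [|/(_ _ Wx) p0|/(_ _ Wy) q0] := pW p q.
- by move=> z /WV[/Vp|/Vq]; rewrite mpoly_evalM => ->; rewrite ?mul0r ?mulr0.
- by rewrite p0 eqxx in px.
- by rewrite q0 eqxx in qy.
Qed.

Lemma prime_set_closure A : prime_set A -> prime_set (zariski_closure A).
Proof.
move=> pA p q /(vanishes_sub (@zariski_closure_sub A)) /pA[] /vanishes_closure;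
  by [left|right].
Qed.

(** Zorn's lemma for the sets with prime ideal between [Z] and [V]. If [p * q] vanishes on the union
    of a chain and [p] does not vanish on some member, then [q] vanishes on that member and on all
    larger ones. A maximal set is its own Zariski closure. *)
Lemma component_above V Z : algebraic_variety V -> irreducible_variety Z ->
  Z `<=` V -> exists2 W, irreducible_component V W & Z `<=` W.
Proof.
move=> cV irZ ZV; have [_ Z0 _] := irZ.
(* Joining [Z] settles the empty chain, whose union is [set0]. *)
pose P A := A `|` Z `<=` V /\ prime_set (A `|` Z).
have [|A [[AV pA] maxA]] := @Zorn_bigcup _ P.
  move=> G GP Gtot; split.
    by move=> x [[B GB Bx]|/ZV//]; have [+ _] := GP _ GB; apply; left.
  move=> p q pq.
  have sub B : G B -> B `|` Z `<=` \bigcup_(X in G) X `|` Z.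
    by move=> GB x [Bx|]; [left; exists B|right].
  have [|] := pselect (forall B, G B -> vanishes (B `|` Z) p).
    have [|] := pselect (exists B, G B).
      move=> [B0 GB0] H; left => x [[B GB Bx]|Zx].
        by apply: (H B GB); left.
      by apply: (H B0 GB0); right.
    move=> nG _; have /irreducible_prime pZ := irZ.
    have bZ : \bigcup_(X in G) X `|` Z = Z.
      apply/seteqP; split=> x; last by right.
      by case=> // -[B GB]; case: nG; exists B.
    by rewrite bZ in pq *; apply: pZ.
  move=> /existsNP[B1 /not_implyP[GB1 nB1]]; right.
  have q1 B : G B -> B1 `<=` B -> vanishes (B `|` Z) q.
    move=> GB B1B; have [_ pB] := GP _ GB.
    have [|H|//] := pB p q; first exact: vanishes_sub (sub _ GB) pq.
    case: nB1; apply: vanishes_sub H => x [/B1B|]; [by left|by right].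
  move=> x [[B GB Bx]|Zx]; last by apply: (q1 B1 GB1) => //; right.
  have [BB1|B1B] := Gtot _ _ GB GB1.
    by apply: (q1 B1 GB1) => //; left; apply: BB1.
  by apply: (q1 B GB) => //; left.
pose W := zariski_closure (A `|` Z).
have WV : W `<=` V by exact: zariski_closure_min.
have AW : A `|` Z `<=` W by exact: zariski_closure_sub.
have WZ : W `|` Z = W.
  by apply/setUidl => x Zx; apply: AW; right.
have irW : irreducible_variety W.
  apply: prime_irreducible; [exact: zariski_closure_closed| |].
    by case: Z0 => x Zx; exists x; apply: AW; right.
  exact: prime_set_closure.
have maxW W' : irreducible_variety W' -> W' `<=` V -> A `|` Z `<=` W' -> W' = A `|` Z.
  move=> irW' W'V AW'.
  have W'Z : W' `|` Z = W' by apply/setUidl => x Zx; apply: AW'; right.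
  have PW' : P W' by rewrite /P W'Z; split=> //; apply: irreducible_prime.
  apply/seteqP; split=> //.
  have AW'' : A `<=` W' by move=> x Ax; apply: AW'; left.
  have [W'A|W'A] := pselect (W' `<=` A); first by move=> x /W'A; left.
  by case: (maxA W').
exists W; last by move=> x Zx; apply: AW; right.
split=> // W' irW' W'V WW'.
have E := maxW _ irW WV AW.
by rewrite {1}E; apply: maxW => // x /AW; apply: WW'.
Qed.

End ZariskiBasics.

Section Flats.
Variables (F : numFieldType) (d : nat).

Lemma flat_closed k (A : set 'rV[F]_d) : is_flat k A -> algebraic_variety A.
Proof.
move=> [a [M [_ ->]]].
(* The columns of [cokermx M] are equations of the row space of [M]. *)
pose e j : {mpoly F[d]} := \sum_i (cokermx M i j) *: ('X_i - (a 0 i)%:MP).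
have eE j x : mpoly_eval (e j) x = ((x - a) *m cokermx M) 0 j.
  rewrite /mpoly_eval /e raddf_sum mxE; apply: eq_bigr => i _.
  by rewrite /= mevalZ mevalB mevalXU mevalC !mxE mulrC.
exists (range e); apply/seteqP; split=> x /=.
  move=> [c ->] _ [j _ <-]; rewrite eE addrC addKr -mulmxA mulmx_coker.
  by rewrite mulmx0 mxE.
move=> H; have : (x - a <= M)%MS.
  rewrite submxE; apply/eqP/rowP => j; rewrite [RHS]mxE -eE; apply: H.
  by exists j.
by move=> /submxP[c Hc]; exists c; rewrite -Hc addrC subrK.
Qed.

(** Polynomials pulled back to the parameter space are [lpoly] functions, and a product of two
    nonzero ones is nonzero. *)
Lemma flat_irreducible k (A : set 'rV[F]_d) : is_flat k A -> irreducible_variety A.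
Proof.
move=> fA; apply: prime_irreducible (flat_closed fA) _ _.
  by have [a [M [_ ->]]] := fA; exists a, 0; rewrite mul0mx addr0.
have [a [M [_ ->]]] := fA => p q pq.
apply/or_asboolP/negPn; apply/negP; rewrite negb_or => /andP[].
move=> /asboolPn/existsNP[_ /not_implyP[[x ->] px]].
move=> /asboolPn/existsNP[_ /not_implyP[[y ->] qy]].
have lp r : lpoly (fun c : 'rV[F]_k => mpoly_eval r (a + c *m M)).
  have := @lpoly_affine F _ _ _ (mulmxr M) a (lpoly_mpoly_eval r).
  by move=> H u v; have [s Hs] := H u v; exists s => t; rewrite -Hs /= addrC.
have [|c] := lpoly_neq0M (lp p) (lp q) (ex_intro _ x (introN eqP px)).
  by exists y; apply/eqP.
by rewrite -mpoly_evalM pq ?eqxx //; exists c.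
Qed.

Lemma point_flat (a : 'rV[F]_d) : is_flat 0 [set a].
Proof.
exists a, 0; split; first by rewrite /row_free mxrank0.
apply/seteqP; split=> x /=; first by move=> ->; exists 0; rewrite mul0mx addr0.
by move=> [c ->]; rewrite mulmx0 addr0.
Qed.

End Flats.

(** * Noetherianity *)

(** Each chosen index minimizes [f] over the remaining tail, so its value bounds all later ones from
    below. *)
Lemma nondecreasing_subsequence (f : nat -> nat) : exists2 h : nat -> nat,
  {homo h : i j / (i < j)%N} & {homo (f \o h) : i j / (i <= j)%N}.
Proof.
have /choice[g Hg] N : exists n, (N <= n)%N /\ forall m, (N <= m)%N -> (f n <= f m)%N.
  have ex : exists v, `[< exists2 n, (N <= n)%N & f n = v >].
    by exists (f N); apply/asboolP; exists N.
  have [v /asboolP[n Nn fn] minv] := ex_minnP ex.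
  exists n; split=> // m Nm; rewrite fn; apply: minv.
  by apply/asboolP; exists m.
pose h := fix h k := if k is k'.+1 then g (h k').+1 else g 0%N.
have hlt : {homo h : i j / (i < j)%N}.
  by apply: homo_ltn; [exact: ltn_trans|move=> i; case: (Hg (h i).+1)].
exists h => // i j ij /=.
have low : exists2 N, (N <= h i)%N & h i = g N.
  by case: i {ij} => [|i]; [exists 0%N|exists (h i).+1 => //; case: (Hg (h i).+1)].
have [N _ E] := low; have [Nle fmin] := Hg N.
rewrite E fmin //; apply: leq_trans Nle _; rewrite -E.
by move: ij; rewrite leq_eqVlt => /orP[/eqP->//|/hlt/ltnW].
Qed.

(** Nondecreasing subsequences are extracted for one exponent after another; in the last subsequence
    any two terms are comparable. *)
Lemma dickson d (m : nat -> 'X_{1..d}) : exists i j, (i < j)%N /\ (m i <= m j)%MM.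
Proof.
have sub (s : seq 'I_d) : exists2 h : nat -> nat, {homo h : i j / (i < j)%N} &
    forall l, l \in s -> {homo (fun i => m (h i) l) : i j / (i <= j)%N}.
  elim: s => [|l s [h h1 h2]]; first by exists id.
  have [k k1 k2] := nondecreasing_subsequence (fun i => m (h i) l).
  exists (h \o k) => [i j ij|l']; first by apply: h1; apply: k1.
  rewrite inE => /orP[/eqP->|l's] i j ij; first exact: k2.
  apply: (h2 _ l's); move: ij; rewrite leq_eqVlt => /orP[/eqP->//|/k1/ltnW//].
have [h h1 h2] := sub (enum 'I_d).
exists (h 0%N), (h 1%N); split; first exact: h1.
by apply/mnm_lepP => l; apply: (h2 l); rewrite ?mem_enum.
Qed.

Section HilbertBasis.
Variables (F : fieldType) (d : nat).
Implicit Types (p q f g : {mpoly F[d]}) (V W Z : set 'rV[F]_d).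

(** Only the consequence for common zeros is kept. By Dickson's lemma, finitely many elements of [I]
    suffice for every leading monomial of [I] to be divisible by one of theirs; subtracting
    multiples of them then lowers the leading monomial, and the monomial order is well-founded. *)
Lemma hilbert_basis (I : set {mpoly F[d]}) :
  (forall f g, I f -> I g -> I (f - g)) -> (forall p f, I f -> I (p * f)) ->
  exists2 gs : seq {mpoly F[d]}, forall g, g \in gs -> I g &
    forall f x, I f -> (forall g, g \in gs -> mpoly_eval g x = 0) ->
      mpoly_eval f x = 0.
Proof.
move=> IB IM.
pose ok (gs : seq {mpoly F[d]}) := forall g, g \in gs -> I g /\ g != 0.
have [gs ok_gs Hgs] : exists2 gs : seq {mpoly F[d]}, ok gs &
    forall f, I f -> f != 0 -> exists2 g, g \in gs & (mlead g <= mlead f)%MM.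
  apply: contrapT => /forall2NP H.
  have /choice[nxt Hn] gs : exists f, ok gs ->
      [/\ I f, f != 0 & forall g, g \in gs -> ~~ (mlead g <= mlead f)%MM].
    have [okg|nok] := pselect (ok gs); last by exists 0.
    case: (H gs) => // /existsNP[f /not_implyP[If /not_implyP[f0 nf]]].
    by exists f => _; split=> // g ggs; apply/negP => le; apply: nf; exists g.
  pose s := fix s k := if k is k'.+1 then nxt (s k') :: s k' else [::].
  have oks k : ok (s k).
    elim: k => //= k IH g; rewrite inE => /orP[/eqP->|/IH//].
    by have [] := Hn _ IH.
  have [i [j [ij le]]] := dickson (fun k => mlead (nxt (s k))).
  have : nxt (s i) \in s j.
    elim: j ij {le} => // j IH; rewrite ltnS leq_eqVlt /= inE => /orP[/eqP->|/IH->].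
      by rewrite eqxx.
    by rewrite orbT.
  by have [_ _ h] := Hn _ (oks j) => /h; rewrite le.
exists gs => [g /ok_gs[]//|f x + gx].
have : Acc (fun a b : 'X_{1..d} => a < b)%O (mlead f) by apply: ltom_wf.
move Em : (mlead f) => m A; elim: A f Em => {}m _ IH f Em If.
have [->|f0] := eqVneq f 0; first by rewrite /mpoly_eval meval0.
have [g ggs le] := Hgs f If f0; have [Ig g0] := ok_gs g ggs.
pose c := mleadc f / mleadc g.
(* [q] has the same leading term as [f] and vanishes at [x]. *)
pose q := c *: 'X_[mlead f - mlead g] * g.
have lc0 h : h != 0 -> mleadc h != 0 by rewrite mleadc_eq0.
have c0 : c != 0 by rewrite mulf_neq0 ?invr_eq0 ?lc0.
have q0 : c *: 'X_[mlead f - mlead g] != 0 :> {mpoly F[d]}.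
  by rewrite scaler_eq0 negb_or c0 /= -msupp_eq0 msuppX.
have lq : mlead q = mlead f.
  by rewrite /q mleadM // mleadZ // mleadXm submK.
have lcq : mleadc q = mleadc f.
  rewrite /q [mlead _]mleadM // mleadcM mleadcZE mleadXm mcoeffX eqxx mulr1.
  by rewrite divfK ?lc0.
have -> : mpoly_eval f x = mpoly_eval (f - q) x.
  rewrite /mpoly_eval mevalB /q mevalM -[X in _ - _ * X]/(mpoly_eval g x).
  by rewrite gx // mulr0 subr0.
have Ifq : I (f - q) by apply: IB => //; apply: IM.
have [->|fq0] := eqVneq (f - q) 0; first by rewrite /mpoly_eval meval0.
apply: (IH (mlead (f - q))) => //; rewrite -Em lt_neqAle; apply/andP; split.
  apply/eqP => E; have := lc0 _ _ _ fq0; apply/negP; rewrite negbK; apply/eqP.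
  by rewrite E mcoeffB -{2}lq lcq subrr.
by have := mleadB_le f q; rewrite lq joinxx.
Qed.

Lemma vanishesB V p q : vanishes V p -> vanishes V q -> vanishes V (p - q).
Proof.
by move=> Hp Hq x Vx; rewrite /mpoly_eval mevalB -!/(mpoly_eval _ _) Hp ?Hq ?subr0.
Qed.

Lemma vanishesM V p q : vanishes V q -> vanishes V (p * q).
Proof. by move=> Hq x Vx; rewrite mpoly_evalM Hq ?mulr0. Qed.

Lemma closed_finite V : algebraic_variety V -> exists gs : seq {mpoly F[d]},
  V = [set x | forall g, g \in gs -> mpoly_eval g x = 0].
Proof.
move=> cV.
have [gs gsV Hgs] := hilbert_basis (@vanishesB V) (@vanishesM V).
exists gs; apply/seteqP; split=> x /=; first by move=> Vx g /gsV; apply.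
move=> Hx; apply: contrapT => /(closed_not_in cV)[p Vp].
by rewrite (Hgs p) ?eqxx.
Qed.

(** Along a strictly decreasing sequence the vanishing ideals have an ideal as their union. A finite
    basis of it vanishes already at some stage [N], so stage [N + 1] cannot be smaller. *)
Lemma minimal_closed (P : set (set 'rV[F]_d)) V : algebraic_variety V -> P V ->
  exists Z, [/\ algebraic_variety Z, Z `<=` V, P Z &
    forall Y, algebraic_variety Y -> Y `<=` Z -> P Y -> Y = Z].
Proof.
move=> cV PV; apply: contrapT => nex.
pose T := {Z : set 'rV[F]_d | [/\ algebraic_variety Z, Z `<=` V & P Z]}.
have /choice[nxt Hn] (Z : T) : exists Y : T, sval Y `<` sval Z.
  case: Z => Z [cZ ZV PZ] /=; apply: contrapT => nY; apply: nex.
  exists Z; split=> // Y cY YZ PY; apply: contrapT => YneZ; apply: nY.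
  have TY : [/\ algebraic_variety Y, Y `<=` V & P Y].
    by split=> // x /YZ/ZV.
  by exists (exist _ Y TY); split=> //= ZY; apply: YneZ; apply/seteqP.
have TV : [/\ algebraic_variety V, V `<=` V & P V] by split.
pose s := fix s k := if k is k'.+1 then nxt (s k') else exist _ V TV : T.
pose S k := sval (s k).
have Sdec i j : (i <= j)%N -> S j `<=` S i.
  move=> /subnK<-; elim: (j - i)%N => // k IH; apply: subset_trans IH.
  by rewrite addSn; have [] := Hn (s (k + i)%N).
pose I : set {mpoly F[d]} := [set p | exists k, vanishes (S k) p].
have [f g|p f [k Hk]|gs gsI Hgs] := @hilbert_basis I.
- move=> [i Hi] [j Hj]; exists (maxn i j); apply: vanishesB.
    by apply: vanishes_sub Hi; apply: Sdec; rewrite leq_maxl.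
  by apply: vanishes_sub Hj; apply: Sdec; rewrite leq_maxr.
- by exists k; apply: vanishesM.
have [N HN] : exists N, forall g, g \in gs -> vanishes (S N) g.
  elim: gs gsI {Hgs} => [|g gs IH] gsI; first by exists 0%N.
  have [|N HN] := IH; first by move=> h hgs; apply: gsI; rewrite inE hgs orbT.
  have [k Hk] := gsI g (mem_head _ _).
  exists (maxn N k) => h; rewrite inE => /orP[/eqP->|/HN H].
    by apply: vanishes_sub Hk; apply: Sdec; rewrite leq_maxr.
  by apply: vanishes_sub H; apply: Sdec; rewrite leq_maxl.
have [SN SNn] := Hn (s N); apply: SNn => x Sx.
have [cS _ _] := svalP (s N.+1).
apply: contrapT => /(closed_not_in cS)[p Vp]; rewrite (Hgs p x) ?eqxx //.
  by exists N.+1.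
by move=> g /HN; apply.
Qed.

End HilbertBasis.

(** * Images of varieties under polynomial maps *)

Section TermPolynomials.
Variable F : fieldType.

(** Inverses get a dummy value, as the translation serves inverse-free terms ([GRing.rterm]). A
    variable of index at least [q] becomes 0, the default read beyond the end of [env y]. *)
Fixpoint mpoly_of_term q (t : GRing.term F) : {mpoly F[q]} :=
  match t with
  | GRing.Var i => if insub i is Some j then 'X_(j : 'I_q) else 0
  | GRing.Const c => c%:MP
  | GRing.NatConst n => n%:R
  | GRing.Add t1 t2 => mpoly_of_term q t1 + mpoly_of_term q t2
  | GRing.Opp t1 => - mpoly_of_term q t1
  | GRing.NatMul t1 n => mpoly_of_term q t1 *+ n
  | GRing.Mul t1 t2 => mpoly_of_term q t1 * mpoly_of_term q t2
  | GRing.Inv t1 => 0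
  | GRing.Exp t1 n => mpoly_of_term q t1 ^+ n
  end.

Definition env q (y : 'I_q -> F) : seq F := codom y.

Lemma env_nth q (y : 'I_q -> F) (i : 'I_q) : (env y)`_i = y i.
Proof. by rewrite /env codomE (nth_map i) ?size_enum_ord // nth_ord_enum. Qed.

Lemma size_env q (y : 'I_q -> F) : size (env y) = q.
Proof. by rewrite size_codom card_ord. Qed.

Lemma eval_mpoly_of_term q (y : 'I_q -> F) t : GRing.rterm t ->
  GRing.eval (env y) t = (mpoly_of_term q t).@[y].
Proof.
elim: t => //=.
- move=> i _; case: insubP => [j _ <-|]; first by rewrite mevalXU env_nth.
  by rewrite -leqNgt => qi; rewrite meval0 nth_default ?size_env.
- by move=> c _; rewrite mevalC.
- by move=> n _; rewrite rmorph_nat.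
- by move=> t1 IH1 t2 IH2 /andP[/IH1-> /IH2->]; rewrite mevalD.
- by move=> t1 IH1 /IH1->; rewrite mevalN.
- by move=> t1 IH1 n /IH1->; rewrite mevalMn.
- by move=> t1 IH1 t2 IH2 /andP[/IH1-> /IH2->]; rewrite mevalM.
- by move=> t1 IH1 n /IH1->; rewrite rmorphXn.
Qed.

(** Variable [i] is numbered [k + i]: the first [k] places of the environment are reserved for the
    coordinates of the image point. *)
Definition term_of_mpoly k d (p : {mpoly F[d]}) : GRing.term F :=
  foldr (fun m t => GRing.Add (GRing.Mul (GRing.Const p@_m)
    (foldr (fun (i : 'I_d) u => GRing.Mul (GRing.Exp (GRing.Var F (k + i)) (m i)) u)
       (GRing.NatConst _ 1) (enum 'I_d))) t) (GRing.NatConst F 0) (msupp p).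

Lemma rterm_of_mpoly k d (p : {mpoly F[d]}) : GRing.rterm (term_of_mpoly k p).
Proof.
rewrite /term_of_mpoly; elim: (msupp p) => //= m s ->; rewrite andbT.
by elim: (enum _).
Qed.

Lemma eval_term_of_mpoly k d (p : {mpoly F[d]}) (e : seq F) :
  GRing.eval e (term_of_mpoly k p) = p.@[fun i => e`_(k + i)].
Proof.
rewrite mevalE /term_of_mpoly; elim: (msupp p) => /= [|m s ->].
  by rewrite big_nil.
rewrite big_cons; congr (_ * _ + _).
have -> : \prod_(i < d) e`_(k + i) ^+ m i = \prod_(i <- enum 'I_d) e`_(k + i) ^+ m i.
  by rewrite big_enum.
by elim: (enum _) => /= [|i r ->]; rewrite ?big_nil ?big_cons.
Qed.

End TermPolynomials.

Section ImageOfClosedSet.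
Variables (F : fieldType) (d q : nat) (h : 'I_q -> {mpoly F[d]}).

Definition in_poly_image (W : set 'rV[F]_d) (y : 'I_q -> F) :=
  exists2 x, W x & forall i, mpoly_eval (h i) x = y i.

(** This is the meaning of a block of existential quantifiers over the variables from [q] to
    [q + d - 1], which hold [x]; the free variables below [q] hold [y]. *)
Lemma in_poly_imageP (gs : seq {mpoly F[d]}) (y : 'I_q -> F) :
  in_poly_image [set x | forall g, g \in gs -> mpoly_eval g x = 0] y <->
  exists e' : seq F, [/\ {in [predC iota q d], GRing.same_env (env y) e'},
    forall g, g \in gs -> GRing.eval e' (term_of_mpoly q g) = 0 &
    forall i : 'I_q, GRing.eval e' (term_of_mpoly q (h i)) = e'`_i].
Proof.
split=> [[x Hx hx]|[e' [He Hg Hh]]].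
  have Ex (p : {mpoly F[d]}) :
      GRing.eval (env y ++ env (fun i => x 0 i)) (term_of_mpoly q p) = mpoly_eval p x.
    rewrite eval_term_of_mpoly; apply: meval_eq => i.
    by rewrite nth_cat size_env ltnNge leq_addr addKn env_nth.
  exists (env y ++ env (fun i => x 0 i)); split.
  - move=> j; rewrite !inE mem_iota negb_and -ltnNge -leqNgt nth_cat size_env.
    case: ltnP => // qj dj; rewrite !nth_default ?size_env //.
    by rewrite leq_subRL.
  - by move=> g /Hx; rewrite Ex.
  - by move=> i; rewrite Ex hx nth_cat size_env ltn_ord env_nth.
have Ex (p : {mpoly F[d]}) :
    GRing.eval e' (term_of_mpoly q p) = mpoly_eval p (\row_i e'`_(q + i)).
  by rewrite eval_term_of_mpoly; apply: meval_eq => i; rewrite mxE.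
exists (\row_i e'`_(q + i)) => [g /Hg|i]; first by rewrite Ex.
by rewrite -Ex Hh -He ?env_nth // !inE mem_iota leqNgt ltn_ord.
Qed.

End ImageOfClosedSet.

Section ComplexElimination.
Variables (F : closedFieldType) (d q : nat) (h : 'I_q -> {mpoly F[d]}).

Let qelim := GRing.quantifier_elim (@ClosedFieldQE.ex_elim F).

Lemma qf_eval_pattern (f : GRing.formula F) :
  GRing.qf_form f -> GRing.rformula f ->
  exists ps : seq {mpoly F[q]}, forall y y' : 'I_q -> F,
    (forall p, p \in ps -> (p.@[y] == 0) = (p.@[y'] == 0)) ->
    GRing.qf_eval (env y) f = GRing.qf_eval (env y') f.
Proof.
elim: f => //=.
- by exists [::].
- move=> t1 t2 _ /andP[r1 r2]; exists [:: mpoly_of_term q t1 - mpoly_of_term q t2].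
  move=> y y' /(_ _ (mem_head _ _)); rewrite !mevalB !subr_eq0.
  by rewrite -!eval_mpoly_of_term.
- move=> f1 IH1 f2 IH2 /andP[/IH1 + /IH2 +] /andP[r1 r2].
  move=> /(_ r1)[s1 H1] /(_ r2)[s2 H2]; exists (s1 ++ s2) => y y' H.
  by rewrite (H1 y y') ?(H2 y y') // => p Hp; apply: H; rewrite mem_cat Hp ?orbT.
- move=> f1 IH1 f2 IH2 /andP[/IH1 + /IH2 +] /andP[r1 r2].
  move=> /(_ r1)[s1 H1] /(_ r2)[s2 H2]; exists (s1 ++ s2) => y y' H.
  by rewrite (H1 y y') ?(H2 y y') // => p Hp; apply: H; rewrite mem_cat Hp ?orbT.
- move=> f1 IH1 f2 IH2 /andP[/IH1 + /IH2 +] /andP[r1 r2].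
  move=> /(_ r1)[s1 H1] /(_ r2)[s2 H2]; exists (s1 ++ s2) => y y' H.
  by rewrite (H1 y y') ?(H2 y y') // => p Hp; apply: H; rewrite mem_cat Hp ?orbT.
- move=> f1 IH1 /IH1 + r1 => /(_ r1)[s1 H1]; exists s1 => y y' H.
  by rewrite (H1 y y').
Qed.

(** Chevalley's theorem: after elimination of quantifiers, membership in the image depends only on
    which atoms vanish. *)
Lemma image_vanishing_pattern (W : set 'rV[F]_d) : algebraic_variety W ->
  exists ps : seq {mpoly F[q]}, forall y y' : 'I_q -> F,
    (forall p, p \in ps -> (p.@[y] == 0) = (p.@[y'] == 0)) ->
    in_poly_image h W y -> in_poly_image h W y'.
Proof.
move=> /closed_finite[gs ->].
pose base := GRing.And
  (foldr (fun g f => GRing.And (GRing.Equal (term_of_mpoly q g) (GRing.NatConst F 0)) f)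
     (GRing.Bool true) gs)
  (foldr (fun (i : 'I_q) f => GRing.And (GRing.Equal (term_of_mpoly q (h i)) (GRing.Var F i)) f)
     (GRing.Bool true) (enum 'I_q)).
pose f := foldr GRing.Exists base (iota q d).
have rb : GRing.rformula base.
  apply/andP; split; [elim: (gs)|elim: (enum _)] => //= a s ->.
    by rewrite rterm_of_mpoly.
  by rewrite rterm_of_mpoly.
have rf : GRing.rformula f by rewrite /f; elim: (iota q d) => //=.
have [qf_f rq] := andP (GRing.quantifier_elim_wf (@ClosedFieldQE.wf_ex_elim F) rf).
have [ps Hps] := qf_eval_pattern qf_f rq.
exists ps => y y' /Hps E.
have okP (y0 : 'I_q -> F) : reflect (in_poly_image h
    [set x | forall g, g \in gs -> mpoly_eval g x = 0] y0)
    (GRing.qf_eval (env y0) (qelim f)).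
  have V := @ClosedFieldQE.holds_ex_elim F (@solve_monicpoly F).
  apply: equivP (GRing.quantifier_elim_rformP (@ClosedFieldQE.wf_ex_elim F) V _ rf) _.
  rewrite in_poly_imageP /f -GRing.foldExistsP.
  have hb e' : GRing.holds e' base <->
     (forall g, g \in gs -> GRing.eval e' (term_of_mpoly q g) = 0) /\
     (forall i : 'I_q, GRing.eval e' (term_of_mpoly q (h i)) = e'`_i).
    rewrite /base /=.
    have -> : (forall i : 'I_q, GRing.eval e' (term_of_mpoly q (h i)) = e'`_i) <->
       (forall i : 'I_q, i \in enum 'I_q ->
          GRing.eval e' (term_of_mpoly q (h i)) = e'`_i).
      by split=> H i; [move=> _; apply: H|apply: H; rewrite mem_enum].
    split=> -[H1 H2]; split.
    - elim: (gs) H1 => //= g s IH [Hg Hs] g'; rewrite inE => /orP[/eqP->//|].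
      exact: IH.
    - elim: (enum _) H2 => //= g s IH [Hg Hs] g'; rewrite inE => /orP[/eqP->//|].
      exact: IH.
    - elim: (gs) H1 => //= g s IH H; split; first by rewrite H ?mem_head.
      by apply: IH => g' Hg; apply: H; rewrite inE Hg orbT.
    - elim: (enum _) H2 => //= g s IH H; split; first by rewrite H ?mem_head.
      by apply: IH => g' Hg; apply: H; rewrite inE Hg orbT.
  split=> [[e' He /hb[H1 H2]]|[e' [He H1 H2]]]; exists e' => //.
  exact/hb.
by move=> /okP H; apply/okP; rewrite -E.
Qed.

End ComplexElimination.

Section RealElimination.
Variables (F : rcfType) (d q : nat) (h : 'I_q -> {mpoly F[d]}).
Import ordered_qelim.

Lemma ord_foldExistsP I (e : seq F) (f : ord.formula F) :
  (exists2 e', {in [predC I], GRing.same_env e e'} & ord.holds e' f)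
    <-> ord.holds e (foldr (@ord.Exists F) f I).
Proof.
elim: I e => /= [|i I IHi] e.
  by split=> [[e' eq_e] |]; [apply: ord.eq_holds => i; rewrite eq_e | exists e].
split=> [[e' eq_e f_e'] | [x]]; last set e_x := set_nth 0 e i x.
  exists e'`_i; apply/IHi; exists e' => // j.
  by have:= eq_e j; rewrite nth_set_nth /= !inE; case: eqP => // ->.
case/IHi=> e' eq_e f_e'; exists e' => // j.
by have:= eq_e j; rewrite nth_set_nth /= !inE; case: eqP.
Qed.

Let qelim :=
  ord.quantifier_elim (fun n s => qe_rcf.qfr_to_formula (@qe_rcf.wproj F n s)).

Lemma qf_eval_sign_pattern (f : ord.formula F) :
  ord.qf_form f -> ord.rformula f ->
  exists ps : seq {mpoly F[q]}, forall y y' : 'I_q -> F,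
    (forall p, p \in ps -> Num.sg p.@[y] = Num.sg p.@[y']) ->
    ord.qf_eval (env y) f = ord.qf_eval (env y') f.
Proof.
elim: f => //=.
- by exists [::].
- move=> t1 t2 _ /andP[r1 r2]; exists [:: mpoly_of_term q t1 - mpoly_of_term q t2].
  move=> y y' /(_ _ (mem_head _ _)); rewrite !mevalB -!eval_mpoly_of_term // => E.
  by rewrite -!(subr_eq0 (GRing.eval _ t1)) -!(sgr_eq0 (_ - _)) E.
- move=> t1 t2 _ /andP[r1 r2]; exists [:: mpoly_of_term q t2 - mpoly_of_term q t1].
  move=> y y' /(_ _ (mem_head _ _)); rewrite !mevalB -!eval_mpoly_of_term // => E.
  by rewrite -!(subr_gt0 (GRing.eval _ t1)) -!(sgr_gt0 (_ - _)) E.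
- move=> t1 t2 _ /andP[r1 r2]; exists [:: mpoly_of_term q t2 - mpoly_of_term q t1].
  move=> y y' /(_ _ (mem_head _ _)); rewrite !mevalB -!eval_mpoly_of_term // => E.
  by rewrite -!(subr_ge0 (GRing.eval _ t1)) -!(sgr_ge0 (_ - _)) E.
- move=> f1 IH1 f2 IH2 /andP[/IH1 + /IH2 +] /andP[r1 r2].
  move=> /(_ r1)[s1 H1] /(_ r2)[s2 H2]; exists (s1 ++ s2) => y y' H.
  by rewrite (H1 y y') ?(H2 y y') // => p Hp; apply: H; rewrite mem_cat Hp ?orbT.
- move=> f1 IH1 f2 IH2 /andP[/IH1 + /IH2 +] /andP[r1 r2].
  move=> /(_ r1)[s1 H1] /(_ r2)[s2 H2]; exists (s1 ++ s2) => y y' H.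
  by rewrite (H1 y y') ?(H2 y y') // => p Hp; apply: H; rewrite mem_cat Hp ?orbT.
- move=> f1 IH1 f2 IH2 /andP[/IH1 + /IH2 +] /andP[r1 r2].
  move=> /(_ r1)[s1 H1] /(_ r2)[s2 H2]; exists (s1 ++ s2) => y y' H.
  by rewrite (H1 y y') ?(H2 y y') // => p Hp; apply: H; rewrite mem_cat Hp ?orbT.
- move=> f1 IH1 /IH1 + r1 => /(_ r1)[s1 H1]; exists s1 => y y' H.
  by rewrite (H1 y y').
Qed.

(** The theorem of Tarski and Seidenberg: over a real closed field the atoms are decided by
    signs. *)
Lemma image_sign_pattern (W : set 'rV[F]_d) : algebraic_variety W ->
  exists ps : seq {mpoly F[q]}, forall y y' : 'I_q -> F,
    (forall p, p \in ps -> Num.sg p.@[y] = Num.sg p.@[y']) ->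
    in_poly_image h W y -> in_poly_image h W y'.
Proof.
move=> /closed_finite[gs ->].
pose base := ord.And
  (foldr (fun g f => ord.And (ord.Equal (term_of_mpoly q g) (GRing.NatConst F 0)) f)
     (ord.Bool true) gs)
  (foldr (fun (i : 'I_q) f => ord.And (ord.Equal (term_of_mpoly q (h i)) (GRing.Var F i)) f)
     (ord.Bool true) (enum 'I_q)).
pose f := foldr (@ord.Exists F) base (iota q d).
have rb : ord.rformula base.
  apply/andP; split; [elim: (gs)|elim: (enum _)] => //= a s ->.
    by rewrite rterm_of_mpoly.
  by rewrite rterm_of_mpoly.
have rf : ord.rformula f by rewrite /f; elim: (iota q d) => //=.
have [qf_f rq] := andP (ord.quantifier_elim_wf (@qe_rcf.wf_QE_wproj F) rf).
have [ps Hps] := qf_eval_sign_pattern qf_f rq.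
exists ps => y y' /Hps E.
have okP (y0 : 'I_q -> F) : reflect (in_poly_image h
    [set x | forall g, g \in gs -> mpoly_eval g x = 0] y0)
    (ord.qf_eval (env y0) (qelim f)).
  apply: equivP (ord.quantifier_elim_rformP (@qe_rcf.wf_QE_wproj F)
    (@qe_rcf.valid_QE_wproj F) _ rf) _.
  rewrite in_poly_imageP /f -ord_foldExistsP.
  have hb e' : ord.holds e' base <->
     (forall g, g \in gs -> GRing.eval e' (term_of_mpoly q g) = 0) /\
     (forall i : 'I_q, GRing.eval e' (term_of_mpoly q (h i)) = e'`_i).
    rewrite /base /=.
    have -> : (forall i : 'I_q, GRing.eval e' (term_of_mpoly q (h i)) = e'`_i) <->
       (forall i : 'I_q, i \in enum 'I_q ->
          GRing.eval e' (term_of_mpoly q (h i)) = e'`_i).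
      by split=> H i; [move=> _; apply: H|apply: H; rewrite mem_enum].
    split=> -[H1 H2]; split.
    - elim: (gs) H1 => //= g s IH [Hg Hs] g'; rewrite inE => /orP[/eqP->//|].
      exact: IH.
    - elim: (enum _) H2 => //= g s IH [Hg Hs] g'; rewrite inE => /orP[/eqP->//|].
      exact: IH.
    - elim: (gs) H1 => //= g s IH H; split; first by rewrite H ?mem_head.
      by apply: IH => g' Hg; apply: H; rewrite inE Hg orbT.
    - elim: (enum _) H2 => //= g s IH H; split; first by rewrite H ?mem_head.
      by apply: IH => g' Hg; apply: H; rewrite inE Hg orbT.
  split=> [[e' He /hb[H1 H2]]|[e' [He H1 H2]]]; exists e' => //.
  exact/hb.
by move=> /okP H; apply/okP; rewrite -E.
Qed.

End RealElimination.

(** * Chains in real varieties *)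

Definition algdep (F : fieldType) (T : Type) (W : set T) q (z : 'I_q -> T -> F) :=
  exists2 P : {mpoly F[q]}, P != 0 & forall x, W x -> P.@[fun i => z i x] = 0.

Section SmallParameter.
Variable F : rcfType.

Lemma sgr_poly_near0 (p : {poly F}) : p.[0] != 0 ->
  exists2 e, 0 < e & forall t, 0 < t -> t < e -> Num.sg p.[t] = Num.sg p.[0].
Proof.
move=> p0; have [|e e0 He] := @poly_cont F 0 p `|p.[0]|; first by rewrite normr_gt0.
exists e => // t t0 te; have := He t; rewrite subr0 gtr0_norm // => /(_ te).
rewrite ltr_norml; have [lt0|gt0|/eqP] := ltrgtP p.[0] 0; last by rewrite (negPf p0).
- rewrite ltr0_norm // => /andP[_]; rewrite ltrBlDr addNr => pt.
  by rewrite !ltr0_sg.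
- rewrite gtr0_norm // => /andP[]; rewrite ltrBrDr addNr => pt _.
  by rewrite !gtr0_sg.
Qed.

Lemma sgr_polys_near0 (ps : seq {poly F}) : (forall p, p \in ps -> p.[0] != 0) ->
  exists2 e, 0 < e & forall t, 0 < t -> t < e ->
    forall p, p \in ps -> Num.sg p.[t] = Num.sg p.[0].
Proof.
elim: ps => [|p ps IH] H; first by exists 1.
have [|e e0 He] := IH; first by move=> r rps; apply: H; rewrite inE rps orbT.
have [e' e'0 He'] := sgr_poly_near0 (H p (mem_head _ _)).
exists (Num.min e e'); first by rewrite lt_min e0.
move=> t t0; rewrite lt_min => /andP[te te'] r; rewrite inE => /orP[/eqP->|].
  exact: He'.
exact: He.
Qed.

Lemma poly_eq0_near0 (p : {poly F}) e : 0 < e ->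
  (forall t, 0 < t -> t < e -> p.[t] = 0) -> p = 0.
Proof.
move=> e0 H; apply/eqP; apply: contraT => p0.
suff: (size [seq e / i.+2%:R : F | i <- iota 0 (size p)] < size p)%N.
  by rewrite size_map size_iota ltnn.
apply: max_poly_roots => //.
  apply/allP => _ /mapP[i _ ->]; apply/eqP; apply: H.
    by rewrite divr_gt0 ?ltr0n.
  by rewrite ltr_pdivrMr ?ltr0n // ltr_pMr // ltr1n.
rewrite map_inj_uniq ?iota_uniq // => i j /(mulfI (lt0r_neq0 e0)) /invr_inj /eqP.
by rewrite eqr_nat => /eqP[].
Qed.

End SmallParameter.

Lemma algdep_set0 (F : fieldType) (T : Type) q (z : 'I_q -> T -> F) : algdep set0 z.
Proof. by exists 1; rewrite ?oner_eq0. Qed.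

(** In a closed set minimal for the independence of [h], every proper closed subset carries a
    relation. If two such subsets covered it, the product of their relations would hold
    everywhere. *)
Lemma minimal_independent_irreducible (F : fieldType) d q (h : 'I_q -> 'rV[F]_d -> F) V :
  algebraic_variety V -> ~ algdep V h ->
  exists Z, [/\ irreducible_variety Z, Z `<=` V & ~ algdep Z h].
Proof.
move=> cV nV; have [Z [cZ ZV nZ minZ]] := minimal_closed (P := fun Z => ~ algdep Z h) cV nV.
exists Z; split=> //; split=> //.
  by apply/set0P/eqP => Z0; apply: nZ; rewrite Z0; apply: algdep_set0.
move=> V1 V2 c1 c2 ZU; apply: contrapT => /not_orP[n1 n2].
have dep V' : algebraic_variety V' -> ~ Z `<=` V' -> algdep (Z `&` V') h.
  move=> cV' nZV'; apply: contrapT => H; apply: nZV' => x Zx.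
  have E := minZ _ (closedI cZ cV') (@subIsetl _ _ _) H.
  by move: Zx; rewrite -E => -[].
have [P P0 HP] := dep _ c1 n1; have [Q Q0 HQ] := dep _ c2 n2.
apply: nZ; exists (P * Q); first by rewrite mulf_neq0.
move=> x Zx; rewrite mevalM; have [V1x|V2x] := ZU _ Zx.
  by rewrite HP ?mul0r.
by rewrite HQ ?mulr0.
Qed.

Section RealSlices.
Variables (F : rcfType) (d : nat).
Implicit Types (V W Z : set 'rV[F]_d).

(* The image of V in affine space is semialgebraic and Zariski dense, hence it
   contains a small piece of a line in every direction through a generic point. *)
Lemma real_slice V r (h : 'I_r.+1 -> {mpoly F[d]}) : algebraic_variety V ->
  ~ algdep V (fun i => mpoly_eval (h i)) ->
  exists c, ~ algdep (V `&` [set x | mpoly_eval (h ord0 - c%:MP) x = 0])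
    (fun i : 'I_r => mpoly_eval (h (lift ord0 i))).
Proof.
move=> cV nV; have [ps Hps] := image_sign_pattern h cV.
(* Where [Q] is nonzero, each nonzero polynomial of [ps] has a strict sign, which persists
   nearby. *)
pose Q := \prod_(p <- ps | p != 0) p.
have Q0 : Q != 0 by rewrite prodf_seq_neq0; apply/allP => p _; apply/implyP.
have [x0 Vx0 Qx0] : exists2 x, V x & Q.@[fun i => mpoly_eval (h i) x] != 0.
  apply: contrapT => /forall2NP H; apply: nV; exists Q => // x Vx.
  by case: (H x) => // /negP; rewrite negbK => /eqP.
pose y0 : 'rV_r.+1 := \row_i mpoly_eval (h i) x0.
exists (y0 0 ord0) => -[P P0 HP]; have [v Pv] := mpoly_neq0_ex P0.
(* The direction [w] fixes the first coordinate, and at time 1 the line reaches the point whose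
   other coordinates are [v]. *)
pose w : 'rV_r.+1 := \row_i (if unlift ord0 i is Some j then v 0 j - y0 0 i else 0).
pose line t i := (y0 + t *: w) 0 i.
have line0 t : line t ord0 = y0 0 ord0.
  by rewrite /line !mxE unlift_none mulr0 addr0.
have /choice[pol Hpol] (p : {mpoly F[r.+1]}) :
  exists s : {poly F}, forall t, p.@[line t] = s.[t] by exact: lpoly_mpoly_eval.
have [s Hs] : exists s : {poly F}, forall t, P.@[fun i => line t (lift ord0 i)] = s.[t].
  apply: (@lpoly_meval F _ r P (fun i (x : 'rV_r.+1) => x 0 (lift ord0 i)) _ y0 w).
  move=> i x y; exists ((x 0 (lift ord0 i))%:P + (y 0 (lift ord0 i))%:P * 'X) => t.
  by rewrite !mxE !hornerE mulrC.
have [|e e0 He] := @sgr_polys_near0 F [seq pol p | p <- ps & p != 0].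
  move=> _ /mapP[p + ->]; rewrite mem_filter => /andP[p0 pps]; rewrite -Hpol.
  move: Qx0; rewrite /Q rmorph_prod /= prodf_seq_neq0 => /allP/(_ p pps)/implyP/(_ p0).
  congr (_ != 0); apply: meval_eq => i.
  by rewrite /line scale0r addr0 mxE.
(* For small [t > 0] the point [line t] has the signs of [y0], hence is the image of a point of the
   slice, where [P] vanishes. But [s] is nonzero at 1. *)
suff s0 : s = 0.
  suff E : mpoly_eval P v = s.[1] by rewrite E s0 horner0 eqxx in Pv.
  rewrite -Hs; apply: meval_eq => i; rewrite /line !mxE liftK mul1r.
  by rewrite addrC subrK.
apply: (poly_eq0_near0 e0) => t t0 te; rewrite -Hs.
have [x Vx hx] : in_poly_image h V (line t).
  apply: (Hps (fun i => y0 0 i)); last by exists x0 => // i; rewrite mxE.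
  move=> p pps; have [->|p0] := eqVneq p 0; first by rewrite !meval0.
  have := He t t0 te (pol p); rewrite -!Hpol => ->.
    by congr Num.sg; apply: meval_eq => i; rewrite /line scale0r addr0.
  by apply: map_f; rewrite mem_filter p0.
rewrite -(HP x).
  by apply: meval_eq => i; rewrite hx.
split=> //=; rewrite /mpoly_eval mevalB mevalC -!/(mpoly_eval _ _) hx line0.
by rewrite subrr.
Qed.

(** A minimal irreducible [Z] on which [h] is independent lies in no slice [h ord0 = c], since
    [h ord0 - c] would be a relation on it. The slice keeping the other functions independent
    contains the lower part of the chain. *)
Lemma independent_chain r V (h : 'I_r -> {mpoly F[d]}) : algebraic_variety V ->
  ~ algdep V (fun i => mpoly_eval (h i)) -> irreducible_chain V r.
Proof.
elim: r V h => [|r IH] V h cV nV.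
  have [Z [irZ ZV _]] := minimal_independent_irreducible cV nV.
  by exists (fun=> Z).
have [Z [irZ ZV nZ]] := minimal_independent_irreducible cV nV.
have [cZ _ _] := irZ.
have [c nS] := real_slice cZ nZ.
have [Y [irY Ylt]] := IH _ _ (closedI cZ (hypersurface_closed _)) nS.
exists (fun i => if (i <= r)%N then Y i else Z); split=> i ir.
  case: ifP => [/irY[irYi YS]|_//]; split=> //.
  by apply: subset_trans YS (subset_trans _ ZV) => x [].
rewrite ltnS in ir; rewrite ir; case: ltnP => [ir'|ri]; first exact: Ylt.
have [_ YS] := irY _ ir; split; first by apply: subset_trans YS _ => x [].
move=> ZY; apply: nZ; exists ('X_ord0 - c%:MP).
  apply: contraT; rewrite negbK subr_eq0 => /eqP /(congr1 (mcoeff U_(ord0))).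
  rewrite mcoeffX eqxx mcoeffC; case: eqP => [/(congr1 (@mdeg _))|_].
    by rewrite mdeg0 mdeg1.
  by rewrite mulr0 => /eqP; rewrite oner_eq0.
move=> x /ZY/YS[_ /=]; rewrite /mpoly_eval !mevalB !mevalC mevalXU => <-.
by [].
Qed.

End RealSlices.

(** * Growth of the spaces of polynomial functions *)

Section PolynomialFunctions.
Variables (F : fieldType) (T : Type).

(** Degree at most [n] in the functions [z], as functions rather than polynomials: relations among
    the [z i] are built in, and degree bounds follow by induction on the construction. *)
Inductive polyfun q (z : 'I_q -> T -> F) : nat -> (T -> F) -> Prop :=
| polyfun_cst n c f : (forall x, f x = c) -> polyfun z n f
| polyfun_add n f g h : polyfun z n f -> polyfun z n g ->
    (forall x, h x = f x + g x) -> polyfun z n h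
| polyfun_mul_var n i f g : polyfun z n f -> (forall x, g x = z i x * f x) ->
    polyfun z n.+1 g.

Section Closure.
Variables (q : nat) (z : 'I_q -> T -> F).

Lemma polyfun_ext n f g : polyfun z n f -> f =1 g -> polyfun z n g.
Proof.
move=> pf fg; apply: (polyfun_add pf (polyfun_cst z n (f := fun=> 0) (fun=> erefl))).
by move=> x; rewrite addr0 fg.
Qed.

Lemma polyfun_le n m f : (n <= m)%N -> polyfun z n f -> polyfun z m f.
Proof.
move=> + pf; elim: pf m => {n f} [n c f E|n f g h _ IHf _ IHg E|n i f g _ IH E] m nm.
- exact: polyfun_cst E.
- exact: polyfun_add (IHf _ nm) (IHg _ nm) E.
- by case: m nm => // m nm; apply: polyfun_mul_var (IH _ nm) E.
Qed.

Lemma polyfun_scale n c f : polyfun z n f -> polyfun z n (fun x => c * f x).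
Proof.
elim=> {n f} [n b f E|n f g h _ IHf _ IHg E|n i f g _ IH E].
- by apply: (@polyfun_cst _ z n (c * b)) => x; rewrite E.
- by apply: polyfun_add IHf IHg _ => x; rewrite E mulrDr.
- by apply: polyfun_mul_var IH _ => x; rewrite E mulrCA.
Qed.

Lemma polyfunD n f g : polyfun z n f -> polyfun z n g ->
  polyfun z n (fun x => f x + g x).
Proof. by move=> pf pg; apply: polyfun_add pf pg _. Qed.

Lemma polyfunM n m f g : polyfun z n f -> polyfun z m g ->
  polyfun z (n + m) (fun x => f x * g x).
Proof.
move=> pf pg; elim: pf => {n f} [n b f E|n f h k _ IHf _ IHh E|n i f h _ IH E].
- apply: polyfun_le (leq_addl n m) _.
  by apply: polyfun_ext (polyfun_scale b pg) _ => x; rewrite E.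
- by apply: polyfun_add IHf IHh _ => x; rewrite E mulrDl.
- by rewrite addSn; apply: polyfun_mul_var IH _ => x; rewrite E mulrA.
Qed.

Lemma polyfunX n f k : polyfun z n f -> polyfun z (k * n) (fun x => f x ^+ k).
Proof.
move=> pf; elim: k => [|k IH]; first exact: (@polyfun_cst _ _ _ 1).
by rewrite mulSn; apply: polyfun_ext (polyfunM pf IH) _ => x; rewrite exprS.
Qed.

Lemma polyfun0 n : polyfun z n (fun=> 0).
Proof. exact: polyfun_cst. Qed.

Lemma polyfun1 n : polyfun z n (fun=> 1).
Proof. exact: polyfun_cst. Qed.

Lemma polyfun_sum n I (r : seq I) (P : pred I) (f : I -> T -> F) :
  (forall i, P i -> polyfun z n (f i)) ->
  polyfun z n (fun x => \sum_(i <- r | P i) f i x).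
Proof.
move=> H; elim: r => [|i r IH].
  by apply: polyfun_ext (polyfun0 n) _ => x; rewrite big_nil.
case: (boolP (P i)) => Pi.
  by apply: polyfun_ext (polyfunD (H i Pi) IH) _ => x; rewrite big_cons Pi.
by apply: polyfun_ext IH _ => x; rewrite big_cons (negPf Pi).
Qed.

Lemma polyfun_var i : polyfun z 1 (z i).
Proof. by apply: polyfun_mul_var (polyfun1 0) _ => x; rewrite mulr1. Qed.

Lemma polyfun_monomial I (r : seq I) (h : I -> T -> F) (m : I -> nat) :
  (forall i, polyfun z 1 (h i)) ->
  polyfun z (\sum_(i <- r) m i) (fun x => \prod_(i <- r) h i x ^+ m i).
Proof.
move=> H; elim: r => [|i r IH].
  by apply: polyfun_ext (polyfun1 _) _ => x; rewrite big_nil.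
rewrite big_cons; have := polyfunX (m i) (H i); rewrite muln1 => pi.
by apply: polyfun_ext (polyfunM pi IH) _ => x; rewrite big_cons.
Qed.

Lemma polyfun_mpoly (p : {mpoly F[q]}) :
  polyfun z (msize p) (fun x => p.@[fun i => z i x]).
Proof.
apply: (@polyfun_ext _ (fun x => \sum_(m <- msupp p | m \in msupp p)
   p@_m * \prod_(i < q) z i x ^+ m i)); last first.
  by move=> x; rewrite mevalE [RHS]big_seq.
apply: polyfun_sum => m mp; apply: polyfun_scale.
apply: polyfun_le (ltnW (msize_mdeg_lt mp)) _; rewrite mdegE.
by apply: polyfun_monomial polyfun_var.
Qed.

Lemma mpoly_of_polyfun n f : polyfun z n f ->
  exists p : {mpoly F[q]}, forall x, f x = p.@[fun i => z i x].
Proof.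
elim=> {n f} [n b f E|n f g h _ [p Hp] _ [r Hr] E|n i f g _ [p Hp] E].
- by exists b%:MP => x; rewrite mevalC.
- by exists (p + r) => x; rewrite mevalD E Hp Hr.
- by exists ('X_i * p) => x; rewrite mevalM mevalXU E Hp.
Qed.

End Closure.

Lemma polyfun_subst q q' (z : 'I_q -> T -> F) (z' : 'I_q' -> T -> F) n f :
  (forall i, polyfun z' 1 (z i)) -> polyfun z n f -> polyfun z' n f.
Proof.
move=> H; elim=> {n f} [n b f E|n f g h _ IHf _ IHg E|n i f g _ IH E].
- exact: polyfun_cst E.
- exact: polyfun_add IHf IHg E.
- by rewrite -add1n; apply: polyfun_ext (polyfunM (H i) IH) _ => x; rewrite E.
Qed.

Variable W : set T.

(** An upper bound [N] for the dimension of the space of restrictions to [W]. The spanning functions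
    are arbitrary, which leaves freedom when the system [z] is changed. *)
Definition spanned_by q (z : 'I_q -> T -> F) n N :=
  exists f : 'I_N -> T -> F, forall g, polyfun z n g ->
    exists c : 'I_N -> F, forall x, W x -> g x = \sum_i c i * f i x.

Definition independent_family q (z : 'I_q -> T -> F) n N :=
  exists f : 'I_N -> T -> F, (forall i, polyfun z n (f i)) /\
    forall c : 'I_N -> F, (forall x, W x -> \sum_i c i * f i x = 0) ->
      forall i, c i = 0.

(** The Hilbert function of [W] with respect to [z] is [O(n^k)]; this plays the part of dimension at
    most [k]. *)
Definition growth q (z : 'I_q -> T -> F) k :=
  exists c, forall n, spanned_by z n (c * n.+1 ^ k).

Section Dimension.
Variables (q : nat) (z : 'I_q -> T -> F).

Lemma independent_le_spanned n N M :
  independent_family z n N -> spanned_by z n M -> (N <= M)%N.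
Proof.
move=> [f [pf indf]] [g Hg].
have /choice[A HA] i : exists c : 'I_M -> F, forall x, W x -> f i x = \sum_j c j * g j x.
  exact: Hg.
rewrite leqNgt; apply/negP => MN.
pose B : 'M_(N, M) := \matrix_(i, j) A i j.
have /rowV0Pn[c /sub_kermxP cB c0] : kermx B != 0.
  rewrite kermx_eq0 /row_free neq_ltn; apply/orP; left.
  exact: leq_ltn_trans (rank_leq_col B) MN.
have ci : forall i, c 0 i = 0.
  apply: indf => x Wx.
  have -> : \sum_i c 0 i * f i x = \sum_j (c *m B) 0 j * g j x.
    under eq_bigr => i _ do rewrite HA // mulr_sumr.
    rewrite exchange_big; apply: eq_bigr => j _; rewrite mxE mulr_suml.
    by apply: eq_bigr => i _; rewrite mxE mulrA.
  by rewrite cB; apply: big1 => j _; rewrite mxE mul0r.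
by move: c0; case/rV0Pn => i; rewrite ci eqxx.
Qed.

Lemma spanned_by_fin n (I : finType) (f : I -> T -> F) :
  (forall g, polyfun z n g ->
    exists c : I -> F, forall x, W x -> g x = \sum_i c i * f i x) ->
  spanned_by z n #|I|.
Proof.
move=> H; exists (fun i => f (enum_val i)) => g /H[c Hc].
exists (fun i => c (enum_val i)) => x /Hc ->.
by rewrite (reindex (@enum_val I I)) //=; apply: onW_bij; apply: enum_val_bij.
Qed.

Lemma independent_fin n (I : finType) (f : I -> T -> F) :
  (forall i, polyfun z n (f i)) ->
  (forall c : I -> F, (forall x, W x -> \sum_i c i * f i x = 0) -> forall i, c i = 0) ->
  independent_family z n #|I|.
Proof.
move=> pf H; exists (fun i => f (enum_val i)); split=> [i|c Hc i]; first exact: pf.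
rewrite -(enum_valK i); apply: (H (fun i => c (enum_rank i))) => x /Hc E.
rewrite -[RHS]E (reindex (@enum_val I I)) /=; last first.
  by apply: onW_bij; apply: enum_val_bij.
by apply: eq_bigr => j _; rewrite enum_valK.
Qed.

Lemma spanned_by_leq n N M : (N <= M)%N -> spanned_by z n N -> spanned_by z n M.
Proof.
move=> NM [f Hf].
exists (fun i x => if insub (val i) is Some j then f j x else 0) => g /Hf[c Hc].
exists (fun i => if insub (val i) is Some j then c j else 0) => x /Hc ->.
pose G k := (if insub k is Some j then c j else 0) *
  (if insub k is Some j then f j x else 0).
have -> : \sum_i c i * f i x = \sum_(i < N) G i.
  by apply: eq_bigr => i _; rewrite /G valK.
rewrite (big_ord_widen _ G NM) big_mkcond; apply: eq_bigr => i _.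
by case: ifP => //; rewrite /G; case: insubP => [j ->//|]; rewrite mul0r.
Qed.

Lemma growth_independent k a :
  (forall n, independent_family z (a * n) (n ^ k.+1)) -> ~ growth z k.
Proof.
(* This [n] beats the constant: [c (a n + 1)^k <= c (a + 1)^k n^k < n^(k+1)]. *)
move=> ind [c Hc]; pose n := (c * a.+1 ^ k).+1.
have := independent_le_spanned (ind n) (Hc _).
have le : ((a * n).+1 ^ k <= (a.+1 * n) ^ k)%N.
  by case: k {ind Hc} @n => [|k] n //; rewrite leq_exp2r // mulSn addnC -addn1 leq_add2l.
move=> /leq_trans /(_ (leq_mul (leqnn c) le)).
by rewrite expnMn mulnA expnS leq_pmul2r ?expn_gt0 // /n ltnn.
Qed.

(** A linear relation among the [n ^ q] monomials with all exponents below [n] is an algebraic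
    relation among the [u i]. *)
Lemma independent_monomials (u : 'I_q -> T -> F) n :
  (forall i, polyfun z 1 (u i)) -> ~ algdep W u ->
  independent_family z (q * n) (n ^ q).
Proof.
move=> pu nu; have -> : (n ^ q = #|{ffun 'I_q -> 'I_n}|)%N.
  by rewrite card_ffun !card_ord.
apply: (@independent_fin _ _ (fun (f : {ffun 'I_q -> 'I_n}) x =>
  \prod_(i < q) u i x ^+ f i)) => [f|c Hc].
  apply: polyfun_le (polyfun_monomial _ (fun i => f i : nat) pu).
  rewrite -[q in (_ <= q * n)%N]card_ord -sum_nat_const.
  by apply: leq_sum => i _; apply: ltnW.
pose mon (f : {ffun 'I_q -> 'I_n}) := [multinom (f i : nat) | i < q].
have monI : injective mon.
  move=> f g /mnmP E; apply/ffunP => i; apply: val_inj.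
  by have := E i; rewrite !mnmE.
pose P : {mpoly F[q]} := \sum_f c f *: 'X_[mon f].
have P0 : P = 0.
  apply/eqP; apply: contraT => P0; case: nu; exists P => // x Wx.
  rewrite -[RHS](Hc x Wx) raddf_sum; apply: eq_bigr => f _.
  rewrite /= mevalZ mevalX; congr (_ * _); apply: eq_bigr => i _.
  by rewrite mnmE.
move=> f; have := congr1 (mcoeff (mon f)) P0; rewrite mcoeff0 raddf_sum /=.
rewrite (bigD1 f) //= big1 ?addr0 => [|g gf].
  by rewrite mcoeffZ mcoeffX eqxx mulr1.
by rewrite mcoeffZ mcoeffX (inj_eq monI) (negPf gf) mulr0.
Qed.

End Dimension.

Lemma algdep_growth q k (z : 'I_q -> T -> F) (u : 'I_k.+1 -> T -> F) :
  (forall i, polyfun z 1 (u i)) -> growth z k -> algdep W u.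
Proof.
move=> pu gz; apply: contrapT => nu.
have gu : growth u k.
  by have [c Hc] := gz; exists c => n; have [f Hf] := Hc n; exists f => g
    /(polyfun_subst pu)/Hf.
apply: (growth_independent (a := k.+1)) gu => n.
by apply: independent_monomials nu => i; apply: polyfun_var.
Qed.

Lemma spanned_by_powers q q' (z : 'I_q -> T -> F) (z' : 'I_q' -> T -> F) (w : T -> F) J n m N :
  (forall g, polyfun z n g -> exists p : nat -> T -> F,
     (forall j, (j < J)%N -> polyfun z' m (p j)) /\
     forall x, W x -> g x = \sum_(j < J) w x ^+ j * p j x) ->
  spanned_by z' m N -> spanned_by z n (J * N).
Proof.
move=> H [f Hf]; have -> : (J * N = #|{: 'I_J * 'I_N}|)%N by rewrite card_prod !card_ord.
apply: (spanned_by_fin (f := fun (jk : 'I_J * 'I_N) x => w x ^+ jk.1 * f jk.2 x)).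
move=> g /H[p [pp Hp]].
have /choice[c Hc] (j : 'I_J) : exists c : 'I_N -> F,
  forall x, W x -> p j x = \sum_i c i * f i x by apply: Hf; apply: pp.
exists (fun jk => c jk.1 jk.2) => x Wx; rewrite Hp //.
rewrite -(pair_bigA _ (fun j i => c j i * (w x ^+ j * f i x))) /=.
by apply: eq_bigr => j _; rewrite Hc // mulr_sumr; apply: eq_bigr => i _; rewrite mulrCA.
Qed.

Lemma growth_trivial q (z : 'I_q -> T -> F) : growth z q.
Proof.
exists 1%N => n; rewrite mul1n; elim: q z => [|q IH] z.
  exists (fun _ _ => 1) => g.
  elim=> {n g} [n b f E|n f g h _ [c Hc] _ [b Hb] E|n [] //].
    by exists (fun=> b) => x _; rewrite big_ord1 mulr1.
  exists (fun i => c i + b i) => x Wx; rewrite E Hc // Hb // -big_split /=.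
  by apply: eq_bigr => i _; rewrite mulrDl.
rewrite expnS; pose z' i := z (lift ord0 i).
apply: (spanned_by_powers (w := z ord0)) (IH z') => g; move: n g {IH} => n g.
elim=> {n g} [n b f E|n f g h _ [p [pp Hp]] _ [r [pr Hr]] E|n i f g _ [p [pp Hp]] E].
- exists (fun j => if j == 0%N then fun=> b else fun=> 0); split=> [j _|x _].
    by case: eqP => _; apply: polyfun_cst.
  by rewrite big_ord_recl big1 /= ?mul1r ?addr0 // => j _; rewrite mulr0.
- exists (fun j x => p j x + r j x); split=> [j jn|x Wx].
    by apply: polyfunD; [apply: pp|apply: pr].
  by rewrite E Hp // Hr // -big_split /=; apply: eq_bigr => j _; rewrite mulrDr.
- case: (unliftP ord0 i) => [i'|] Ei.
    exists (fun j x => if (j < n.+1)%N then z' i' x * p j x else 0); split=> [j _|x Wx].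
      case: ltnP => jn; last exact: polyfun0.
      by apply: polyfun_mul_var (pp _ jn) _.
    rewrite E Hp // [RHS]big_ord_recr /= ltnn mulr0 addr0 mulr_sumr.
    by apply: eq_bigr => j _; rewrite ltn_ord Ei mulrCA.
  exists (fun j x => if j is j'.+1 then p j' x else 0); split=> [[|j] jn|x Wx].
  + exact: polyfun0.
  + by apply: polyfun_le (pp _ jn).
  + rewrite E Hp // [RHS]big_ord_recl /= mulr0 add0r mulr_sumr Ei.
    by apply: eq_bigr => j _; rewrite /bump /= add1n exprS mulrA.
Qed.

Lemma growth_leq q (z : 'I_q -> T -> F) k l : (k <= l)%N -> growth z k -> growth z l.
Proof.
move=> kl [c Hc]; exists c => n; apply: spanned_by_leq (Hc n).
by rewrite leq_mul2l leq_pexp2l ?orbT.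
Qed.

End PolynomialFunctions.

(** * Noether normalization *)

Section Noether.
Variables (F : numFieldType) (T : Type) (W : set T).

(** The linear change of variables of Noether normalization over an infinite field. *)
Definition shear q (z : 'I_q.+1 -> T -> F) (a : 'rV[F]_q) (i : 'I_q) x :=
  z (lift ord0 i) x + a 0 i * z ord0 x.

Section Expansion.
Variables (q : nat) (z : 'I_q.+1 -> T -> F) (a : 'rV[F]_q).
Let w := z ord0.
Let z' := shear z a.

(** As a polynomial in [w] and [z'], [f] has total degree at most [s], with the constant [c] as
    coefficient of [w ^ s]. *)
Definition expands s c (f : T -> F) := exists b : nat -> T -> F,
  (forall j, (j < s)%N -> polyfun z' (s - j) (b j)) /\
  forall x, f x = c * w x ^+ s + \sum_(j < s) w x ^+ j * b j x.

(** The coefficient of [w] in [z i], as [z i = z' j - a 0 j * w] for [i = lift ord0 j]. *)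
Definition top_coef i := if unlift ord0 i is Some j then - a 0 j else 1.

Lemma var_top i : exists2 g, polyfun z' 1 g & forall x, z i x = top_coef i * w x + g x.
Proof.
rewrite /top_coef; case: (unliftP ord0 i) => [j ->|->].
  exists (z' j); first exact: polyfun_var.
  by move=> x; rewrite /z' /shear addrC mulNr addrK.
by exists (fun=> 0) => [|x]; [exact: polyfun0|rewrite mul1r addr0].
Qed.

Lemma expands_mul_var s c f i : expands s c f ->
  expands s.+1 (top_coef i * c) (fun x => z i x * f x).
Proof.
move=> [b [pb Hb]]; have [g pg Hg] := var_top i.
pose b1 j x := if j is j'.+1 then b j' x else 0.
pose b2 j x := if (j < s)%N then b j x else c.
exists (fun j x => top_coef i * b1 j x + g x * b2 j x); split=> [j js|x].
  apply: polyfunD.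
    apply: polyfun_scale; case: j js => [|j] js; first exact: polyfun0.
    by rewrite subSS; apply: pb.
  rewrite subSn // -add1n; apply: polyfunM pg _; rewrite /b2.
  by case: ltnP => js'; [apply: pb|apply: polyfun_cst].
under eq_bigr do rewrite mulrDr.
rewrite big_split /= big_ord_recl [in X in _ + (_ + X)]big_ord_recr /= /b2 ltnn.
rewrite !mulr0 add0r Hb Hg mulrDl !mulrDr exprS !mulr_sumr.
have -> : \sum_(j < s) w x ^+ bump 0 j * (top_coef i * b j x) =
          \sum_(j < s) top_coef i * w x * (w x ^+ j * b j x).
  by apply: eq_bigr => j _; rewrite /bump /= add1n exprS; ring.
have -> : \sum_(j < s) w x ^+ j * (g x * (if (j < s)%N then b j x else c)) =
          \sum_(j < s) g x * (w x ^+ j * b j x).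
  by apply: eq_bigr => j _; rewrite ltn_ord; ring.
ring.
Qed.

Lemma expands_monomial (r : seq 'I_q.+1) (m : 'I_q.+1 -> nat) :
  expands (\sum_(i <- r) m i) (\prod_(i <- r) top_coef i ^+ m i)
    (fun x => \prod_(i <- r) z i x ^+ m i).
Proof.
elim: r => [|i r IH].
  rewrite !big_nil; exists (fun _ => fun=> 0); split=> // x.
  by rewrite big_nil big_ord0 mulr1 addr0.
have -> : (fun x => \prod_(k <- i :: r) z k x ^+ m k) =
  (fun x => z i x ^+ m i * \prod_(k <- r) z k x ^+ m k).
  by apply: funext => x; rewrite big_cons.
rewrite !big_cons; elim: (m i) => [|k].
  rewrite add0n expr0 mul1r; have [b [pb Hb]] := IH; exists b; split=> // x.
  by rewrite expr0 mul1r Hb.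
move=> /(@expands_mul_var _ _ _ i)[b [pb Hb]].
rewrite addSn exprS -mulrA; exists b; split=> // x.
by rewrite -Hb exprS mulrA.
Qed.

Lemma expandsD s c d f g : expands s c f -> expands s d g ->
  expands s (c + d) (fun x => f x + g x).
Proof.
move=> [b [pb Hb]] [e [pe He]]; exists (fun j x => b j x + e j x); split=> [j js|x].
  by apply: polyfunD; [apply: pb|apply: pe].
rewrite Hb He mulrDl addrACA -big_split /=; congr (_ + _).
by apply: eq_bigr => j _; rewrite mulrDr.
Qed.

Lemma expandsZ s c d f : expands s c f -> expands s (d * c) (fun x => d * f x).
Proof.
move=> [b [pb Hb]]; exists (fun j x => d * b j x); split=> [j js|x].
  by apply: polyfun_scale; apply: pb.
rewrite Hb mulrDr mulrA mulr_sumr; congr (_ + _).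
by apply: eq_bigr => j _; rewrite mulrCA.
Qed.

Lemma expands_lt s n c f : (s < n)%N -> expands s c f -> expands n 0 f.
Proof.
move=> sn [b [pb Hb]].
exists (fun j x => if (j < s)%N then b j x else if j == s then c else 0).
split=> [j jn|x].
  case: ltnP => js; first by apply: polyfun_le (pb _ js); rewrite leq_sub2r // ltnW.
  by case: eqP => _; apply: polyfun_cst.
rewrite mul0r add0r Hb.
pose G j := w x ^+ j * (if (j < s)%N then b j x else if j == s then c else 0).
have -> : \sum_(j < n) w x ^+ j * (if (j < s)%N then b j x else if val j == s then c else 0)
  = \sum_(0 <= j < n) G j by rewrite big_mkord.
rewrite (big_cat_nat _ (n := s.+1)) //= [X in _ = _ + X]big_nat_cond.
rewrite [X in _ = _ + X]big1 ?addr0.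
  rewrite big_nat_recr //= /G ltnn eqxx addrC [c * _]mulrC; congr (_ + _).
  by rewrite big_mkord; apply: eq_bigr => j _; rewrite ltn_ord.
by move=> j /andP[/andP[sj _] _]; rewrite /G ltnNge ltnW // gtn_eqF // mulr0.
Qed.

(** The coefficient of the top power of [w] is the leading form of [P] at the point [(1, -a)]. *)
Lemma expands_mpoly (P : {mpoly F[q.+1]}) :
  expands (msize P).-1
    (\sum_(m <- msupp P | mdeg m == (msize P).-1)
       P@_m * \prod_(i < q.+1) top_coef i ^+ m i)
    (fun x => P.@[fun i => z i x]).
Proof.
set n := (msize P).-1.
have H0 : expands n 0 (fun=> 0).
  by exists (fun _ => fun=> 0); split=> [j _|x]; [exact: polyfun0|];
    rewrite mul0r add0r big1 // => j _; rewrite mulr0.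
have : {subset msupp P <= msupp P} by [].
have -> : (fun x => P.@[fun i => z i x]) =
  (fun x => \sum_(m <- msupp P) P@_m * \prod_(i < q.+1) z i x ^+ m i).
  by apply: funext => x; rewrite mevalE.
elim: {1 3 4}(msupp P) => [|m s IH] sub.
  by rewrite big_nil (_ : (fun x => _) = fun=> 0) //; apply: funext => x; rewrite big_nil.
have mP : m \in msupp P by apply: sub; rewrite mem_head.
have {}IH := IH (fun k ks => sub k (mem_behead (s := m :: s) ks)).
have le : (mdeg m <= n)%N.
  by have := msize_mdeg_lt mP; rewrite /n; case: (msize P).
have := expandsZ P@_m (@expands_monomial (index_enum _) m); rewrite -mdegE => Em.
have -> : (fun x => \sum_(k <- m :: s) P@_k * \prod_(i < q.+1) z i x ^+ k i) =
  (fun x => P@_m * (\prod_(i < q.+1) z i x ^+ m i) +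
            \sum_(k <- s) P@_k * \prod_(i < q.+1) z i x ^+ k i).
  by apply: funext => x; rewrite big_cons.
rewrite big_cons; case: eqP => Edeg.
  by apply: expandsD IH; rewrite -Edeg.
rewrite -[X in expands _ X _]add0r; apply: expandsD IH.
by apply: expands_lt Em; rewrite ltn_neqAle le andbT; apply/eqP.
Qed.

End Expansion.

(** Integrality with a bound on the total degree: every term has degree at most [n] in [w] and [z]
    together. This bound later controls the degree of plane sections of the surface. *)
Definition integral_relation q (z : 'I_q -> T -> F) (w : T -> F) n (b : nat -> T -> F) :=
  (forall j, (j < n)%N -> polyfun z (n - j) (b j)) /\
  forall x, W x -> w x ^+ n = \sum_(j < n) w x ^+ j * b j x.

(** [t a] is the leading form of a relation at [(1, -a)]; where it is nonzero, the relation can be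
    made monic in [z ord0]. It is not identically zero because a monomial of given degree is
    determined by its exponents other than the first. *)
Lemma noether_relation q (z : 'I_q.+1 -> T -> F) : algdep W z ->
  exists t : 'rV[F]_q -> F, [/\ lpoly t, exists a, t a != 0 &
    forall a, t a != 0 -> exists n b, integral_relation (shear z a) (z ord0) n b].
Proof.
move=> [P P0 HP]; set n := (msize P).-1.
pose t a := \sum_(m <- msupp P | mdeg m == n) P@_m * \prod_(i < q.+1) top_coef a i ^+ m i.
pose rest (m : 'X_{1..q.+1}) := [multinom m (lift ord0 i) | i < q].
pose Q : {mpoly F[q]} := \sum_(m <- msupp P | mdeg m == n) P@_m *: 'X_[rest m].
have tE a : t a = mpoly_eval Q (- a).
  rewrite /mpoly_eval raddf_sum; apply: eq_bigr => m _.
  rewrite /= mevalZ mevalX big_ord_recl /top_coef unlift_none expr1n mul1r.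
  congr (_ * _); apply: eq_bigr => i _.
  by rewrite liftK mnmE !mxE.
have restI m m' : mdeg m = mdeg m' -> rest m = rest m' -> m = m'.
  rewrite !mdegE !big_ord_recl /= => E /mnmP R.
  have {}R i : m (lift ord0 i) = m' (lift ord0 i) by have := R i; rewrite !mnmE.
  have E0 : m ord0 = m' ord0.
    by move: E; under eq_bigr do rewrite R; move=> /addIn.
  by apply/mnmP => i; case: (unliftP ord0 i) => [j ->|->].
have Q0 : Q != 0.
  have lP := mlead_supp P0; have dP : mdeg (mlead P) = n by rewrite /n -mlead_deg.
  apply: contraTneq lP => E; rewrite -mcoeff_eq0.
  have := congr1 (mcoeff (rest (mlead P))) E; rewrite mcoeff0 raddf_sum /=.
  rewrite -big_filter; have := mlead_supp P0; rewrite -/(mlead P) => lP.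
  rewrite (bigD1_seq (mlead P)) /= ?filter_uniq ?msupp_uniq //; last first.
    by rewrite mem_filter dP eqxx.
  rewrite mcoeffZ mcoeffX eqxx mulr1 big1_seq ?addr0 => [->//|m].
  rewrite mem_filter => /and3P[mne /eqP dm _].
  rewrite mcoeffZ mcoeffX; case: eqP => [R|_]; last by rewrite mulr0.
  by move: mne; rewrite (restI m (mlead P)) ?eqxx // dP.
exists t; split.
- move=> x y; have [p Hp] := lpoly_mpoly_eval Q (- x) (- y).
  by exists p => u; rewrite tE -Hp opprD scalerN.
- by have [v Hv] := mpoly_neq0_ex Q0; exists (- v); rewrite tE opprK.
move=> a ta; have [b [pb Hb]] := expands_mpoly z a P.
exists n, (fun j x => - (t a)^-1 * b j x); split=> [j jn|x Wx].
  by apply: polyfun_scale; apply: pb.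
apply: (mulfI ta); rewrite mulr_sumr; apply/eqP; rewrite -subr_eq0.
rewrite -[X in _ == X](HP x Wx) Hb; apply/eqP; congr (_ + _).
rewrite -sumrN; apply: eq_bigr => j _.
by rewrite mulNr mulrN mulrN opprK mulrCA [t a * _]mulrA divff // mul1r.
Qed.

Section Reduction.
Variables (q : nat) (z : 'I_q.+1 -> T -> F) (a : 'rV[F]_q).
Let w := z ord0.
Let z' := shear z a.
Variables (n : nat) (b : nat -> T -> F).
Hypothesis rel : integral_relation z' w n b.

Lemma reduce_powers m f : polyfun z m f -> exists p : nat -> T -> F,
  (forall j, (j < n)%N -> polyfun z' (m + n) (p j)) /\
  forall x, W x -> f x = \sum_(j < n) w x ^+ j * p j x.
Proof.
have [pb Hb] := rel.
(* The bound [m + n - j] survives multiplication by [w], which shifts [j]; the summand [n] keeps the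
   subtraction from truncating. *)
suff H : polyfun z m f -> exists p : nat -> T -> F,
    (forall j, (j < n)%N -> polyfun z' (m + n - j) (p j)) /\
    forall x, W x -> f x = \sum_(j < n) w x ^+ j * p j x.
  move=> /H[p [pp Hp]]; exists p; split=> // j jn.
  by apply: polyfun_le (pp _ jn); rewrite leq_subr.
have mulw k g p : (forall j, (j < n)%N -> polyfun z' (k + n - j) (p j)) ->
    (forall x, W x -> g x = \sum_(j < n) w x ^+ j * p j x) ->
    exists r : nat -> T -> F, (forall j, (j < n)%N -> polyfun z' (k.+1 + n - j) (r j)) /\
    forall x, W x -> w x * g x = \sum_(j < n) w x ^+ j * r j x.
  (* For [n = 0] the relation reads [1 = 0], so [W] is empty. *)
  case: n pb Hb => [|n'] pb' Hb' pp Hp.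
    exists p; split=> // x Wx; have := Hb' x Wx; rewrite big_ord0 expr0 => /eqP.
    by rewrite oner_eq0.
  pose p' j x := if j is j'.+1 then p j' x else 0.
  exists (fun j x => p' j x + b j x * p n' x); split=> [j jn|x Wx].
    apply: polyfunD.
      case: j jn => [|j] jn; first exact: polyfun0.
      by rewrite addSn subSS; apply: pp; apply: ltnW.
    apply: polyfun_le (polyfunM (pb' _ jn) (pp _ (ltnSn n'))).
    by move: jn; lia.
  rewrite Hp // mulr_sumr; under [RHS]eq_bigr do rewrite mulrDr.
  rewrite big_split /= [in RHS]big_ord_recl /= mulr0 add0r big_ord_recr /=.
  congr (_ + _).
    by apply: eq_bigr => j _; rewrite /bump /= add1n exprS mulrA.
  rewrite mulrA -exprS Hb' // mulr_suml; apply: eq_bigr => j _.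
  by rewrite mulrA.
elim=> {m f} [m c f E|m f g h _ [p [pp Hp]] _ [r [pr Hr]] E|m i f g _ [p [pp Hp]] E].
- case: n Hb {mulw pb} => [|n'] Hb'.
    exists (fun _ => fun=> 0); split=> // x Wx; have := Hb' x Wx.
    by rewrite big_ord0 expr0 => /eqP; rewrite oner_eq0.
  exists (fun j x => if j == 0%N then c else 0); split=> [j _|x _].
    by case: eqP => _; apply: polyfun_cst.
  by rewrite big_ord_recl big1 /= ?mul1r ?addr0 // => j _; rewrite mulr0.
- exists (fun j x => p j x + r j x); split=> [j jn|x Wx].
    by apply: polyfunD; [apply: pp|apply: pr].
  by rewrite E Hp // Hr // -big_split /=; apply: eq_bigr => j _; rewrite mulrDr.
- have [r [pr Hr]] := mulw _ _ _ pp Hp; have [e pe He] := var_top z a i.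
  exists (fun j x => top_coef a i * r j x + e x * p j x); split=> [j jn|x Wx].
    apply: polyfunD; first by apply: polyfun_scale; apply: pr.
    rewrite addSn subSn; last by apply: leq_trans (ltnW jn) (leq_addl _ _).
    by rewrite -add1n; apply: polyfunM pe (pp _ jn).
  rewrite E He mulrDl -mulrA -/w Hr // {1}Hp // !mulr_sumr -big_split /=.
  by apply: eq_bigr => j _; ring.
Qed.

(** The powers of [w] below [n] generate the functions of [z] over those of [z'], at the cost of
    raising the degree by [n]; the exponent of growth does not see this. *)
Lemma growth_shear k : growth W z' k -> growth W z k.
Proof.
move=> [c Hc]; exists (n * (c * n.+1 ^ k))%N => m.
apply: spanned_by_leq (spanned_by_powers (w := w) (@reduce_powers m) (Hc _)).
rewrite -!mulnA !leq_mul2l; apply/orP; right; apply/orP; right.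
by rewrite -expnMn; case: k {Hc} => // k; rewrite leq_exp2r //; nia.
Qed.

End Reduction.

Lemma algdep_growth_pred q (z : 'I_q.+1 -> T -> F) : algdep W z -> growth W z q.
Proof.
move=> /noether_relation[t [_ [a ta] /(_ a ta)[n [b rel]]]].
exact: (growth_shear rel (growth_trivial W _)).
Qed.

Definition lincomb q k (z : 'I_q -> T -> F) (A : 'M[F]_(q, k)) (j : 'I_k) x :=
  \sum_i A i j * z i x.

Lemma polyfun_lincomb q k (z : 'I_q -> T -> F) (A : 'M[F]_(q, k)) j :
  polyfun z 1 (lincomb z A j).
Proof.
by apply: polyfun_sum => i _; apply: polyfun_scale; apply: polyfun_var.
Qed.

Lemma algdep_sub q k (z : 'I_q -> T -> F) (s : 'I_k -> 'I_q) : injective s ->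
  algdep W (z \o s) -> algdep W z.
Proof.
move=> sI [P P0 HP]; have [v Pv] := mpoly_neq0_ex P0.
pose lq : k.-tuple {mpoly F[q]} := [tuple 'X_(s i) | i < k].
have E (u : 'I_q -> F) : (P \mPo lq).@[u] = P.@[u \o s].
  rewrite comp_mpoly_meval; apply: meval_eq => i.
  by rewrite tnth_mktuple mevalXU.
exists (P \mPo lq); last by move=> x /HP <-; rewrite E.
apply: contra_neq Pv => E0.
pose u j := if [pick i | s i == j] is Some i then v 0 i else 0.
have := E u; rewrite E0 meval0 => ->; apply: meval_eq => i.
rewrite /u /=; case: pickP => [i' /eqP/sI->//|/(_ i)]; by rewrite eqxx.
Qed.

(** While more than [k] functions remain, [k + 1] of them are dependent, and a shear removes one
    without raising the exponent of growth. The hypothesis speaks of linear combinations because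
    these are stable under shears. *)
Lemma dependent_growth q k (z : 'I_q -> T -> F) :
  (forall A : 'M[F]_(q, k.+1), algdep W (lincomb z A)) -> growth W z k.
Proof.
elim: q z => [|q IH] z H; first exact: growth_leq (growth_trivial _ _).
have [qk|kq] := leqP q.+1 k; first exact: growth_leq qk (growth_trivial _ _).
pose s (j : 'I_k.+1) := widen_ord kq j.
have sI : injective s by move=> i j /(congr1 val) /= /val_inj.
have /noether_relation[t [_ [a ta] /(_ a ta)[n [b rel]]]] : algdep W z.
  apply: (algdep_sub sI); have [P P0 HP] := H (\matrix_(i, j) (i == s j)%:R).
  exists P => // x /HP <-; apply: meval_eq => j; rewrite /lincomb /=.
  rewrite (bigD1 (s j)) //= mxE eqxx mul1r big1 ?addr0 // => i ij.
  by rewrite mxE (negPf ij) mul0r.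
apply: (growth_shear rel); apply: IH => A.
pose B : 'M[F]_(q.+1, k.+1) := \matrix_(i, j)
  if unlift ord0 i is Some i' then A i' j else \sum_i' A i' j * a 0 i'.
have [P P0 HP] := H B; exists P => // x /HP <-; apply: meval_eq => j.
rewrite /lincomb big_ord_recl mxE unlift_none mulr_suml -big_split /=.
by apply: eq_bigr => i _; rewrite mxE liftK /shear; ring.
Qed.

End Noether.

(** * Generic linear forms *)

Section GenericForms.
Variables (F : numFieldType).

Definition fcons (T : Type) k (w : T -> F) (u : 'I_k -> T -> F) (i : 'I_k.+1) :=
  if unlift ord0 i is Some j then u j else w.

(** Were the sheared system dependent, its growth would have exponent [k], and by the integral
    relation so would that of [w] and [u] together; but [u] consists of [k + 1] independent
    functions. *)
Lemma shear_independent (T : Type) (W : set T) k (w : T -> F) (u : 'I_k.+1 -> T -> F) :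
  ~ algdep W u -> algdep W (fcons w u) ->
  exists t : 'rV[F]_k.+1 -> F, [/\ lpoly t, exists a, t a != 0 &
    forall a, t a != 0 -> ~ algdep W (fun i x => u i x + a 0 i * w x) /\
      exists n b, integral_relation W (fun i x => u i x + a 0 i * w x) w n b].
Proof.
move=> nu /noether_relation[t [lt t0 Ht]]; exists t; split=> // a /Ht[n [b rel]].
have E : shear (fcons w u) a = (fun i x => u i x + a 0 i * w x).
  by apply: funext => i; apply: funext => x; rewrite /shear /fcons liftK unlift_none.
have E0 : fcons w u ord0 = w by rewrite /fcons unlift_none.
split; last by exists n, b; move: rel; rewrite E E0.
move=> dep; apply: nu; apply: (@algdep_growth _ _ _ _ _ (fcons w u)).
  move=> i; apply: polyfun_ext (polyfun_var _ (lift ord0 i)) _ => x.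
  by rewrite /fcons liftK.
by apply: (growth_shear rel); rewrite E; apply: algdep_growth_pred.
Qed.

Section Forms.
Variable d : nat.
Implicit Types (W : set 'rV[F]_d).

Definition coordinate (i : 'I_d) (x : 'rV[F]_d) := x 0 i.

Definition forms k (A : 'M[F]_(d, k)) (j : 'I_k) (x : 'rV[F]_d) := (x *m A) 0 j.

Lemma formsE k (A : 'M[F]_(d, k)) : forms A = lincomb coordinate A.
Proof.
apply: funext => j; apply: funext => x; rewrite /forms /lincomb mxE.
by apply: eq_bigr => i _; rewrite mulrC.
Qed.

Lemma polyfun_forms k (A : 'M[F]_(d, k)) j : polyfun coordinate 1 (forms A j).
Proof. by rewrite formsE; apply: polyfun_lincomb. Qed.

Lemma exists_independent_forms W k : ~ growth W coordinate k ->
  exists A : 'M[F]_(d, k.+1), ~ algdep W (forms A).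
Proof.
move=> ng; apply: contrapT => H; apply: ng; apply: dependent_growth => A.
by apply: contrapT => nA; apply: H; exists A; rewrite formsE.
Qed.

(* The rows of an independent system of forms are replaced one at a time by
   generic rows. *)
Lemma generic_independent_forms W k (phi : 'M[F]_(d, k.+1) -> F) :
  growth W coordinate k.+1 -> (exists A : 'M[F]_(d, k.+1), ~ algdep W (forms A)) ->
  lpoly phi -> (exists B, phi B != 0) ->
  exists2 A, ~ algdep W (forms A) & phi A != 0.
Proof.
move=> gW [A0 indA0] lphi [B0 phiB0].
suff H m : (m <= d)%N -> exists A B, [/\ ~ algdep W (forms A), phi B != 0 &
    forall i : 'I_d, (i < m)%N -> row i A = row i B].
  have [A [B [indA phiB E]]] := H d (leqnn d); exists A => //.
  by rewrite (_ : A = B) //; apply/row_matrixP => i; apply: E.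
elim: m => [|m IH] md; first by exists A0, B0; split.
have [A [B [indA phiB E]]] := IH (ltnW md); pose i := Ordinal md.
have [|t [lt t0 Ht]] := @shear_independent _ W k (coordinate i) (forms A) indA.
  apply: algdep_growth gW => j; rewrite /fcons; case: unlift => [j'|].
    exact: polyfun_forms.
  exact: polyfun_var.
pose ei : 'cV[F]_d := delta_mx i 0.
pose h : {linear 'rV[F]_k.+1 -> 'M[F]_(d, k.+1)} := mulmx ei.
(* [B1] is [B] with row [i] taken from [A], so that adding the same [a] to row [i] of [A] and of
   [B1] keeps these rows equal. *)
pose B1 := B + ei *m (row i A - row i B).
have rowei (a : 'rV[F]_k.+1) (i' : 'I_d) : row i' (ei *m a) = (i' == i)%:R *: a.
  by apply/rowP => j; rewrite !mxE big_ord1 !mxE andbT.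
have [|a] := lpoly_neq0M lt (lpoly_affine h B1 lphi) t0.
  exists (row i B - row i A); rewrite /= /B1 addrCA -mulmxDr.
  by rewrite [X in ei *m X](_ : _ = 0) ?mulmx0 ?addr0 // addrC subrKA subrr.
rewrite mulf_eq0 negb_or => /andP[/Ht[ind _] phi'].
exists (A + ei *m a), (h a + B1); split=> // [dep|i'].
  case: dep => P P0 HP; apply: ind; exists P => // x /HP <-; apply: meval_eq => j.
  rewrite /forms mulmxDr [in RHS]mxE; congr (_ + _).
  rewrite mulmxA mxE big_ord1 mulrC; congr (_ * _).
  rewrite mxE (bigD1 i) //= big1 => [|l li].
    by rewrite mxE !eqxx mulr1 addr0.
  by rewrite mxE (negPf li) mulr0.
rewrite ltnS leq_eqVlt => im.
rewrite !linearD /= !rowei addrCA; have [->|ii'] := eqVneq i' i.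
  by rewrite !scale1r [RHS]addrCA [row i B + _]addrC subrK addrC.
rewrite !scale0r !addr0; apply: E; move: im => /orP[/eqP im|//].
by case/eqP: ii'; apply: val_inj.
Qed.

End Forms.
End GenericForms.

(** * Chains of varieties and growth *)

Section ChainGrowth.
Variables (F : numFieldType) (d : nat).
Implicit Types (W Z V : set 'rV[F]_d).

Lemma polyfun_coord_mpoly n (f : 'rV[F]_d -> F) : polyfun (@coordinate F d) n f ->
  exists p : {mpoly F[d]}, f = mpoly_eval p.
Proof.
by move=> /mpoly_of_polyfun[p Hp]; exists p; apply: funext.
Qed.

(** The functions [f] are independent already on [Z'], where all multiples of [h] vanish, and
    multiplication by [h] is injective on [Z] because [Z] is prime. *)
Lemma independent_extend Z Z' h a n N m M : prime_set Z -> Z' `<=` Z ->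
  vanishes Z' h -> ~ vanishes Z h -> polyfun (@coordinate F d) a (mpoly_eval h) ->
  independent_family Z' (@coordinate F d) n N -> independent_family Z (@coordinate F d) m M ->
  independent_family Z (@coordinate F d) (maxn n (a + m)) (N + M).
Proof.
move=> pZ Z'Z hZ' hZ ph [f [pf indf]] [g [pg indg]].
exists (fun i x => match fintype.split i with inl j => f j x | inr j => mpoly_eval h x * g j x end).
split=> [i|c Hc].
  case: (fintype.split i) => j; first by apply: polyfun_le (pf j); rewrite leq_maxl.
  by apply: polyfun_le (polyfunM ph (pg j)); rewrite leq_maxr.
have sE x : \sum_i c i * match fintype.split i with inl j => f j x | inr j => mpoly_eval h x * g j x end
   = \sum_i c (lshift M i) * f i x + mpoly_eval h x * (\sum_j c (rshift N j) * g j x).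
  rewrite big_split_ord /=; congr (_ + _).
    by apply: eq_bigr => i _; rewrite (unsplitK (inl i : 'I_N + 'I_M)).
  by rewrite mulr_sumr; apply: eq_bigr => i _; rewrite (unsplitK (inr i : 'I_N + 'I_M)) mulrCA.
have cl : forall i, c (lshift M i) = 0.
  apply: (indf (fun i => c (lshift M i))) => x Zx.
  by have := Hc x (Z'Z x Zx); rewrite sE (hZ' x Zx) mul0r addr0.
have cr : forall j, c (rshift N j) = 0.
  apply: (indg (fun j => c (rshift N j))).
  have [r Hr] : exists r, (fun x => \sum_j c (rshift N j) * g j x) = mpoly_eval r.
    apply: (@polyfun_coord_mpoly m); apply: polyfun_sum => j _.
    exact: polyfun_scale.
  have [x Zx|//|rZ x Zx] := pZ h r; last by have := rZ x Zx; rewrite -Hr.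
  have := Hc x Zx; rewrite sE big1 ?add0r => [|i _]; last by rewrite cl mul0r.
  by rewrite mpoly_evalM -Hr.
move=> i; case: (fintype.splitP i) => j Ej.
  by rewrite (_ : i = lshift M j) ?cl //; apply: val_inj.
by rewrite (_ : i = rshift N j) ?cr //; apply: val_inj.
Qed.

(** Each step of the chain multiplies the number of independent functions of degree [O(n)] by [n]: a
    polynomial [h] vanishing on the smaller variety but not on the larger one allows [n] successive
    extensions. *)
Lemma chain_growth V k : irreducible_chain V k.+1 -> ~ growth V (@coordinate F d) k.
Proof.
move=> [Z [irZ Zlt]].
suff H i : (i <= k.+1)%N -> exists a, forall n,
    independent_family (Z i) (@coordinate F d) (a * n) (n ^ i).
  have [a Ha] := H k.+1 (leqnn _) => -[c Hc].
  apply: (growth_independent Ha); exists c => n; have [f Hf] := Hc n.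
  exists f => g /Hf[b Hb]; exists b => x Zx; apply: Hb.
  by have [_ ZV] := irZ k.+1 (leqnn _); apply: ZV.
elim: i => [|i IH] ik.
  have [[_ [x Zx] _] _] := irZ 0%N (leq0n _).
  exists 0%N => n; rewrite expn0; exists (fun _ => fun=> 1); split=> [j|c Hc j].
    exact: polyfun1.
  by have := Hc x Zx; rewrite big_ord1 mulr1 (ord1 j).
have [a Ha] := IH (ltnW ik).
have [irZi _] := irZ _ (ltnW ik); have [irZi1 _] := irZ _ ik.
have [ZZ nZZ] := Zlt i ik; have [cZ _ _] := irZi.
have [x Zx nZx] : exists2 x, Z i.+1 x & ~ Z i x.
  by move: nZZ => /existsNP[x /not_implyP[? ?]]; exists x.
have [h hZ hx] := closed_not_in cZ nZx.
have nhZ : ~ vanishes (Z i.+1) h by move=> /(_ x Zx) h0; rewrite h0 eqxx in hx.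
have ph := polyfun_mpoly (@coordinate F d) h.
exists (a + msize h)%N => n.
suff K m : independent_family (Z i.+1) (@coordinate F d) (a * n + msize h * m) (m * n ^ i).
  have := K n; rewrite expnS => -[f [pf indf]]; exists f; split=> // j.
  by apply: polyfun_le (pf j); rewrite mulnDl.
elim: m => [|m IHm].
  by exists (fun _ => fun=> 0); split=> [j|c _ []//]; exact: polyfun0.
have := independent_extend (irreducible_prime irZi1) ZZ hZ nhZ ph (Ha n) IHm.
rewrite mulSn => -[f [pf indf]]; exists f; split=> // j.
by apply: polyfun_le (pf j); rewrite mulnS; lia.
Qed.

End ChainGrowth.

(** * Factoriality of polynomial rings *)

Section PrimeFactorization.
Variable A : idomainType.
Implicit Types (a b c p u : A) (s : seq A).

Definition divides a b := exists c, b = c * a.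

Definition prime_elt p :=
  [/\ p != 0, p \isn't a GRing.unit & forall a b, divides p (a * b) -> divides p a \/ divides p b].

Definition factors a s := exists2 u, u \is a GRing.unit & a = u * \prod_(p <- s) p.

Definition all_prime s := forall p, p \in s -> prime_elt p.

Lemma divides_refl a : divides a a. Proof. by exists 1; rewrite mul1r. Qed.

Lemma divides_mull a b c : divides a b -> divides a (c * b).
Proof. by move=> [x ->]; exists (c * x); rewrite mulrA. Qed.

Lemma divides_mulr a b c : divides a b -> divides a (b * c).
Proof. by rewrite mulrC; apply: divides_mull. Qed.

Lemma divides_trans a b c : divides a b -> divides b c -> divides a c.
Proof. by move=> ab [x ->]; apply: divides_mull. Qed.

Lemma divides_unitMl u a b : u \is a GRing.unit -> divides a (u * b) -> divides a b.
Proof. by move=> Uu [x E]; exists (u^-1 * x); rewrite -mulrA -E mulKr. Qed.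

Lemma divides_add a b c : divides a b -> divides a c -> divides a (b + c).
Proof. by move=> [x ->] [y ->]; exists (x + y); rewrite mulrDl. Qed.

Lemma divides_unit a b : b \is a GRing.unit -> divides a b -> a \is a GRing.unit.
Proof. by move=> + [c E]; rewrite E unitrM => /andP[]. Qed.

Lemma prime_divides_prod p s : prime_elt p -> divides p (\prod_(q <- s) q) ->
  exists2 q, q \in s & divides p q.
Proof.
move=> pp; elim: s => [|q s IH].
  rewrite big_nil => /(divides_unit (unitr1 _)) Up.
  by case: pp => _; rewrite Up.
rewrite big_cons; case: pp => _ _ pp /pp[pq|/IH[r rs pr]].
  by exists q; rewrite ?mem_head.
by exists r; rewrite ?inE ?rs ?orbT.
Qed.

Lemma factors_mul a b s t : factors a s -> factors b t -> factors (a * b) (s ++ t).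
Proof.
move=> [u Uu ->] [v Uv ->]; exists (u * v); first by rewrite unitrM Uu.
by rewrite big_cat /= mulrACA.
Qed.

(* Each prime occurring in l can be moved from l to q or to h. *)
Lemma split_factors l s x q h : all_prime s -> factors l s -> l * x = q * h ->
  exists l1 q1 h1, [/\ divides l1 l, h = l1 * h1 & x = q1 * h1].
Proof.
elim: s l q h => [|p s IH] l q h ps [u Uu El] E.
  exists 1, (u^-1 * q), h; split; first by exists l; rewrite mulr1.
    by rewrite mul1r.
  by rewrite -mulrA -E El big_nil mulr1 mulKr.
have ps' : all_prime s by move=> r rs; apply: ps; rewrite inE rs orbT.
have [p0 _ pp] := ps p (mem_head _ _).
pose l' := u * \prod_(r <- s) r.
have fl' : factors l' s by exists u.
have El' : l = p * l' by rewrite El big_cons mulrCA.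
have : divides p (q * h) by rewrite -E El'; exists (l' * x); ring.
have dl : divides l' l by rewrite El'; apply: divides_mull; apply: divides_refl.
move=> /pp[[q' Eq]|[h' Eh]].
  have [|l1 [q1 [h1 [d1 -> ->]]]] := IH l' q' h ps' fl'.
    by apply: (mulfI p0); rewrite mulrA -El' E Eq; ring.
  by exists l1, q1, h1; split=> //; apply: divides_trans dl.
have [|l1 [q1 [h1 [d1 Eh1 ->]]]] := IH l' q h' ps' fl'.
  by apply: (mulfI p0); rewrite mulrA -El' E Eh; ring.
exists (p * l1), q1, h1; split=> //; last by rewrite Eh Eh1; ring.
by rewrite El'; move: d1 => [c ->]; exists c; rewrite mulrCA.
Qed.

End PrimeFactorization.

(** The factors are prime and not merely irreducible, which makes uniqueness automatic. *)
Definition factorial_ring (A : idomainType) :=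
  forall a : A, a != 0 -> exists2 s, all_prime s & factors a s.

Lemma factorial_field (F : fieldType) : factorial_ring F.
Proof.
move=> a a0; exists [::] => //; exists a; first by rewrite unitfE.
by rewrite big_nil mulr1.
Qed.

Section FactorialPoly.
Variable A : idomainType.
Hypothesis facA : factorial_ring A.
Implicit Types (a b c p : A) (f g h : {poly A}).

Lemma divides_polyC a f : divides a%:P f <-> forall i, divides a f`_i.
Proof.
split=> [[g ->] i|H]; first by exists g`_i; rewrite coefMC.
have /choice[c Hc] i : exists b, f`_i = b * a by exact: H.
exists (\poly_(i < size f) c i); apply/polyP => i; rewrite coefMC coef_poly.
by case: ltnP => [_|le]; [rewrite Hc|rewrite nth_default ?mul0r].
Qed.

(** Gauss's lemma: if [i] and [j] are the first indices at which [p] fails to divide the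
    coefficients of [f] and [g], then in the coefficient of index [i + j] of the product all terms
    but one are divisible by [p]. *)
Lemma prime_polyC p : prime_elt p -> prime_elt p%:P.
Proof.
move=> [p0 Up pp]; split; first by rewrite polyC_eq0.
  by rewrite poly_unitE coefC size_polyC p0.
move=> f g /divides_polyC H; apply: contrapT => /not_orP[nf ng].
have min f' : ~ divides p%:P f' -> exists i, ~ divides p f'`_i /\
    forall j, (j < i)%N -> divides p f'`_j.
  move=> nf'; have ex : exists i, `[< ~ divides p f'`_i >].
    apply: contrapT => H'; apply: nf'; apply/divides_polyC => i.
    by apply: contrapT => Hi; apply: H'; exists i; apply/asboolP.
  have [i /asboolP Hi mini] := ex_minnP ex; exists i; split=> // j ji.
  by apply: contrapT => /asboolP/mini; rewrite leqNgt ji.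
have [i [nfi fi]] := min f nf; have [j [ngj gj]] := min g ng.
have := H (i + j)%N; rewrite coefM.
have ij : (i < (i + j).+1)%N by rewrite ltnS leq_addr.
rewrite (bigD1 (Ordinal ij)) //= addKn => Hs.
have rest : divides p (\sum_(k < (i + j).+1 | k != Ordinal ij) f`_k * g`_(i + j - k)).
  elim/big_ind: _ => [|a b|k ki]; [by exists 0; rewrite mul0r|exact: divides_add|].
  have [lt|ge] := ltnP k i; first by apply: divides_mulr; apply: fi.
  apply: divides_mull; apply: gj.
  have : (i < k)%N by rewrite ltn_neqAle ge andbT; move: ki; rewrite -val_eqE eq_sym.
  by have := ltn_ord k; lia.
have : divides p (f`_i * g`_j).
  have [x Ex] := Hs; have [y Ey] := rest; exists (x - y).
  by rewrite mulrBl -Ex -Ey addrK.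
by move=> /pp[].
Qed.

Lemma polyC_factors a s : factors a s -> factors a%:P [seq p%:P | p <- s].
Proof.
move=> [u Uu ->]; exists u%:P; first by rewrite rmorph_unit.
by rewrite polyCM big_map rmorph_prod.
Qed.

Lemma polyC_all_prime s : all_prime s -> all_prime [seq p%:P | p <- s].
Proof. by move=> ps _ /mapP[p pis ->]; apply: prime_polyC; apply: ps. Qed.

Definition primitive f := forall a, divides a%:P f -> a \is a GRing.unit.

Lemma divides_polyC_const l f : l != 0 -> divides f l%:P -> exists b, f = b%:P.
Proof.
move=> l0 [c Ec]; exists f`_0; apply: size1_polyC.
have f0 : f != 0.
  by apply: contra_neq l0 => f0; move: Ec; rewrite f0 mulr0 => /eqP; rewrite polyC_eq0 => /eqP.
have c0 : c != 0.
  by apply: contra_neq l0 => c0; move: Ec; rewrite c0 mul0r => /eqP; rewrite polyC_eq0 => /eqP.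
have := size_mul c0 f0; rewrite -Ec size_polyC l0.
by move: c0 f0; rewrite -!size_poly_gt0; lia.
Qed.

(** The primes of [l] are distributed over [h] and [f]; the part falling to [f] is a constant, hence
    a unit. *)
Lemma primitive_dvd l f g h : l != 0 -> primitive f -> l *: g = h * f -> divides f g.
Proof.
move=> l0 pf E; have [s ps fs] := facA l0.
have [|l1 [q1 [h1 [d1 E1 E2]]]] :=
  split_factors (polyC_all_prime ps) (polyC_factors fs) (x := g) (q := h) (h := f).
  by rewrite mul_polyC.
have [b Eb] := divides_polyC_const l0 d1; rewrite Eb in E1.
have Ub : b \is a GRing.unit by apply: pf; exists h1; rewrite E1 mulrC.
exists (q1 * b^-1%:P); rewrite E2 E1 -!mulrA; congr (_ * _).
by rewrite mulrA -polyCM mulVr // mul1r.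
Qed.

Lemma prime_divisor a : a != 0 -> a \isn't a GRing.unit ->
  exists2 p, prime_elt p & divides p a.
Proof.
move=> a0 Ua; have [[|p s] ps [u Uu E]] := facA a0.
  by rewrite E big_nil mulr1 Uu in Ua.
exists p; first by apply: ps; rewrite mem_head.
by rewrite E; exists (u * \prod_(q <- s) q); rewrite big_cons; ring.
Qed.

Lemma prime_associate p q : prime_elt p -> prime_elt q -> divides p q ->
  exists2 x, x \is a GRing.unit & q = x * p.
Proof.
move=> [p0 Up _] [q0 Uq qq] [x E]; exists x => //.
have [//|[y Ey]|[y Ey]] := qq x p; first by exists 1; rewrite mul1r.
  case/negP: Up; have : y * p = 1.
    by apply: (mulIf q0); rewrite mul1r [RHS]E Ey; ring.
  by move=> yp; apply/unitrP; exists y; split; rewrite // mulrC.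
apply/unitrP; exists y; have : y * x = 1.
  by apply: (mulIf p0); rewrite mul1r [RHS]Ey E; ring.
by move=> yx; split; rewrite // mulrC.
Qed.

(** Induction on the number of primes of the leading coefficient: dividing [f] by a prime constant
    removes one of them. *)
Lemma primitive_part f : f != 0 -> exists s g,
  [/\ all_prime s, primitive g & f = (\prod_(p <- s) p)%:P * g].
Proof.
move=> f0; have lf0 : lead_coef f != 0 by rewrite lead_coef_eq0.
have [t pt ft] := facA lf0.
have [n] := ubnP (size t); elim: n f t f0 pt ft {lf0} => // n IH f t f0 pt ft tn.
have [pf|] := pselect (primitive f).
  by exists [::], f; split=> //; rewrite big_nil mul1r.
move=> /existsNP[a /not_implyP[[g Eg] /negP Ua]].
have a0 : a != 0 by apply: contra_neq f0 => a0; rewrite Eg a0 mulr0.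
have [p pp [b Eb]] := prime_divisor a0 Ua.
pose f1 := g * b%:P.
have Ef : f = f1 * p%:P by rewrite Eg Eb polyCM mulrA.
have f10 : f1 != 0 by apply: contra_neq f0 => f10; rewrite Ef f10 mul0r.
have lE : lead_coef f = lead_coef f1 * p by rewrite Ef lead_coefM lead_coefC.
have [u Uu Et] := ft.
have [q qt pq] : exists2 q, q \in t & divides p q.
  apply: prime_divides_prod => //; apply: (@divides_unitMl _ u) => //.
  by rewrite -Et lE; exists (lead_coef f1).
have [x Ux Eq] := prime_associate pp (pt q qt) pq.
have [p0 _ _] := pp.
have f1t : factors (lead_coef f1) (rem q t).
  exists (u * x); first by rewrite unitrM Uu.
  apply: (mulIf p0); rewrite -lE Et (perm_big _ (perm_to_rem qt)) big_cons /=.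
  by set m := \prod_(r <- rem q t) r; rewrite Eq; ring.
have [||s [g' [ps pg' E]]] := IH f1 (rem q t) f10 _ f1t.
- by move=> r /mem_rem; apply: pt.
- by rewrite size_rem //; case: (t) qt tn.
exists (p :: s), g'; split=> //.
  by move=> r; rewrite inE => /orP[/eqP->|/ps].
by rewrite Ef E big_cons polyCM; ring.
Qed.

(** An element [h] of least degree in the ideal of [f] and [b] pseudo-divides both. By
    irreducibility either [h] is a constant, and [f] divides a constant multiple of [c], or [h] is a
    constant multiple of [f], and [f] divides a constant multiple of [b]. Primitivity removes the
    constants. *)
Lemma irreducible_primitive_prime f : primitive f -> (1 < size f)%N ->
  (forall g h, f = g * h -> (size g <= 1)%N \/ (size h <= 1)%N) -> prime_elt f.
Proof.
move=> pf sf irr; have f0 : f != 0 by rewrite -size_poly_gt0 ltnW.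
split=> // [|b c [r Er]]; first by rewrite poly_unitE gtn_eqF.
pose I k := exists x y, k = x * f + y * b.
have ex : exists n, `[< exists2 h, I h & h != 0 /\ size h = n >].
  by exists (size f); apply/asboolP; exists f; [exists 1, 0; ring|].
have [_ /asboolP[h Ih [h0 <-]] minh] := ex_minnP ex.
have [x [y Eh]] := Ih.
have red k : I k -> exists l q, l != 0 /\ l *: k = q * h.
  move=> [x' [y' Ek]]; have := Pdiv.Idomain.divp_eq k h.
  set l := _ ^+ _; set q := (_ %/ _)%R; set m := (_ %% _)%R => E.
  exists l, q; split; first by rewrite expf_neq0 ?lead_coef_eq0.
  suff -> : l *: k = q * h + 0 by rewrite addr0.
  rewrite E; congr (_ + _); apply/eqP; apply: contraT => m0.
  have : (size h <= size m)%N.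
    apply: minh; apply/asboolP; exists m => //.
    exists (l *: x' - q * x), (l *: y' - q * y).
    have -> : m = l *: k - q * h by rewrite E addrC addKr.
    by rewrite Ek Eh -!mul_polyC; ring.
  by rewrite leqNgt ltn_modp h0.
have If : I f by exists 1, 0; ring.
have Ib : I b by exists 0, 1; ring.
have [l [q [l0 E]]] := red f If.
have [s ps fs] := facA l0.
have [|l1 [q1 [h1 [d1 E1 E2]]]] :=
  split_factors (polyC_all_prime ps) (polyC_factors fs) (x := f) (q := q) (h := h).
  by rewrite mul_polyC.
have [z E3] : exists z, l1 = z%:P by apply: divides_polyC_const d1; exact: l0.
have [sq|sh] := irr _ _ E2; last first.
  have [k Ek] : exists k, h = k%:P.
    exists h`_0; apply: size1_polyC.
    by rewrite E1 E3 mul_polyC; apply: leq_trans (size_scale_leq _ _) sh.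
  right; apply: (@primitive_dvd k _ _ (x * c + y * r)) => //.
    by rewrite -polyC_eq0 -Ek.
  by rewrite -mul_polyC -Ek Eh mulrDl -mulrA [y * b * c]mulrAC -mulrA [c * b]mulrC Er; ring.
move: (size1_polyC sq); set k := q1`_0 => Ek.
have Uk : k \is a GRing.unit by apply: pf; exists h1; rewrite E2 Ek mulrC.
have Eh1 : h1 = k^-1%:P * f by rewrite E2 Ek mulrA -polyCM mulVr ?mul1r.
have [l' [q' [l'0 E']]] := red b Ib.
left; apply: (@primitive_dvd l' _ _ (q' * l1 * k^-1%:P)) => //.
by rewrite E' E1 Eh1 !mulrA.
Qed.

Theorem factorial_poly : factorial_ring {poly A}.
Proof.
move=> f; have [n] := ubnP (size f); elim: n f => // n IH f fn f0.
have [s [g [ps pg E]]] := primitive_part f0.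
have g0 : g != 0 by apply: contra_neq f0 => g0; rewrite E g0 mulr0.
have gf : (size g <= size f)%N.
  rewrite E mul_polyC size_scale //; apply: contra_neq f0 => p0.
  by rewrite E p0 mul0r.
have [t pt ft] : exists2 t, all_prime t & factors g t.
  have [sg|sg] := leqP (size g) 1.
    exists [::] => //; exists g; last by rewrite big_nil mulr1.
    rewrite (size1_polyC sg) rmorph_unit //; apply: pg; exists 1.
    by rewrite mul1r -size1_polyC.
  have [[b [c [Eg sb sc]]]|nred] :=
    pselect (exists b c : {poly A}, [/\ g = b * c, (1 < size b)%N & (1 < size c)%N]).
    have b0 : b != 0 by rewrite -size_poly_gt0 ltnW.
    have c0 : c != 0 by rewrite -size_poly_gt0 ltnW.
    have sz : size g = (size b + size c).-1 by rewrite Eg size_mul.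
    have [|t1 p1 f1] := IH b _ b0; first by lia.
    have [|t2 p2 f2] := IH c _ c0; first by lia.
    exists (t1 ++ t2); last by rewrite Eg; apply: factors_mul.
    by move=> r; rewrite mem_cat => /orP[/p1|/p2].
  exists [:: g]; last by exists 1; rewrite ?unitr1 // big_seq1 mul1r.
  move=> r; rewrite inE => /eqP->; apply: irreducible_primitive_prime => // b c Eg.
  by apply: contrapT => /not_orP[/negP + /negP]; rewrite -!ltnNge => *; apply: nred; exists b, c.
exists ([seq p%:P | p <- s] ++ t).
  by move=> r; rewrite mem_cat => /orP[/(polyC_all_prime ps)|/pt].
rewrite E; apply: factors_mul ft; apply: polyC_factors.
by exists 1; rewrite ?unitr1 ?mul1r.
Qed.

End FactorialPoly.

(** * The equation of a surface *)

Section PrimeIdealOfPolynomials.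
Variable A : idomainType.
Implicit Types (a b c : A) (f g h : {poly A}).

Lemma prime_not_divides_polyC g c : (1 < size g)%N -> c != 0 -> ~ divides g c%:P.
Proof.
by move=> sg c0 /(divides_polyC_const c0)[b E]; move: sg; rewrite E size_polyC; case: (b != 0).
Qed.

Lemma pseudo_division g h : h != 0 -> exists l q r,
  [/\ l != 0, l *: g = q * h + r & (size r < size h)%N].
Proof.
move=> h0; exists (lead_coef h ^+ scalp g h), (g %/ h), (g %% h); split.
- by rewrite expf_neq0 ?lead_coef_eq0.
- exact: Pdiv.Idomain.divp_eq.
- by rewrite ltn_modp.
Qed.

(* An element of least size of the ideal (g, h) pseudo-divides g; as g is prime
   it must be a constant unless g divides h. *)
Lemma prime_bezout g h : prime_elt g -> (1 < size g)%N -> ~ divides g h ->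
  exists c f k, c != 0 /\ c%:P = f * g + k * h.
Proof.
move=> pg sg ngh; have [g0 _ gP] := pg.
pose I k := exists x y, k = x * g + y * h.
have ex : exists n, `[< exists2 k, I k & k != 0 /\ size k = n >].
  by exists (size g); apply/asboolP; exists g; [exists 1, 0; ring|].
have [_ /asboolP[k Ik [k0 <-]] mink] := ex_minnP ex.
have [x [y Ek]] := Ik.
have red f : I f -> exists l q, l != 0 /\ l *: f = q * k.
  move=> [x' [y' Ef]]; have [l [q [r [l0 E sr]]]] := pseudo_division f k0.
  exists l, q; split=> //; suff r0 : r = 0 by rewrite E r0 addr0.
  apply/eqP; apply: contraT => r0.
  suff : (size k <= size r)%N by rewrite leqNgt sr.
  apply: mink; apply/asboolP; exists r => //.
  exists (l *: x' - q * x), (l *: y' - q * y).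
  have -> : r = l *: f - q * k by rewrite E addrC addKr.
  by rewrite Ef Ek -!mul_polyC; ring.
suff /size1_polyC E : (size k <= 1)%N.
  by exists k`_0, x, y; rewrite -E -polyC_eq0 -E.
have Ig : I g by exists 1, 0; ring.
have Ih : I h by exists 0, 1; ring.
have [l [q [l0 E]]] := red g Ig; have [l' [q' [l'0 E']]] := red h Ih.
have [|[v Ev]|gk] := gP q k; first by rewrite -E -mul_polyC; exists l%:P.
  have [b ->] : exists b, k = b%:P.
    apply: (divides_polyC_const l0); exists v; apply: (mulIf g0).
    by rewrite mul_polyC E Ev; ring.
  by rewrite size_polyC; case: (b != 0).
have [|//|//] := gP l'%:P h.
  by rewrite mul_polyC E'; apply: divides_mull.
by move=> /(prime_not_divides_polyC sg l'0).
Qed.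

Lemma monic_division g h : g \is monic -> exists q r, h = q * g + r /\ (size r < size g)%N.
Proof.
move=> mg; have g0 : g != 0 by apply: monic_neq0.
exists (h %/ g), (h %% g); split; last by rewrite ltn_modp.
exact: (Pdiv.IdomainMonic.divp_eq mg).
Qed.

Variable J : {poly A} -> Prop.
Hypothesis JB : forall f g, J f -> J g -> J (f - g).
Hypothesis JM : forall f g, J g -> J (f * g).
Hypothesis Jprime : forall f g, J (f * g) -> J f \/ J g.
Hypothesis JC : forall a, J a%:P -> a = 0.

Lemma prime_ideal_prod (s : seq {poly A}) : J (\prod_(p <- s) p) ->
  exists2 p, p \in s & J p.
Proof.
elim: s => [|p s IH].
  by rewrite big_nil => /JC/eqP; rewrite oner_eq0.
rewrite big_cons => /Jprime[Jp|/IH[q qs Jq]]; first by exists p; rewrite ?mem_head.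
by exists q; rewrite ?inE ?qs ?orbT.
Qed.

(** Some prime factor of [f] lies in [J], and a unit makes it monic. Remainders modulo this [g] stay
    in [J] and must vanish: an element of [J] of least degree, below that of [g], would
    pseudo-divide the prime [g] and so be a constant, against [JC], or a multiple of [g], of too
    large a degree. *)
Lemma prime_ideal_generator f : factorial_ring {poly A} -> J f -> f \is monic ->
  exists g, [/\ J g, prime_elt g, g \is monic, divides g f & forall h, J h -> divides g h].
Proof.
move=> fac Jf mf; have [s ps [u Uu Ef]] := fac f (monic_neq0 mf).
have [p pis Jp] : exists2 p, p \in s & J p.
  apply: prime_ideal_prod; have : J (u^-1 * f) by apply: JM.
  by rewrite Ef mulKr.
have [p0 Up pP] := ps p pis.
have [q Eq] : divides p f.
  by rewrite Ef (big_rem p) //= mulrCA; apply: divides_mulr; apply: divides_refl.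
have lpq : lead_coef q * lead_coef p = 1.
  by rewrite -lead_coefM -Eq; apply/eqP.
have Ul : lead_coef p \is a GRing.unit.
  by apply/unitrP; exists (lead_coef q); split; rewrite // mulrC.
pose v : {poly A} := (lead_coef p)^-1%:P.
have Uv : v \is a GRing.unit by rewrite rmorph_unit // unitrV.
have vp : divides (v * p) p by exists v^-1; rewrite mulKr.
have pv h : divides p h -> divides (v * p) h by apply: divides_trans.
have Jg : J (v * p) by apply: JM.
have pg : prime_elt (v * p).
  split; first by rewrite mulf_neq0 //; apply: contraTneq Uv => ->; rewrite unitr0.
    by rewrite unitrMr.
  move=> a b ab; have [|/pv|/pv] := pP a b; [|by left|by right].
  by apply: divides_trans ab; exists v.
have mg : v * p \is monic by rewrite monicE lead_coefM lead_coefC mulVr.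
exists (v * p); split=> //; first by apply: pv; exists q.
set g := v * p in Jg pg mg *.
have [g0 _ gP] := pg.
have small r : J r -> (size r < size g)%N -> r = 0.
  move=> Jr rg; apply/eqP; apply: contraT => r0.
  have ex : exists n, `[< exists2 k, J k & k != 0 /\ size k = n >].
    by exists (size r); apply/asboolP; exists r.
  have [_ /asboolP[k Jk [k0 <-]] mink] := ex_minnP ex.
  have kr : (size k <= size r)%N by apply: mink; apply/asboolP; exists r.
  have [l [q' [m [l0 E sm]]]] := pseudo_division g k0.
  have m0 : m = 0.
    apply/eqP; apply: contraT => m0; suff : (size k <= size m)%N by rewrite leqNgt sm.
    apply: mink; apply/asboolP; exists m => //.
    have -> : m = l%:P * g - q' * k by rewrite mul_polyC E addrC addKr.
    by apply: JB; apply: JM.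
  have [|[w Ew]|[w Ew]] := gP q' k.
  - by exists l%:P; rewrite mul_polyC E m0 addr0.
  - have [b Eb] : exists b, k = b%:P.
      apply: (divides_polyC_const l0); exists w; apply: (mulIf g0).
      by rewrite mul_polyC E m0 Ew; ring.
    by move: k0 Jk; rewrite Eb polyC_eq0 => /negP + /JC b0; rewrite b0 eqxx.
  - have w0 : w != 0 by apply: contra_neq k0 => w0; rewrite Ew w0 mul0r.
    move: kr; rewrite Ew size_mul // (polySpred w0) addSn /=.
    by move=> /(leq_trans (leq_addl _ _)); rewrite leqNgt rg.
move=> h Jh; have [q' [r [Eh sr]]] := monic_division h mg.
exists q'; rewrite Eh (small r) ?addr0 //.
have -> : r = h - q' * g by rewrite Eh addrC addKr.
by apply: JB => //; apply: JM.
Qed.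

End PrimeIdealOfPolynomials.

(** * Total degree of equations *)

Section Weight.
Variable K : idomainType.
Implicit Types (f g q : {poly {poly K}}).

(* Both variables have weight 1. *)
Definition weight_le n f := forall j, (size (f`_j)%R <= n.+1 - j)%N.

(* The substitution (x, y) |-> (s, s t) turns weight into degree in s. *)
Definition blowup f : {poly {poly K}} :=
  (map_poly (map_poly polyC) f).['X%:P * 'X].

Lemma blowupM f g : blowup (f * g) = blowup f * blowup g.
Proof. by rewrite /blowup rmorphM hornerM. Qed.

Lemma coef_blowup f t j :
  (blowup f)`_t`_j = if (j <= t)%N then f`_j`_(t - j) else 0.
Proof.
rewrite /blowup horner_coef coef_sum.
have -> : \sum_(i < size (map_poly (map_poly polyC) f))
    ((map_poly (map_poly polyC) f)`_i * ('X%:P * 'X) ^+ i)`_t =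
    \sum_(i < size (map_poly (map_poly polyC) f))
      (if (t < i)%N then 0 else (f`_i`_(t - i))%:P * 'X^i) :> {poly K}.
  apply: eq_bigr => i _; rewrite coef_map /= exprMn mulrA coefMXn.
  by case: ifP => // _; rewrite -rmorphXn coefMC coef_map.
have sz : size (map_poly (map_poly (@polyC K)) f) = size f.
  by apply: size_map_inj_poly; rewrite ?rmorph0 //; apply: map_inj_poly => //; apply: polyC_inj.
rewrite coef_sum.
have [jf|fj] := ltnP j (size (map_poly (map_poly (@polyC K)) f)).
  rewrite (bigD1 (Ordinal jf)) //= big1 => [|i ij].
    by rewrite addr0 ltnNge; case: leqP => _ /=; rewrite ?coef0 // coefCM coefXn eqxx mulr1.
  case: ifP; rewrite ?coef0 // coefCM coefXn.
  by case: eqP => [E|_ _]; [move: ij; rewrite -val_eqE /= E eqxx|rewrite mulr0].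
rewrite big1 => [|i _]; last first.
  case: ifP; rewrite ?coef0 // coefCM coefXn.
  by case: eqP => [E|_ _]; [have := ltn_ord i; rewrite -E ltnNge fj|rewrite mulr0].
by move: fj; rewrite sz => fj; rewrite [f`_j]nth_default // coef0; case: ifP.
Qed.

Lemma weight_blowup n f : weight_le n f <-> (size (blowup f) <= n.+1)%N.
Proof.
split=> [H|H j].
  apply/leq_sizeP => t nt; apply/polyP => j; rewrite coef_blowup coef0.
  case: leqP => // jt; apply: nth_default; apply: leq_trans (H j) _.
  by apply: leq_sub2r.
apply/leq_sizeP => i ji; have := coef_blowup f (i + j) j.
rewrite leq_addl addnK => <-; rewrite (leq_sizeP _ _ H) ?coef0 //.
by move: ji; lia.
Qed.

Lemma size_blowup_ge f : lead_coef f \is a GRing.unit -> (size f <= size (blowup f))%N.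
Proof.
move=> Uf; have f0 : f != 0 by apply: contraTneq Uf => ->; rewrite lead_coef0 unitr0.
rewrite (polySpred f0) ltnNge; apply/negP => H.
have := coef_blowup f (size f).-1 (size f).-1.
rewrite leqnn subnn (leq_sizeP _ _ H) // coef0 -/(lead_coef f) => /esym l0.
by move: Uf; rewrite poly_unitE l0 unitr0 andbF.
Qed.

(** Degrees after [blowup] add up in a product, and each factor has there at least its degree in the
    outer variable. Equality for [f] thus forces equality for its factors. *)
Lemma weight_divisor f g : f \is monic -> weight_le (size f).-1 f -> g \is monic ->
  divides g f -> weight_le (size g).-1 g.
Proof.
move=> mf wf mg [q Ef]; apply/weight_blowup.
have f0 := monic_neq0 mf; have g0 := monic_neq0 mg.
have q0 : q != 0 by apply: contra_neq f0 => q0; rewrite Ef q0 mul0r.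
have mq : lead_coef q \is a GRing.unit.
  by have := lead_coefM q g; rewrite -Ef (monicP mf) (monicP mg) mulr1 => <-; apply: unitr1.
have sg : (size g <= size (blowup g))%N by apply: size_blowup_ge; rewrite (monicP mg) unitr1.
have sq := size_blowup_ge mq.
move/weight_blowup: wf; rewrite Ef blowupM.
have gs0 : (0 < size g)%N by rewrite size_poly_gt0.
have qs0 : (0 < size q)%N by rewrite size_poly_gt0.
rewrite size_mul -?size_poly_gt0; [|by apply: leq_trans sq|by apply: leq_trans sg].
rewrite size_mul //; move: sg sq gs0 qs0.
set a := size (blowup q); set b := size (blowup g).
by move: (size g) (size q) a b => i j a b; lia.
Qed.

End Weight.

Section Evaluation.
Variable F : numFieldType.

(* The variables are nested as F[b1][b2][y]. *)
Definition ev2 (b1 b2 : F) : {rmorphism {poly {poly F}} -> F} :=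
  horner_eval b1 \o horner_eval b2%:P.

Definition ev3 (b1 b2 y : F) : {rmorphism {poly {poly {poly F}}} -> F} :=
  horner_eval y \o map_poly (ev2 b1 b2).

Lemma ev2E b1 b2 a : ev2 b1 b2 a = a.[b2%:P].[b1]. Proof. by []. Qed.

Lemma ev3E b1 b2 y h : ev3 b1 b2 y h = (map_poly (ev2 b1 b2) h).[y]. Proof. by []. Qed.

Lemma ev2C b1 b2 (c : {poly F}) : ev2 b1 b2 c%:P = c.[b1].
Proof. by rewrite ev2E hornerC. Qed.

Lemma ev2X b1 b2 : ev2 b1 b2 'X = b2.
Proof. by rewrite ev2E hornerX hornerC. Qed.

Lemma ev3C b1 b2 y (c : {poly {poly F}}) : ev3 b1 b2 y c%:P = ev2 b1 b2 c.
Proof. by rewrite ev3E map_polyC hornerC. Qed.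

Lemma ev3X b1 b2 y : ev3 b1 b2 y 'X = y.
Proof. by rewrite ev3E map_polyX hornerX. Qed.

Lemma ev2_sum b1 b2 (a : {poly {poly F}}) :
  ev2 b1 b2 a = \sum_(i < size a) (a`_i).[b1] * b2 ^+ i.
Proof.
rewrite ev2E [a.[_]]horner_coef horner_sum; apply: eq_bigr => i _.
by rewrite -rmorphXn /= hornerM hornerC.
Qed.

Lemma ev2_neq0 (a : {poly {poly F}}) : a != 0 ->
  exists b : 'rV[F]_2, ev2 (b 0 0) (b 0 1) a != 0.
Proof.
rewrite -lead_coef_eq0 => /poly_neq0_ex[b1 Hb1].
have /poly_neq0_ex[b2 Hb2] : map_poly (horner_eval b1) a != 0.
  by apply: contra_neq Hb1 => /polyP/(_ (size a).-1); rewrite coef_map coef0.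
exists (\row_i if i == 0 then b1 else b2); rewrite !mxE /=.
have := horner_map (horner_eval b1) a b2%:P; rewrite /= !horner_evalE hornerC => <-.
exact: Hb2.
Qed.

Lemma lpoly_ev2 (a : {poly {poly F}}) :
  lpoly (fun b : 'rV[F]_2 => ev2 (b 0 0) (b 0 1) a).
Proof.
have lv i : lpoly (fun b : 'rV[F]_2 => b 0 i).
  by move=> x y; exists ((x 0 i)%:P + (y 0 i)%:P * 'X) => t; rewrite !mxE !hornerE mulrC.
move=> x y; have [|p Hp] := @lpoly_sum F _ _ (index_enum 'I_(size a))
  (fun i (b : 'rV[F]_2) => (a`_i).[b 0 0] * b 0 1 ^+ i) _ x y.
  move=> i _; apply: lpolyM; last exact: lpolyX.
  move=> u v; have [|p Hp] := @lpoly_sum F _ _ (index_enum 'I_(size a`_i))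
    (fun j (b : 'rV[F]_2) => a`_i`_j * b 0 0 ^+ j) _ u v.
    by move=> j _; apply: lpolyM; [apply: lpoly_cst|apply: lpolyX].
  by exists p => t; rewrite -Hp horner_coef.
by exists p => t; rewrite -Hp ev2_sum.
Qed.

Definition poly3_of_mpoly (P : {mpoly F[3]}) : {poly {poly {poly F}}} :=
  mmap (fun c => c%:P%:P%:P)
    (fun i : 'I_3 => if i == 0 then 'X%:P%:P else if i == 1 then 'X%:P else 'X) P.

Definition vec3 (b1 b2 y : F) (i : 'I_3) :=
  if i == 0 then b1 else if i == 1 then b2 else y.

Lemma ev3_mpoly b1 b2 y P : ev3 b1 b2 y (poly3_of_mpoly P) = P.@[vec3 b1 b2 y].
Proof.
rewrite /poly3_of_mpoly /mmap rmorph_sum mevalE; apply: eq_bigr => m _.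
rewrite rmorphM; congr (_ * _).
  by rewrite ev3C ev2C hornerC.
rewrite /mmap1 rmorph_prod; apply: eq_bigr => i _; rewrite rmorphXn; congr (_ ^+ _).
rewrite /vec3; case: eqP => _; first by rewrite ev3C ev2C hornerX.
by case: eqP => _; [rewrite ev3C ev2X|rewrite ev3X].
Qed.

(** Only the degree in the second variable is bounded: [b1] later serves as the parameter of the
    plane sections. *)
Lemma poly2_of_polyfun (T : Type) (u : 'I_2 -> T -> F) n f : polyfun u n f ->
  exists2 a : {poly {poly F}}, (size a <= n.+1)%N & forall x, f x = ev2 (u 0 x) (u 1 x) a.
Proof.
elim=> {n f} [n b f E|n f g h _ [a sa Ha] _ [c sc Hc] E|n i f g _ [a sa Ha] E].
- exists b%:P%:P; first by apply: leq_trans (size_polyC_leq1 _) _.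
  by move=> x; rewrite E ev2C hornerC.
- exists (a + c); last by move=> x; rewrite E Ha Hc rmorphD.
  by apply: leq_trans (size_polyD _ _) _; rewrite geq_max sa.
- have [Ei|Ei] := eqVneq i 0.
    exists ('X%:P * a); last by move=> x; rewrite E Ei Ha rmorphM ev2C hornerX.
    rewrite mul_polyC; apply: leq_trans (size_scale_leq _ _) _.
    exact: leq_trans sa _.
  have {}Ei : i = 1 by apply: val_inj; case: i {E} Ei => -[|[|]].
  exists ('X * a); last by move=> x; rewrite E Ei Ha rmorphM ev2X.
  by apply: leq_trans (size_polyMleq _ _) _; rewrite size_polyX.
Qed.

Lemma mpoly_of_poly2 (a : {poly {poly F}}) : a != 0 ->
  exists2 P : {mpoly F[2]}, P != 0 & forall u : 'I_2 -> F, P.@[u] = ev2 (u 0) (u 1) a.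
Proof.
move=> a0.
pose P : {mpoly F[2]} := \sum_(i < size a) (\sum_(j < size a`_i) a`_i`_j *: 'X_0 ^+ j) * 'X_1 ^+ i.
have EP u : P.@[u] = ev2 (u 0) (u 1) a.
  rewrite ev2_sum rmorph_sum; apply: eq_bigr => i _.
  rewrite rmorphM rmorphXn /= mevalXU rmorph_sum; congr (_ * _).
  rewrite horner_coef; apply: eq_bigr => j _.
  by rewrite /= mevalZ rmorphXn /= mevalXU.
exists P => //; have [b] := ev2_neq0 a0; rewrite -(EP (fun i => b 0 i)).
by apply: contra_neq => ->; rewrite meval0.
Qed.

End Evaluation.

Section SurfaceEquation.
Variables (F : numClosedFieldType) (T : Type) (W : set T) (u : 'I_2 -> T -> F) (w : T -> F).

Definition on_surface (h : {poly {poly {poly F}}}) :=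
  forall x, W x -> ev3 (u 0 x) (u 1 x) (w x) h = 0.

Definition surface_equation (g : {poly {poly {poly F}}}) :=
  [/\ on_surface g, prime_elt g, g \is monic, weight_le (size g).-1 g &
      forall h, on_surface h -> divides g h].

Hypothesis surface_prime :
  forall g h, on_surface (g * h) -> on_surface g \/ on_surface h.
Hypothesis independent : ~ algdep W u.

Lemma on_surfaceC a : on_surface a%:P -> a = 0.
Proof.
move=> Ja; apply/eqP; apply: contraT => a0; case: independent.
have [P P0 HP] := mpoly_of_poly2 a0; exists P => // x /Ja.
by rewrite HP ev3C.
Qed.

(** The integral relation is a monic element of the ideal of the surface whose total degree in [b2]
    and [y] equals its degree in [y]. Its prime factor in the ideal inherits both properties. *)
Lemma exists_surface_equation n b : integral_relation W u w n b ->
  exists g, surface_equation g.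
Proof.
move=> [pb Hb].
have /choice[a Ha] j : exists a : {poly {poly F}}, (j < n)%N ->
    (size a <= (n - j).+1)%N /\ forall x, b j x = ev2 (u 0 x) (u 1 x) a.
  case: (ltnP j n) => jn; last by exists 0.
  by have [a sa Ha] := poly2_of_polyfun (pb j jn); exists a.
pose r : {poly {poly {poly F}}} := \poly_(j < n) a j.
pose f := 'X^n - r.
have sr : (size (- r)%R < size ('X^n : {poly {poly {poly F}}}))%N.
  by rewrite size_polyN size_polyXn ltnS size_poly.
have mf : f \is monic by rewrite monicE /f lead_coefDl // lead_coefXn.
have sf : size f = n.+1 by rewrite /f size_polyDl // size_polyXn.
have wf : weight_le (size f).-1 f.
  move=> j; rewrite sf /f coefB coefXn coef_poly /=.
  have [->|jn] := eqVneq j n.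
    by rewrite ltnn subr0 subSn // subnn size_poly1.
  rewrite sub0r size_polyN; case: ltnP => jn'; last by rewrite size_poly0.
  by rewrite subSn ?(ltnW jn') //; have [] := Ha j jn'.
have Jf : on_surface f.
  move=> x Wx; rewrite rmorphB rmorphXn ev3X ev3E.
  rewrite Hb // (horner_coef_wide _ (n := n)); last first.
    by apply: leq_trans (size_poly _ _) (size_poly _ _).
  apply/eqP; rewrite subr_eq0; apply/eqP; apply: eq_bigr => j _.
  rewrite coef_map coef_poly ltn_ord /= mulrC.
  by have [_ ->] := Ha j (ltn_ord j).
have [|||||g [Jg pg mg gf gJ]] := @prime_ideal_generator _ on_surface _ _ _ _ f _ Jf mf.
- by move=> g h Jg Jh x Wx; rewrite rmorphB Jg ?Jh ?subr0.
- by move=> g h Jh x Wx; rewrite rmorphM Jh ?mulr0.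
- exact: surface_prime.
- exact: on_surfaceC.
- by do 3! apply: factorial_poly; apply: factorial_field.
by exists g; split=> //; apply: weight_divisor wf mg gf.
Qed.

Variable g : {poly {poly {poly F}}}.
Hypothesis eq_g : surface_equation g.

Lemma size_surface_equation : (1 < size g)%N.
Proof.
have [_ [g0 Ug _] mg _ _] := eq_g; rewrite ltnNge; apply/negP => /size1_polyC E.
case/negP: Ug; move: mg; rewrite E monicE lead_coefC => /eqP->.
exact: unitr1.
Qed.

Lemma surface_bezout h : ~ on_surface h ->
  exists c f k, c != 0 /\ c%:P = f * g + k * h.
Proof.
have [Jg pg _ _ _] := eq_g => nJ.
apply: prime_bezout => //; first exact: size_surface_equation.
by move=> [q E]; apply: nJ => x Wx; rewrite E rmorphM Jg ?mulr0.
Qed.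

(* For generic (b1, b2) all roots y of g(b1, b2, -) are simple and satisfy the
   same equations and inequations as a generic point of the surface. *)
Lemma generic_fiber (ps : seq {mpoly F[3]}) (phi : 'rV[F]_2 -> F) :
  (forall z z' : 'I_3 -> F, (forall p, p \in ps -> (p.@[z] == 0) = (p.@[z'] == 0)) ->
     (exists2 x, W x & vec3 (u 0 x) (u 1 x) (w x) =1 z) ->
     exists2 x, W x & vec3 (u 0 x) (u 1 x) (w x) =1 z') ->
  lpoly phi -> (exists b, phi b != 0) ->
  exists (b : 'rV[F]_2) (ys : seq F), [/\ phi b != 0, uniq ys, size ys = (size g).-1 &
    forall y, y \in ys -> exists2 x, W x & [/\ u 0 x = b 0 0, u 1 x = b 0 1 & w x = y]].
Proof.
move=> Hps lphi phi0; have [Jg pg mg _ gJ] := eq_g; have [g0 _ _] := pg.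
have sg := size_surface_equation.
(* A tested polynomial that vanishes on the surface is a multiple of [g]. The others have to be
   nonzero on the fibre, and the derivative of [g] is added to keep the roots simple. *)
pose atoms := [seq poly3_of_mpoly p | p <- ps & `[< ~ on_surface (poly3_of_mpoly p) >]].
pose hs := g^`() :: atoms.
have nhs h : h \in hs -> ~ on_surface h.
  rewrite inE => /orP[/eqP->|/mapP[p + ->]]; last by rewrite mem_filter => /andP[/asboolP].
  move=> /gJ[q E]; have dg0 : g^`() != 0.
    have [k Ek] : exists k, size g = k.+2.
      by move: sg; case: (size g) => [|[|k]] // _; exists k.
    have lg : g`_k.+1 = 1 by rewrite -(monicP mg) lead_coefE Ek.
    apply/eqP => /polyP/(_ k); rewrite coef_deriv coef0 lg.
    move=> /(congr1 (ev2 0 0)); rewrite rmorphMn rmorph1 rmorph0 => /eqP.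
    by rewrite pnatr_eq0.
  have q0 : q != 0 by apply: contra_neq dg0 => q0; rewrite E q0 mul0r.
  have := lt_size_deriv g0; rewrite E size_mul // (polySpred q0) addSn /=.
  by rewrite ltnNge leq_addl.
(* [c h] results from eliminating [y] from [g] and [h]: where it is nonzero, they have no common
   root. *)
have /choice[c Hc] h : exists c : {poly {poly F}}, h \in hs ->
    c != 0 /\ exists f k, c%:P = f * g + k * h.
  have [hhs|nhh] := boolP (h \in hs); last by exists 0.
  by have [c [f [k [c0 E]]]] := surface_bezout (nhs h hhs); exists c => _; split=> //; exists f, k.
have lps : lpoly (fun b : 'rV[F]_2 => \prod_(h <- hs) ev2 (b 0 0) (b 0 1) (c h)).
  by apply: lpoly_prod => h _; apply: lpoly_ev2.
have [|b] := lpoly_neq0M lphi lps phi0.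
  apply: lpoly_neq0_prod => h hhs; first exact: lpoly_ev2.
  by apply: ev2_neq0; have [] := Hc h hhs.
rewrite mulf_eq0 negb_or => /andP[phib]; rewrite prodf_seq_neq0 => /allP Hb.
set b1 := b 0 0 in Hb *; set b2 := b 0 1 in Hb *.
have coprime h y : h \in hs -> ev3 b1 b2 y g = 0 -> ev3 b1 b2 y h != 0.
  move=> hhs gy; have [_ [f [k E]]] := Hc h hhs.
  have := congr1 (ev3 b1 b2 y) E; rewrite rmorphD !rmorphM gy mulr0 add0r.
  rewrite ev3C => E'.
  by have := implyP (Hb h hhs) isT; rewrite E'; apply: contraNneq => ->; rewrite mulr0.
pose gb := map_poly (ev2 b1 b2) g.
have mgb : gb \is monic by apply: monic_map.
have sgb : size gb = size g.
  by rewrite /gb size_map_poly_id0 // (monicP mg) rmorph1 oner_eq0.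
have [ys Eys] := closed_field_poly_normal gb.
rewrite (monicP mgb) scale1r in Eys.
have rt y : y \in ys -> ev3 b1 b2 y g = 0.
  by move=> yys; rewrite ev3E -/gb; apply/rootP; rewrite Eys root_prod_XsubC.
have sys : size ys = (size g).-1 by rewrite -sgb Eys size_prod_XsubC.
exists b, ys; split=> //.
  rewrite -separable_prod_XsubC -Eys separable_poly.unlock; apply: contrapT => /negP nco.
  have [y] := closed_rootP _ nco.
  rewrite root_gcd => /andP[ry ry'].
  have := @coprime g^`() y (mem_head _ _); rewrite !ev3E => /(_ (rootP ry)).
  by rewrite -deriv_map -/gb (rootP ry') eqxx.
move=> y yys.
(* Such an [x0] exists because the ideal is prime, and [(b1, b2, y)] has the same vanishing pattern
   as its image. *)
have [x0 Wx0 Hx0] : exists2 x, W x & forall h, h \in atoms -> ev3 (u 0 x) (u 1 x) (w x) h != 0.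
  suff H (s : seq {poly {poly {poly F}}}) : (forall h, h \in s -> ~ on_surface h) ->
      ~ on_surface (\prod_(h <- s) h).
    have : ~ on_surface (\prod_(h <- atoms) h).
      by apply: H => h ha; apply: nhs; rewrite inE ha orbT.
    move=> /existsNP[x /not_implyP[Wx /eqP Hx]]; exists x => // h ha.
    by move: Hx; rewrite rmorph_prod prodf_seq_neq0 => /allP/(_ h ha)/implyP; apply.
  elim: s => [|h s IH] H.
    rewrite big_nil -[1]/(1%:P) => /on_surfaceC/eqP; rewrite oner_eq0.
    by [].
  rewrite big_cons => /surface_prime[|]; first by apply: H; rewrite mem_head.
  by apply: IH => k ks; apply: H; rewrite inE ks orbT.
have [||x Wx Hx] := Hps (vec3 (u 0 x0) (u 1 x0) (w x0)) (vec3 b1 b2 y).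
- move=> p pps; rewrite -!ev3_mpoly.
  have [Jp|nJp] := pselect (on_surface (poly3_of_mpoly p)).
    rewrite Jp // eqxx; have [q ->] := gJ _ Jp.
    by rewrite rmorphM (rt y yys) mulr0 eqxx.
  have pa : poly3_of_mpoly p \in atoms.
    by apply: map_f; rewrite mem_filter pps andbT; apply/asboolP.
  rewrite (negPf (Hx0 _ pa)) (negPf (coprime _ _ _ (rt y yys))) //.
  by rewrite inE pa orbT.
- by exists x0.
by exists x => //; split; [apply: (Hx 0)|apply: (Hx 1)|apply: (Hx (@Ordinal 3 2 isT))].
Qed.

End SurfaceEquation.

(** * Cones and rich points *)

Section PlaneBezout.
Variable F : fieldType.
Implicit Types (p q : {poly {poly F}}).

Lemma size_resultant p q n : (forall i, size (p`_i)%R <= n.+1)%N ->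
  (forall i, size (q`_i)%R <= n.+1)%N ->
  (size (resultant p q) <= ((size q).-1 + (size p).-1) * n + 1)%N.
Proof.
move=> bp bq; rewrite /resultant /determinant.
apply: leq_trans (size_sum _ _ _) _; apply/bigmax_leqP => s _.
have entry i j : (size (Sylvester_mx p q i j) <= n.+1)%N.
  rewrite Sylvester_mxE; case: (fintype.split i) => k;
    by case: (k <= j)%N; rewrite /= ?mulr1n ?mulr0n ?size_poly0 ?bp ?bq.
rewrite size_Msign; apply: leq_trans (size_prod_leq _ _) _.
rewrite cardT size_enum_ord leq_subLR.
apply: (@leq_trans (\sum_(i < (size q).-1 + (size p).-1) n.+1).+1).
  by rewrite ltnS; apply: leq_sum => i _; apply: entry.
by rewrite sum_nat_const card_ord mulnS addn1 addnS.
Qed.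

(** The resultant vanishes at the first coordinate of each common zero, and these coordinates
    outnumber its degree, at most the order of the Sylvester matrix times [n]. *)
Lemma common_factor p q n (pts : seq (F * F)) :
  (1 < size p)%N -> (1 < size q)%N ->
  (forall i, size (p`_i)%R <= n.+1)%N -> (forall i, size (q`_i)%R <= n.+1)%N ->
  uniq [seq z.1 | z <- pts] ->
  (forall z, z \in pts -> p.[z.2%:P].[z.1] = 0 /\ q.[z.2%:P].[z.1] = 0) ->
  (((size q).-1 + (size p).-1) * n < size pts)%N ->
  (1 < size (gcdp p q))%N.
Proof.
move=> p1 q1 bp bq up zp N; rewrite -resultant_eq0; apply: contraT => r0.
have [[a b] /= _ E] := resultant_in_ideal p1 q1.
have : (size [seq z.1 | z <- pts] < size (resultant p q))%N.
  apply: max_poly_roots => //; apply/allP => _ /mapP[z zpts ->].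
  have := congr1 (fun h : {poly {poly F}} => h.[z.2%:P].[z.1]) E.
  have [pz qz] := zp z zpts.
  by rewrite hornerC hornerD !hornerM hornerD !hornerM pz qz !mulr0 addr0 => /rootP.
rewrite size_map ltnNge => /negP[]; apply: leq_trans (size_resultant bp bq) _.
by rewrite addn1.
Qed.

End PlaneBezout.

(** * Dilations and homogeneity *)

Section Dilation.
Variable F : numClosedFieldType.
Implicit Types (g h : {poly {poly {poly F}}}).

Definition dil (a l b : F) := a + l * (b - a).

Definition dilX (A : nzRingType) (a l : A) : {poly A} := (a - l * a)%:P + l *: 'X.

Lemma dilXE (A : comNzRingType) (a l b : A) : (dilX a l).[b] = a + l * (b - a).
Proof. by rewrite /dilX hornerD hornerC hornerZ hornerX; ring. Qed.

Lemma size_dilX (A : idomainType) (a l : A) : l != 0 -> size (dilX a l) = 2.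
Proof.
move=> l0; rewrite /dilX addrC size_polyDl size_scale // size_polyX //.
by apply: leq_ltn_trans (size_polyC_leq1 _) _.
Qed.

Lemma lead_dilX (A : idomainType) (a l : A) : l != 0 -> lead_coef (dilX a l) = l.
Proof.
move=> l0; rewrite /dilX addrC lead_coefDl ?lead_coefZ ?lead_coefX ?mulr1 //.
by rewrite size_scale // size_polyX; apply: leq_ltn_trans (size_polyC_leq1 _) _.
Qed.

Lemma dilate2 a1 a2 l : l != 0 -> exists t : {rmorphism {poly {poly F}} -> {poly {poly F}}},
  [/\ forall c, t c%:P%:P = c%:P%:P, forall a, (size (t a) <= size a)%N &
   forall b1 b2 a, ev2 b1 b2 (t a) = ev2 (dil a1 l b1) (dil a2 l b2) a].
Proof.
move=> l0; pose t1 : {rmorphism {poly F} -> {poly F}} := comp_poly (dilX a1 l).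
pose t : {rmorphism {poly {poly F}} -> {poly {poly F}}} :=
  comp_poly (dilX a2%:P l%:P) \o map_poly t1.
have tE a : t a = map_poly t1 a \Po dilX a2%:P l%:P by [].
have t1C c : t1 c%:P = c%:P by exact: comp_polyC.
exists t; split=> [c|a|b1 b2 a].
- by rewrite tE map_polyC /= t1C comp_polyC.
- by rewrite tE size_comp_poly2 ?size_dilX ?polyC_eq0 // size_poly.
- rewrite !ev2E tE horner_comp dilXE -!polyCB -!polyCM -!polyCD -/(dil a2 l b2).
  rewrite -{1}(t1C (dil a2 l b2)) horner_map /= horner_comp dilXE //.
Qed.

(* h(z) = l^-m g(a + l (z - a)) with m the degree of g in the last variable. *)
Lemma dilate3 a1 a2 a3 l g n : l != 0 -> g \is monic ->
  (forall i, size (g`_i)%R <= n.+1)%N ->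
  exists h, [/\ h \is monic, size h = size g, (forall i, size (h`_i)%R <= n.+1)%N &
   forall b1 b2 y, ev3 (dil a1 l b1) (dil a2 l b2) (dil a3 l y) g =
                   l ^+ (size g).-1 * ev3 b1 b2 y h].
Proof.
move=> l0 mg bg; have [t [tC st tE]] := dilate2 a1 a2 l0.
pose cc (c : F) : {poly {poly F}} := c%:P%:P.
have ccE : cc = polyC \o polyC by [].
have cc0 : cc l != 0 by rewrite !polyC_eq0.
pose k := map_poly t g \Po dilX (cc a3) (cc l).
have st1 : size (map_poly t g) = size g.
  by rewrite size_map_poly_id0 // (monicP mg) rmorph1 oner_eq0.
have sk : size k = size g by rewrite size_comp_poly2 ?size_dilX.
have lk : lead_coef k = cc (l ^+ (size g).-1).
  rewrite lead_coef_comp ?size_dilX // lead_dilX // st1.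
  have -> : lead_coef (map_poly t g) = 1.
    exact/monicP/monic_map.
  rewrite mul1r.
  by rewrite /cc !rmorphXn.
pose m := cc (l ^+ (size g).-1)^-1.
have lm : l ^+ (size g).-1 != 0 by rewrite expf_neq0.
have m0 : m != 0 by rewrite !polyC_eq0 invr_eq0.
exists (m *: k); split.
- by rewrite monicE lead_coefZ lk /m -!polyCM mulVf.
- by rewrite size_scale.
- move=> i; rewrite coefZ /m /cc mul_polyC; apply: leq_trans (size_scale_leq _ _) _.
  rewrite /k comp_polyE coef_sum; apply: leq_trans (size_sum _ _ _) _.
  apply/bigmax_leqP => j _; rewrite coefZ.
  have -> : dilX (cc a3) (cc l) = map_poly (polyC \o polyC) (dilX a3 l).
    rewrite /dilX [RHS]rmorphD /= map_polyC map_polyZ map_polyX; congr (_%:P + _).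
    by rewrite /= !polyCB !polyCM.
  have -> : (map_poly (polyC \o polyC) (dilX a3 l) ^+ j)`_i = (((dilX a3 l) ^+ j)`_i)%:P%:P.
    by rewrite -rmorphXn /= coef_map.
  rewrite mulrC mul_polyC; apply: leq_trans (size_scale_leq _ _) _; rewrite coef_map.
  exact: leq_trans (st _) (bg _).
- move=> b1 b2 y; rewrite -mul_polyC rmorphM ev3C ev2C hornerC mulrA divff // mul1r.
  rewrite !ev3E /k map_comp_poly horner_comp -map_poly_comp.
  have -> : (map_poly (ev2 b1 b2) (dilX (cc a3) (cc l))).[y] = dil a3 l y.
    by rewrite -ev3E /dilX rmorphD -mul_polyC rmorphM ev3X !ev3C rmorphB rmorphM !ev2C !hornerC /dil; ring.
  by congr (_.[_]); apply: eq_map_poly => a; exact: esym (tE _ _ _).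
Qed.

(* Two monic equations of the same degree in y agree as soon as their sections
   by the planes b1 = c have too many common points. *)
Lemma section_rigidity g h n (C : seq F) (pts : F -> seq (F * F)) :
  prime_elt g -> g \is monic -> h \is monic -> size h = size g -> (1 < size g)%N ->
  (forall i, size (g`_i)%R <= n.+1)%N -> (forall i, size (h`_i)%R <= n.+1)%N ->
  (forall c, c \notin C -> [/\ uniq [seq z.1 | z <- pts c],
     (2 * (size g).-1 * n < size (pts c))%N &
     forall z, z \in pts c -> ev3 c z.1 z.2 g = 0 /\ ev3 c z.1 z.2 h = 0]) ->
  g = h.
Proof.
move=> pg mg mh sh sg bg bh Hpts.
suff [q Eq] : divides g h.
  have h0 := monic_neq0 mh; have g0 := monic_neq0 mg.
  have q0 : q != 0 by apply: contra_neq h0 => q0; rewrite Eq q0 mul0r.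
  have := size_mul q0 g0; rewrite -Eq sh => E.
  have sq : (size q <= 1)%N.
    move: E q0 sg; rewrite -size_poly_gt0; move: (size q) (size g) => i j; lia.
  have := lead_coefM q g; rewrite -Eq (monicP mg) (monicP mh) mulr1.
  by rewrite Eq (size1_polyC sq) lead_coefC => <-; rewrite mul1r.
apply: contrapT => ngh; have [c0 [f [k [c00 E]]]] := prime_bezout pg sg ngh.
(* On the plane [b1 = c] the eliminant [c0] does not vanish identically, while a common factor of
   the two sections would divide it. *)
have [c] : exists c, (lead_coef c0 * \prod_(x <- C) ('X - x%:P)).[c] != 0.
  apply: poly_neq0_ex; rewrite mulf_neq0 ?lead_coef_eq0 // prodf_seq_neq0.
  by apply/allP => x _; rewrite polyXsubC_eq0.
rewrite hornerM mulf_eq0 negb_or => /andP[lc Hc].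
have cC : c \notin C by rewrite -root_prod_XsubC.
have [up sp zp] := Hpts c cC.
pose sc : {rmorphism {poly {poly {poly F}}} -> {poly {poly F}}} :=
  map_poly (map_poly (horner_eval c)).
have scE b2 y e : (sc e).[y%:P].[b2] = ev3 c b2 y e.
  have -> : (sc e).[y%:P].[b2] = (map_poly (horner_eval b2) (sc e)).[y].
    by have := horner_map (horner_eval b2) (sc e) y%:P; rewrite /= !horner_evalE hornerC.
  rewrite ev3E /sc -map_poly_comp; congr (_.[_]); apply: eq_map_poly => a.
  have := horner_map (horner_eval c) a b2%:P; rewrite /= !horner_evalE hornerC => E'.
  exact: E'.
have sc_monic e : e \is monic -> sc e \is monic by move=> me; apply: monic_map.
have sc_size e : e \is monic -> size (sc e) = size e.
  by move=> me; rewrite size_map_poly_id0 // (monicP me) rmorph1 oner_eq0.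
have sc_deg (e : {poly {poly {poly F}}}) : (forall i, size (e`_i)%R <= n.+1)%N ->
    (forall i, size ((sc e)`_i)%R <= n.+1)%N.
  by move=> be i; rewrite coef_map /=; apply: leq_trans (size_poly _ _) (be i).
have : (1 < size (gcdp (sc g) (sc h)))%N.
  apply: (common_factor (n := n) (pts := pts c)); rewrite ?sc_size ?sh //.
  - exact: sc_deg.
  - exact: sc_deg.
  - by move=> z /zp; rewrite !scE.
  - by rewrite addnn -mul2n.
have : gcdp (sc g) (sc h) %| sc c0%:P.
  by rewrite E rmorphD !rmorphM dvdp_add // dvdp_mull // ?dvdp_gcdl ?dvdp_gcdr.
have cc0 : map_poly (horner_eval c) c0 != 0.
  by rewrite -lead_coef_eq0 lead_coef_map_eq.
have -> : sc c0%:P = (map_poly (horner_eval c) c0)%:P by rewrite /sc /= map_polyC.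
move=> /dvdp_leq; rewrite polyC_eq0 cc0 size_polyC cc0 => /(_ isT).
by rewrite ltnNge => ->.
Qed.

Lemma cone_equation g a1 a2 a3 (sl : seq (F * F)) :
  prime_elt g -> g \is monic -> (1 < size g)%N -> weight_le (size g).-1 g ->
  uniq [seq z.1 | z <- sl] -> (2 * (size g).-1 * (size g).-1 < size sl)%N ->
  (forall z t, z \in sl -> ev3 (a1 + t) (a2 + t * z.1) (a3 + t * z.2) g = 0) ->
  forall l b1 b2 y, l != 0 ->
    ev3 (dil a1 l b1) (dil a2 l b2) (dil a3 l y) g = l ^+ (size g).-1 * ev3 b1 b2 y g.
Proof.
move=> pg mg sg wg usl nsl Hsl l b1 b2 y l0.
have bg i : (size (g`_i)%R <= (size g).-1.+1)%N.
  by apply: leq_trans (wg i) _; rewrite leq_subr.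
have [h [mh sh bh hE]] := dilate3 a1 a2 a3 l0 mg bg.
rewrite hE; congr (_ * ev3 _ _ _ _); apply: esym.
(* The plane [b1 = a1] is left out: there all the lines pass through the apex and give a single
   point. *)
apply: (@section_rigidity g h (size g).-1 [:: a1]
  (fun c => [seq (a2 + (c - a1) * z.1, a3 + (c - a1) * z.2) | z <- sl])) => // c.
rewrite inE => ca; rewrite size_map -map_comp; split=> //.
  rewrite (map_comp (fun s => a2 + (c - a1) * s)) map_inj_uniq // => s s' /addrI.
  by apply: mulfI; rewrite subr_eq0.
move=> _ /mapP[z zsl ->] /=; have Ec : a1 + (c - a1) = c by rewrite addrC subrK.
split; first by have := Hsl z (c - a1) zsl; rewrite Ec.
have ll : l ^+ (size g).-1 != 0 by rewrite expf_neq0.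
apply: (mulfI ll); rewrite mulr0 -hE.
have dE a s : dil a l (a + (c - a1) * s) = a + (l * (c - a1)) * s by rewrite /dil; ring.
rewrite !dE; have -> : dil a1 l c = a1 + l * (c - a1) by [].
exact: Hsl.
Qed.

End Dilation.

Section TwoApexes.
Variables (F : numClosedFieldType) (T : Type) (W : set T) (u : 'I_2 -> T -> F) (w : T -> F).
Hypothesis surface_prime : forall g h, on_surface W u w (g * h) ->
  on_surface W u w g \/ on_surface W u w h.
Variable g : {poly {poly {poly F}}}.
Hypothesis eq_g : surface_equation W u w g.

Definition homogeneous_about (a : F * F * F) := forall l b1 b2 y, l != 0 ->
  ev3 (dil a.1.1 l b1) (dil a.1.2 l b2) (dil a.2 l y) g =
    l ^+ (size g).-1 * ev3 b1 b2 y g.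

(* Composing the dilations of ratio l and 1 / l about the two apexes yields the
   translations along the line joining them, so g is a form in two variables and
   the prime g is linear. *)
Lemma two_apexes (a b : F * F * F) : homogeneous_about a -> homogeneous_about b ->
  a.1.1 != b.1.1 -> exists al be ga, forall x, W x -> w x = al * u 0 x + be * u 1 x + ga.
Proof.
move: a b => [[a1 a2] a3] [[b1 b2] b3] /= Ha Hb ab.
have [Jg pg mg _ _] := eq_g; have sg := size_surface_equation eq_g.
have [g0 _ _] := pg.
pose d1 := b1 - a1; pose d2 := b2 - a2; pose d3 := b3 - a3.
have d10 : d1 != 0 by rewrite subr_eq0 eq_sym.
(* The dilation of ratio [(1 - m)^-1] about [a] followed by that of ratio [1 - m] about [b] is the
   translation by [m (b - a)]. *)
have trans m x1 x2 x3 : m != 1 ->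
    ev3 (x1 + m * d1) (x2 + m * d2) (x3 + m * d3) g = ev3 x1 x2 x3 g.
  move=> m1; have n0 : 1 - m != 0 by rewrite subr_eq0 eq_sym.
  have l0 : (1 - m)^-1 != 0 by rewrite invr_eq0.
  have E a e x : dil e (1 - m) (dil a (1 - m)^-1 x) = x + m * (e - a).
    by rewrite /dil; field.
  rewrite /d1 /d2 /d3 -!E Hb // Ha // mulrA -exprMn divff // expr1n mul1r //.
(* A zero of [g] above [(a1, a2 + 1)] gives a line through the apex [a] inside the surface, of
   direction [(0, 1, r)]. *)
pose gb := map_poly (ev2 a1 (a2 + 1)) g.
have sgb : size gb = size g.
  by rewrite /gb size_map_poly_id0 // (monicP mg) rmorph1 oner_eq0.
have [y0 /rootP Hy0] : exists y, root gb y by apply/closed_rootP; rewrite sgb gtn_eqF.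
pose r := y0 - a3.
have cone k : k != 0 -> ev3 a1 (a2 + k) (a3 + k * r) g = 0.
  move=> k0; have := Ha k a1 (a2 + 1) y0 k0; rewrite [in RHS]ev3E Hy0 mulr0.
  by rewrite /dil subrr mulr0 addr0 addrAC subrr add0r mulr1.
pose cc (c : F) : {poly {poly F}} := c%:P%:P.
(* [ka] and [mu] are the coordinates of [(b1, b2) - (a1, a2)] in the basis [(0, 1)], [(d1, d2)], and
   [y = el] is the plane spanned by the line just found and the line joining the apexes. *)
pose mu : {poly {poly F}} := cc d1^-1 * ('X%:P - cc a1).
pose ka := 'X - cc a2 - mu * cc d2.
pose el := cc a3 + ka * cc r + mu * cc d3.
have ccE x1 x2 c : ev2 x1 x2 (cc c) = c by rewrite ev2C hornerC.
have muE x1 x2 : ev2 x1 x2 mu = (x1 - a1) / d1.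
  by rewrite rmorphM rmorphB !ccE ev2C hornerX mulrC.
have kaE x1 x2 : ev2 x1 x2 ka = x2 - a2 - (x1 - a1) / d1 * d2.
  by rewrite !rmorphB rmorphM !ccE ev2X muE.
have elE x1 x2 : ev2 x1 x2 el = a3 + ev2 x1 x2 ka * r + ev2 x1 x2 mu * d3.
  rewrite (rmorphD _ (cc a3 + ka * cc r)) (rmorphD _ (cc a3)).
  by rewrite (rmorphM _ ka) (rmorphM _ mu) !ccE.
have root_el : g.[el] = 0.
  (* [cone] does not cover [ka = 0], nor [trans] the case [mu = 1]; vanishing away from these two
     lines suffices. *)
  have nz : ka * (mu - 1) != 0.
    rewrite mulf_neq0 //.
      apply/eqP => /(congr1 (ev2 a1 (a2 + 1))); rewrite kaE subrr !mul0r subr0 rmorph0.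
      by rewrite addrAC subrr add0r => /eqP; rewrite oner_eq0.
    apply/eqP => /(congr1 (ev2 a1 a2)); rewrite rmorphB muE rmorph1 subrr mul0r rmorph0.
    by rewrite sub0r => /eqP; rewrite oppr_eq0 oner_eq0.
  apply/eqP; apply: contraT => ge.
  have /ev2_neq0[z] : g.[el] * (ka * (mu - 1)) != 0 by rewrite mulf_neq0.
  set x1 := z 0 0; set x2 := z 0 1.
  rewrite (rmorphM _ g.[el]) (rmorphM _ ka) (rmorphB _ mu) (rmorph1 (ev2 x1 x2)).
  rewrite !mulf_eq0 !negb_or => /andP[+ /andP[k0 m1]].
  have -> : ev2 x1 x2 g.[el] = ev3 x1 x2 (ev2 x1 x2 el) g.
    by rewrite ev3E horner_map.
  have m1' : ev2 x1 x2 mu != 1 by rewrite -subr_eq0.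
  have := trans _ a1 (a2 + ev2 x1 x2 ka) (a3 + ev2 x1 x2 ka * r) m1'.
  rewrite -(elE x1 x2) (cone _ k0).
  have -> : a1 + ev2 x1 x2 mu * d1 = x1 by rewrite muE; field.
  have -> : a2 + ev2 x1 x2 ka + ev2 x1 x2 mu * d2 = x2 by rewrite kaE muE; field.
  by move=> ->; rewrite eqxx.
have /factor_theorem[q Eq] : root g el by apply/rootP.
(* One of the two factors of [g] is in the ideal. Were it [q], a multiple of [g] then, the linear
   factor would be a unit. *)
have : on_surface W u w ('X - el%:P).
  have [|Jq|//] := @surface_prime q ('X - el%:P); first by rewrite -Eq.
  have [_ _ _ _ gJ] := eq_g; have [k Ek] := gJ q Jq.
  have k1 : k * ('X - el%:P) = 1.
    by apply: (mulfI g0); rewrite mulr1 mulrCA mulrA -Ek -Eq.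
  have : 'X - el%:P \is a GRing.unit.
    by apply/unitrP; exists k; split; rewrite // mulrC.
  by rewrite poly_unitE size_XsubC.
move=> Jl.
exists (d1^-1 * (d3 - d2 * r)), r, (a3 - a2 * r - a1 * d1^-1 * (d3 - d2 * r)) => x Wx.
have := Jl x Wx; rewrite rmorphB ev3X ev3C elE kaE muE => /eqP; rewrite subr_eq0 => /eqP ->.
by field.
Qed.

End TwoApexes.

(** * Rich points on a complex surface *)

Section ComplexSurface.
Variables (F : numClosedFieldType) (d : nat).
Implicit Types (W : set 'rV[F]_d).

Definition linear_mpoly (c : 'cV[F]_d) : {mpoly F[d]} := \sum_i c i 0 *: 'X_i.

Lemma linear_mpolyE c x : mpoly_eval (linear_mpoly c) x = (x *m c) 0 0.
Proof.
rewrite /mpoly_eval raddf_sum mxE; apply: eq_bigr => i _.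
by rewrite /= mevalZ mevalXU mulrC.
Qed.

Lemma forms_mpoly k (A : 'M[F]_(d, k)) j x :
  forms A j x = mpoly_eval (linear_mpoly (col j A)) x.
Proof.
by rewrite linear_mpolyE /forms !mxE; apply: eq_bigr => i _; rewrite mxE.
Qed.

Lemma lpoly_coef (U : lmodType F) m n (f : {linear U -> 'M[F]_(m, n)}) i j :
  lpoly (fun x => f x i j).
Proof.
move=> x y; exists ((f x i j)%:P + (f y i j)%:P * 'X) => t.
by rewrite linearD linearZ !mxE !hornerE mulrC.
Qed.

Lemma mpoly_of_ev2 (u0 u1 : {mpoly F[d]}) (a : {poly {poly F}}) :
  exists P, forall x, ev2 (mpoly_eval u0 x) (mpoly_eval u1 x) a = mpoly_eval P x.
Proof.
exists (\sum_(i < size a) (\sum_(j < size (a`_i)%R) a`_i`_j *: u0 ^+ j) * u1 ^+ i) => x.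
rewrite ev2_sum /mpoly_eval rmorph_sum; apply: eq_bigr => i _.
rewrite rmorphM rmorphXn rmorph_sum /=; congr (_ * _).
rewrite horner_coef; apply: eq_bigr => j _.
by rewrite mevalZ rmorphXn.
Qed.

Lemma mpoly_of_ev3 (u0 u1 w : {mpoly F[d]}) (h : {poly {poly {poly F}}}) :
  exists P, forall x,
    ev3 (mpoly_eval u0 x) (mpoly_eval u1 x) (mpoly_eval w x) h = mpoly_eval P x.
Proof.
have /choice[Q HQ] i := mpoly_of_ev2 u0 u1 h`_i.
exists (\sum_(i < size h) Q i * w ^+ i) => x.
rewrite ev3E (horner_coef_wide _ (size_poly _ _)) /mpoly_eval rmorph_sum.
apply: eq_bigr => i _; rewrite coef_map rmorphM rmorphXn; congr (_ * _).
exact: HQ.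
Qed.

Lemma lpoly_matrix_mpoly k (gen : {mpoly F[d * k + k]}) (b : 'rV[F]_k) :
  lpoly (fun A : 'M[F]_(d, k) => mpoly_eval gen (row_mx (mxvec A) b)).
Proof.
move=> x y; have [p Hp] := lpoly_mpoly_eval gen (row_mx (mxvec x) b) (row_mx (mxvec y) 0).
by exists p => t; rewrite -Hp scale_row_mx add_row_mx scaler0 addr0 linearD linearZ.
Qed.

Section SurfaceSetup.
Variables (W : set 'rV[F]_d) (e : nat) (gen : {mpoly F[d * 2 + 2]}).
Hypothesis irW : irreducible_variety W.
Hypothesis growthW : growth W (@coordinate F d) 2.
Hypothesis chainW : irreducible_chain W 2.
Hypothesis gen0 : gen != 0.
Hypothesis genP : forall (A : 'M[F]_(d, 2)) (b : 'rV[F]_2),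
  mpoly_eval gen (row_mx (mxvec A) b) <> 0 -> (W `&` [set x | x *m A = b] #= `I_e)%card.

Definition form1 (c : 'cV[F]_d) (x : 'rV[F]_d) := (x *m c) 0 0.

(** The form [c] is prescribed, so only [A] moves: a generic independent pair is shifted by
    multiples of [c] until [form1 c] is integral over it. The degree of [g] is at most [e] because a
    generic fibre yields that many points of [W], told apart by [form1 c], in a section with exactly
    [e] points. *)
Lemma surface_setup (c : 'cV[F]_d) (phi : 'M[F]_(d, 2) -> F) :
  lpoly phi -> (exists A, phi A != 0) ->
  exists (A : 'M[F]_(d, 2)) (g : {poly {poly {poly F}}}),
    [/\ phi A != 0, ~ algdep W (forms A),
        forall g1 g2, on_surface W (forms A) (form1 c) (g1 * g2) ->
          on_surface W (forms A) (form1 c) g1 \/ on_surface W (forms A) (form1 c) g2,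
        surface_equation W (forms A) (form1 c) g & ((size g).-1 <= e)%N].
Proof.
move=> lphi phi0.
have [v Hv] := mpoly_neq0_ex gen0.
pose b0 : 'rV[F]_2 := rsubmx v.
pose G (A : 'M[F]_(d, 2)) (b : 'rV[F]_2) := mpoly_eval gen (row_mx (mxvec A) b).
have lG b : lpoly (G^~ b) by exact: lpoly_matrix_mpoly.
have lG' A : lpoly (G A).
  move=> x y; have [p Hp] := lpoly_mpoly_eval gen (row_mx (mxvec A) x) (row_mx 0 y).
  by exists p => t; rewrite -Hp /G scale_row_mx add_row_mx scaler0 addr0.
have G0 : exists A, G A b0 != 0.
  by exists (vec_mx (lsubmx v)); rewrite /G vec_mxK hsubmxK.
have lpsi : lpoly (fun A => phi A * G A b0) by apply: lpolyM.
have [A1 indA1 psiA1] := generic_independent_forms growthW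
  (exists_independent_forms (chain_growth chainW)) lpsi (lpoly_neq0M lphi (lG b0) phi0 G0).
have [|t [lt t0 Ht]] := @shear_independent F _ W 1 (form1 c) (forms A1) indA1.
  apply: algdep_growth growthW => j; rewrite /fcons; case: unlift => [j'|].
    exact: polyfun_forms.
  exact: (polyfun_forms c 0).
pose h : {linear 'rV[F]_2 -> 'M[F]_(d, 2)} := mulmx c.
have [|a] := lpoly_neq0M lt (lpoly_affine h A1 lpsi) t0.
  by exists 0; rewrite linear0 add0r.
rewrite mulf_eq0 negb_or => /andP[/Ht[indA [n [b rel]]]].
set A := h a + A1; rewrite mulf_eq0 negb_or => /andP[phiA GA].
have formsA : (fun i x => forms A1 i x + a 0 i * form1 c x) = forms A.
  apply: funext => i; apply: funext => x.
  rewrite /forms /A /h /= mulmxDr [RHS]mxE addrC; congr (_ + _).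
  by rewrite mulmxA [RHS]mxE big_ord1 mulrC.
rewrite formsA in indA rel.
have sprime g1 g2 : on_surface W (forms A) (form1 c) (g1 * g2) ->
    on_surface W (forms A) (form1 c) g1 \/ on_surface W (forms A) (form1 c) g2.
  have ex g : exists P, forall x, ev3 (forms A 0 x) (forms A 1 x) (form1 c x) g = mpoly_eval P x.
    have [P HP] := mpoly_of_ev3 (linear_mpoly (col 0 A)) (linear_mpoly (col 1 A)) (linear_mpoly c) g.
    exists P => x; rewrite -HP !forms_mpoly; congr (ev3 _ _ _ _).
    exact: esym (linear_mpolyE c x).
  have [P1 H1] := ex g1; have [P2 H2] := ex g2 => H12.
  have [|V1|V2] := irreducible_prime irW (p := P1) (q := P2).
  - by move=> x Wx; rewrite mpoly_evalM -H1 -H2 -rmorphM H12.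
  - by left=> x Wx; rewrite H1 V1.
  - by right=> x Wx; rewrite H2 V2.
have [g eqg] := exists_surface_equation sprime indA rel.
exists A, g; split=> //.
have [cW _ _] := irW.
have [ps Hps] := image_vanishing_pattern
  (fun i : 'I_3 => linear_mpoly (if i == 0 then col 0 A else if i == 1 then col 1 A else c)) cW.
have v3 x : vec3 (forms A 0 x) (forms A 1 x) (form1 c x) =1
    fun i : 'I_3 => mpoly_eval
      (linear_mpoly (if i == 0 then col 0 A else if i == 1 then col 1 A else c)) x.
  move=> i; rewrite /vec3; case: eqP => _; first by rewrite forms_mpoly.
  by case: eqP => _; [rewrite forms_mpoly|rewrite linear_mpolyE].
have [|b' [ys [Gb uys sys Hys]]] := generic_fiber sprime indA eqg (ps := ps) _ (lG' A) (ex_intro _ b0 GA).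
  move=> z z' Hz [x Wx Hx]; have [|x' Wx' Hx'] := Hps z z' Hz.
    by exists x => // i; rewrite -v3.
  by exists x' => // i; rewrite v3.
have /choice[f Hf] y : exists x, y \in ys -> [/\ W x, forms A 0 x = b' 0 0,
    forms A 1 x = b' 0 1 & form1 c x = y].
  case: (boolP (y \in ys)) => [/Hys[x Wx [? ? ?]]|_]; last by exists 0.
  by exists x.
have cardX := genP (elimN eqP Gb).
have finX : finite_set (W `&` [set x | x *m A = b']) by apply/finite_setP; exists e.
rewrite -(card_fset_set cardX) -sys -(size_map f); apply: uniq_leq_size.
  rewrite map_inj_in_uniq // => y y' /Hf[_ _ _ Ey] /Hf[_ _ _ Ey'] E.
  by rewrite -Ey E.
move=> _ /mapP[y yys ->]; have [Wx x0 x1 _] := Hf y yys.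
rewrite in_fset_set // inE; split=> //=; apply/rowP => j.
case: j => -[|[|]] // j2; rewrite -[LHS]/(forms A _ _).
  by rewrite (_ : Ordinal j2 = 0) ?x0 //; apply: val_inj.
by rewrite (_ : Ordinal j2 = 1) ?x1 //; apply: val_inj.
Qed.

Lemma rich_points_coplanar p p' (vs vs' : seq 'rV[F]_d) v1 v2 :
  p != p' ->
  (forall v t, v \in vs -> W (p + t *: v)) -> (forall v t, v \in vs' -> W (p' + t *: v)) ->
  {in vs, forall v, v != 0} -> {in vs', forall v, v != 0} -> uniq vs -> uniq vs' ->
  {in vs &, forall v v', v != v' -> row_free (col_mx v v')} ->
  {in vs' &, forall v v', v != v' -> row_free (col_mx v v')} ->
  (2 * e ^ 2 < size vs)%N -> (2 * e ^ 2 < size vs')%N ->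
  v1 \in vs -> v2 \in vs -> v1 != v2 ->
  forall x, W x -> (x - p <= col_mx v1 v2)%MS.
Proof.
move=> pp' Wvs Wvs' nvs nvs' uvs uvs' fvs fvs' svs svs' v1s v2s v12 x Wx.
apply: contraT => nx.
have f12 : row_free (col_mx v1 v2) by apply: fvs.
have [c [c1 c2 c3]] : exists c : 'cV[F]_d,
    [/\ (v1 *m c) 0 0 = 0, (v2 *m c) 0 0 = 0 & ((x - p) *m c) 0 0 = 1].
  pose M := cokermx (col_mx v1 v2).
  have : (x - p) *m M != 0 by rewrite -submxE.
  case/rV0Pn => j Hj.
  have z : col_mx v1 v2 *m M = 0 by rewrite mulmx_coker.
  move: z; rewrite mul_col_mx => z.
  have z1 : v1 *m M = 0 by have := congr1 usubmx z; rewrite col_mxKu linear0.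
  have z2 : v2 *m M = 0 by have := congr1 dsubmx z; rewrite col_mxKd linear0.
  have E v k : (v *m (k *: col j M)) 0 0 = k * (v *m M) 0 j.
    rewrite -scalemxAr mxE; congr (_ * _); rewrite !mxE.
    by apply: eq_bigr => i _; rewrite mxE.
  exists ((((x - p) *m M) 0 j)^-1 *: col j M); split; rewrite E.
  - by rewrite z1 [X in _ * X]mxE mulr0.
  - by rewrite z2 [X in _ * X]mxE mulr0.
  - by rewrite mulVf.
(* phi A != 0 makes the lines through p and p' non-vertical with distinct
   projections. *)
pose s := (p' - p) :: vs ++ vs'.
pose prs := [seq vv <- allpairs pair vs vs | vv.1 != vv.2] ++
            [seq vv <- allpairs pair vs' vs' | vv.1 != vv.2].
pose det2 (vv : 'rV[F]_d * 'rV[F]_d) (A : 'M[F]_(d, 2)) :=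
  forms A 0 vv.1 * forms A 1 vv.2 - forms A 1 vv.1 * forms A 0 vv.2.
pose phi (A : 'M[F]_(d, 2)) :=
  (\prod_(v <- s) forms A 0 v) * (\prod_(vv <- prs) det2 vv A).
have lf j v : lpoly (fun A : 'M[F]_(d, 2) => forms A j v).
  exact: (lpoly_coef (mulmx v : {linear 'M[F]_(d, 2) -> 'rV[F]_2}) 0 j).
have ld vv : lpoly (det2 vv).
  apply: lpolyD; first by apply: lpolyM; apply: lf.
  by apply: lpolyN; apply: lpolyM; apply: lf.
have lphi : lpoly phi.
  by apply: lpolyM; apply: lpoly_prod.
have f0 v : v != 0 -> exists A : 'M[F]_(d, 2), forms A 0 v != 0.
  case/rV0Pn => i vi; exists (delta_mx i 0); rewrite /forms mxE (bigD1 i) //= big1.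
    by rewrite mxE !eqxx mulr1 addr0.
  by move=> j ji; rewrite mxE (negPf ji) mulr0.
have d0 v v' : row_free (col_mx v v') -> exists A, det2 (v, v') A != 0.
  move=> /mulmxVp E; exists (pinvmx (col_mx v v')); rewrite /det2 /forms /=.
  set B := pinvmx _ in E *.
  have EE i j : (col_mx (v *m B) (v' *m B)) i j = (i == j)%:R by rewrite -mul_col_mx E mxE.
  have Ev j : (v *m B) 0 j = (lshift 1 0 == j)%:R by rewrite -EE col_mxEu.
  have Ev' j : (v' *m B) 0 j = (rshift 1 0 == j)%:R by rewrite -EE col_mxEd.
  by rewrite !Ev !Ev' /= mulr1 mulr0 subr0 oner_eq0.
have nz0 v : v \in s -> v != 0.
  rewrite inE mem_cat => /or3P[/eqP->|/nvs//|/nvs'//].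
  by rewrite subr_eq0 eq_sym.
have frp vv : vv \in prs -> row_free (col_mx vv.1 vv.2).
  rewrite mem_cat !mem_filter => /orP[] /andP[ne /allpairsP[[a b] /= [as_ bs E]]];
    rewrite E /= in ne *; [exact: fvs|exact: fvs'].
have [A [g [phiA indA sprime eqg me]]] : exists (A : 'M[F]_(d, 2)) g,
    [/\ phi A != 0, ~ algdep W (forms A),
        forall g1 g2, on_surface W (forms A) (form1 c) (g1 * g2) ->
          on_surface W (forms A) (form1 c) g1 \/ on_surface W (forms A) (form1 c) g2,
        surface_equation W (forms A) (form1 c) g & ((size g).-1 <= e)%N].
  apply: surface_setup => //; apply: lpoly_neq0M.
  - by apply: lpoly_prod => v _.
  - by apply: lpoly_prod => vv _.
  - by apply: lpoly_neq0_prod => v vs0; [exact: lf|apply: f0; apply: nz0].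
  - by apply: lpoly_neq0_prod => -[a b] ab; [exact: ld|apply: d0; apply: (frp (a, b))].
move: phiA; rewrite mulf_eq0 negb_or !prodf_seq_neq0 => /andP[/allP u0n /allP detn].
have {}u0n v : v \in s -> forms A 0 v != 0 by move=> /u0n.
have {}detn vv : vv \in prs -> det2 vv A != 0 by move=> /detn.
have formsD k q t v : forms A k (q + t *: v) = forms A k q + t * forms A k v.
  by rewrite /forms mulmxDl -scalemxAl mxE [X in _ + X]mxE.
have form1D q t v : form1 c (q + t *: v) = form1 c q + t * form1 c v.
  by rewrite /form1 mulmxDl -scalemxAl mxE [X in _ + X]mxE.
have [Jg pg mg wg _] := eqg.
have apex q (ws : seq 'rV[F]_d) : (forall v t, v \in ws -> W (q + t *: v)) -> uniq ws ->
    (forall v, v \in ws -> v \in s) ->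
    (forall v v', v \in ws -> v' \in ws -> v != v' -> (v, v') \in prs) ->
    (2 * e ^ 2 < size ws)%N ->
    homogeneous_about g (forms A 0 q, forms A 1 q, form1 c q).
  move=> Wq uws wss wsp sws l b1 b2 y.
  (* Slopes of the projected lines with respect to the first form; the nonzero determinants keep
     their first components distinct. *)
  pose sl := [seq (forms A 1 v / forms A 0 v, form1 c v / forms A 0 v) | v <- ws].
  apply: (cone_equation (sl := sl)) => //.
  - exact: size_surface_equation eqg.
  - rewrite -map_comp map_inj_in_uniq // => v v' vws v'ws /= E.
    have vn := u0n v (wss v vws); have vn' := u0n v' (wss v' v'ws).
    apply/eqP; apply: contraT => vv'.
    have /negP[] := detn (v, v') (wsp v v' vws v'ws vv').
    rewrite /det2 /= subr_eq0; apply/eqP.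
    have := congr1 (fun r => r * (forms A 0 v * forms A 0 v')) E.
    rewrite mulrA divfK // [forms A 0 v * _]mulrC mulrA divfK // => ->.
    by rewrite mulrC.
  - rewrite size_map; apply: leq_ltn_trans sws.
    by rewrite -mulnA leq_mul2l mulnn leq_exp2r.
  - move=> _ t /mapP[v vws ->] /=; have vn := u0n v (wss v vws).
    have := Jg _ (Wq v (t / forms A 0 v) vws).
    rewrite !formsD form1D divfK // => H; rewrite -[RHS]H.
    by congr (ev3 _ _ _ _); congr (_ + _); rewrite mulrA mulrAC.
have hp : homogeneous_about g (forms A 0 p, forms A 1 p, form1 c p).
  apply: (apex p vs) => // [v vs0|v v' vs0 v's vv'].
    by rewrite inE mem_cat vs0 orbT.
  by rewrite mem_cat mem_filter vv' allpairs_f.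
have hp' : homogeneous_about g (forms A 0 p', forms A 1 p', form1 c p').
  apply: (apex p' vs') => // [v vs0|v v' vs0 v's vv'].
    by rewrite inE mem_cat vs0 !orbT.
  by rewrite mem_cat; apply/orP; right; rewrite mem_filter vv' allpairs_f.
have [|al [be [ga Haff]]] := two_apexes sprime eqg hp hp'.
  rewrite /= eq_sym -subr_eq0; have := u0n (p' - p) (mem_head _ _).
  by rewrite /forms mulmxBl mxE [X in _ + X]mxE.
have Wp : W p by have := Wvs v1 0 v1s; rewrite scale0r addr0.
have lin v : v \in vs -> form1 c v = 0 -> al * forms A 0 v + be * forms A 1 v = 0.
  move=> vvs cv; have := Haff _ (Wvs v 1 vvs); rewrite form1D !formsD cv mulr0 addr0 !mul1r.
  rewrite (Haff _ Wp) => /eqP; rewrite eq_sym -subr_eq0 => /eqP E.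
  by apply: etrans E; ring.
have e1 := lin v1 v1s c1; have e2 := lin v2 v2s c2.
have d12 : det2 (v1, v2) A != 0.
  by apply: detn; rewrite mem_cat mem_filter /= v12 allpairs_f.
(* Cramer's rule for the system [e1], [e2], whose determinant is [det2 (v1, v2) A]. *)
have al0 : al = 0.
  apply: (mulIf d12); rewrite mul0r /det2 /=.
  transitivity ((al * forms A 0 v1 + be * forms A 1 v1) * forms A 1 v2 -
    (al * forms A 0 v2 + be * forms A 1 v2) * forms A 1 v1); first by ring.
  by rewrite e1 e2 !mul0r subr0.
have be0 : be = 0.
  apply: (mulIf d12); rewrite mul0r /det2 /=.
  transitivity ((al * forms A 0 v2 + be * forms A 1 v2) * forms A 0 v1 -
    (al * forms A 0 v1 + be * forms A 1 v1) * forms A 0 v2); first by ring.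
  by rewrite e1 e2 !mul0r subr0.
move: c3; rewrite mulmxBl mxE [X in _ + X]mxE -!/(form1 _ _) (Haff x Wx) (Haff p Wp).
by rewrite al0 be0 !mul0r subrr => /eqP; rewrite eq_sym oner_eq0.
Qed.

End SurfaceSetup.

End ComplexSurface.

(** * Lines, planes and complexifications *)

Section FlatChains.
Variables (F : numFieldType) (d : nat).
Implicit Types (W l : set 'rV[F]_d).

(** On the flat the coordinates are affine functions of [k] parameters. *)
Lemma flat_growth k A : is_flat k A -> growth A (@coordinate F d) k.
Proof.
move=> [a [M [fM ->]]].
pose y (j : 'I_k) (x : 'rV[F]_d) := ((x - a) *m pinvmx M) 0 j.
have [c Hc] := growth_trivial [set x | exists c : 'rV[F]_k, x = a + c *m M] y.
exists c => n; have [f Hf] := Hc n; exists f => g pg.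
have [g' pg' E] : exists2 g', polyfun y n g' &
    forall x, (exists c : 'rV[F]_k, x = a + c *m M) -> g x = g' x.
  elim: {f Hf} pg => {n g} [n b f E|n f g h _ [f' pf Hf] _ [g' pg Hg] E|n i f g _ [f' pf Hf] E].
  - by exists f => // ; apply: polyfun_cst E.
  - exists (fun x => f' x + g' x); first exact: polyfunD.
    by move=> x Hx; rewrite E Hf ?Hg.
  - exists (fun x => (a 0 i + \sum_j M j i * y j x) * f' x).
      rewrite -[n.+1]/(1 + n)%N; apply: polyfunM pf; apply: polyfunD; first exact: polyfun_cst.
      by apply: polyfun_sum => j _; apply: polyfun_scale; apply: polyfun_var.
    move=> x Hx; rewrite E (Hf _ Hx); congr (_ * _); case: Hx => b ->.
    have yE j : y j (a + b *m M) = b 0 j.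
      by rewrite /y addrAC subrr add0r -mulmxA mulmxVp // mulmx1.
    rewrite /coordinate mxE [X in _ + X]mxE; congr (_ + _).
    by apply: eq_bigr => j _; rewrite yE mulrC.
by have [b Hb] := Hf _ pg'; exists b => x Hx; rewrite E // Hb.
Qed.

Lemma line_above_point l : is_flat 1 l -> exists2 p, l p & [set p] `<` l.
Proof.
move=> [a [M [fM ->]]]; have la : exists c : 'rV[F]_1, a = a + c *m M.
  by exists 0; rewrite mul0mx addr0.
exists a => //; split=> [x /= ->//|/(_ (a + M))] /=.
have lM : exists c : 'rV[F]_1, a + M = a + c *m M by exists 1%:M; rewrite mul1mx.
move=> /(_ lM) /eqP; rewrite -subr_eq0 addrC addKr => /eqP M0.
by move: fM; rewrite /row_free M0 mxrank0.
Qed.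

Lemma line_chain1 l W : is_flat 1 l -> l `<=` W -> irreducible_chain W 1.
Proof.
move=> fl lW; have [p lp pl] := line_above_point fl.
exists (nth set0 [:: [set p]; l]); split=> [[|[|]]|[|]] //= _.
  split; first exact: flat_irreducible (point_flat p).
  by move=> x /= ->; apply: lW.
by split=> //; apply: flat_irreducible fl.
Qed.

Lemma line_chain2 l W : is_flat 1 l -> irreducible_variety W -> l `<=` W ->
  ~ W `<=` l -> irreducible_chain W 2.
Proof.
move=> fl irW lW nWl; have [p lp pl] := line_above_point fl.
exists (nth set0 [:: [set p]; l; W]); split=> [[|[|[|]]]|[|[|]]] //= _.
  split; first exact: flat_irreducible (point_flat p).
  by move=> x /= ->; apply: lW.
  by split=> //; apply: flat_irreducible fl.
by split.
Qed.

(** Otherwise a point, [l], [W] and [A] would form a chain of length 3 in a plane, whose growth is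
    quadratic. *)
Lemma plane_sub_irreducible l W A : is_flat 1 l -> irreducible_variety W -> is_flat 2 A ->
  l `<=` W -> ~ W `<=` l -> W `<=` A -> A `<=` W.
Proof.
move=> fl irW fA lW nWl WA; apply: contrapT => nAW.
have [p lp pl] := line_above_point fl.
apply: (@chain_growth F d A 2); last exact: flat_growth.
exists (nth set0 [:: [set p]; l; W; A]); split=> [[|[|[|[|]]]]|[|[|[|]]]] //= _.
- split; first exact: flat_irreducible (point_flat p).
  by move=> x /= ->; apply: WA; apply: lW.
- by split; [apply: flat_irreducible fl|apply: subset_trans lW WA].
- by split=> //; apply: flat_irreducible fA.
Qed.

(** A maximal independent family of functions of degree at most [n] spans. Having polynomial
    spanning functions is what allows their relations to be carried over to a closure. *)
Lemma spanned_by_polyfun (T : Type) (Z : set T) q (z : 'I_q -> T -> F) n N :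
  spanned_by Z z n N -> exists f : 'I_N -> T -> F, (forall i, polyfun z n (f i)) /\
    forall g, polyfun z n g -> exists c : 'I_N -> F, forall x, Z x -> g x = \sum_i c i * f i x.
Proof.
move=> sp.
have ex : exists M, `[< independent_family Z z n M >].
  by exists 0%N; apply/asboolP; exists (fun _ _ => 0); split=> [[]|c _ []].
have bnd M : `[< independent_family Z z n M >] -> (M <= N)%N.
  by move=> /asboolP H; apply: independent_le_spanned H sp.
have [M /asboolP[f [pf indf]] maxM] := ex_maxnP ex bnd.
have MN : (M <= N)%N by apply: bnd; apply/asboolP; exists f.
have sf g : polyfun z n g -> exists c : 'I_M -> F, forall x, Z x -> g x = \sum_i c i * f i x.
  move=> pg; apply: contrapT => ng.
  suff : (M.+1 <= M)%N by rewrite ltnn.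
  apply: maxM; apply/asboolP.
  pose fg (i : 'I_M.+1) := if unlift ord0 i is Some j then f j else g.
  exists fg; split=> [i|c Hc]; first by rewrite /fg; case: unlift.
  have E x : \sum_i c i * fg i x = c ord0 * g x + \sum_j c (lift ord0 j) * f j x.
    rewrite big_ord_recl {1}/fg unlift_none; congr (_ + _).
    by apply: eq_bigr => j _; rewrite /fg liftK.
  have c0 : c ord0 = 0.
    apply/eqP; apply: contraT => c0; case: ng.
    exists (fun j => - (c ord0)^-1 * c (lift ord0 j)) => x Zx.
    apply: (mulfI c0); rewrite mulr_sumr; apply/eqP; rewrite -subr_eq0; apply/eqP.
    rewrite -[RHS](Hc x Zx) E -sumrN; congr (_ + _); apply: eq_bigr => j _.
    by field.
  move=> i; case: (unliftP ord0 i) => [j ->|-> //].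
  apply: (indf (fun j => c (lift ord0 j))) => x Zx.
  by have := Hc x Zx; rewrite E c0 mul0r add0r.
exists (fun i x => if insub (val i) is Some j then f j x else 0); split=> [i|g /sf[c Hc]].
  by case: insub => [j|]; [apply: pf|apply: polyfun0].
exists (fun i => if insub (val i) is Some j then c j else 0) => x /Hc ->.
pose G k := (if insub k is Some j then c j else 0) * (if insub k is Some j then f j x else 0).
have -> : \sum_i c i * f i x = \sum_(i < M) G i.
  by apply: eq_bigr => i _; rewrite /G valK.
rewrite (big_ord_widen _ G MN) big_mkcond; apply: eq_bigr => i _.
by case: ifP => //; rewrite /G; case: insubP => [j ->//|]; rewrite mul0r.
Qed.

(** An expression of [g] through polynomial functions is a polynomial identity on [Z], and so
    persists on the closure. *)
Lemma growth_closure Z k : growth Z (@coordinate F d) k ->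
  growth (zariski_closure Z) (@coordinate F d) k.
Proof.
move=> [c Hc]; exists c => n; have [f [pf Hf]] := spanned_by_polyfun (Hc n).
exists f => g pg; have [b Hb] := Hf g pg; exists b => x Zx.
have [P HP] : exists P, (fun x => g x - \sum_i b i * f i x) = mpoly_eval P.
  apply: (@polyfun_coord_mpoly _ _ n).
  apply: polyfun_ext (polyfunD pg (polyfun_scale (-1) (polyfun_sum _ (P := xpredT) _))) _.
  - by move=> i _; exact: (polyfun_scale (b i) (pf i)).
  - by move=> y; rewrite mulN1r.
have : mpoly_eval P x = 0.
  by apply: Zx => y Zy; rewrite -HP Hb // subrr.
by rewrite -HP => /eqP; rewrite subr_eq0 => /eqP.
Qed.

Lemma growth_sub (T : Type) (Z Y : set T) q (z : 'I_q -> T -> F) k :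
  Z `<=` Y -> growth Y z k -> growth Z z k.
Proof.
move=> ZY [c Hc]; exists c => n; have [f Hf] := Hc n; exists f => g /Hf[b Hb].
by exists b => x /ZY; apply: Hb.
Qed.

End FlatChains.

(** * From the real variety to its complexification *)

Section RealToComplex.
Variables (R : realType) (d : nat).
Implicit Types (V l : set 'rV[R]_d).
Local Notation C := R[i].

Definition complex_point (x : 'rV[R]_d) : 'rV[C]_d := map_mx (real_complex R) x.

Lemma real_growth V : algebraic_variety V -> ~ irreducible_chain V 3 ->
  growth V (@coordinate R d) 2.
Proof.
move=> cV nc; apply: dependent_growth => A; apply: contrapT => nd; apply: nc.
apply: (independent_chain (h := fun j => \sum_i A i j *: 'X_i)) => // -[P P0 HP].
apply: nd; exists P => // x /HP <-; apply: meval_eq => j.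
rewrite /lincomb /mpoly_eval raddf_sum; apply: eq_bigr => i _.
by rewrite /= mevalZ mevalXU.
Qed.

(** At real points a complex polynomial function has real and imaginary parts that are real
    polynomial functions of the same degree, so the real spanning family also spans over the complex
    numbers. *)
Lemma complex_growth V : growth V (@coordinate R d) 2 ->
  growth (complexification V) (@coordinate C d) 2.
Proof.
move=> [c Hc]; apply: growth_closure; exists c => n; have [f Hf] := Hc n.
pose re (x : 'rV[C]_d) : 'rV[R]_d := map_mx (@complex.Re R) x.
exists (fun i x => real_complex R (f i (re x))) => g pg.
have [g1 [g2 [p1 p2 E]]] : exists g1 g2, [/\ polyfun (@coordinate R d) n g1,
    polyfun (@coordinate R d) n g2 &
    forall x, g (complex_point x) = (g1 x)%:C%C + 'i%C * (g2 x)%:C%C].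
  elim: {f Hf} pg => {n g} [n b f E|n f g h _ [f1 [f2 [pf1 pf2 Ef]]] _ [g1 [g2 [pg1 pg2 Eg]]] E|
    n i f g _ [f1 [f2 [pf1 pf2 Ef]]] E].
  - exists (fun=> complex.Re b), (fun=> complex.Im b); split; try exact: polyfun_cst.
    by move=> x; rewrite E; case: b {E} => r s /=; apply/eqP;
      rewrite eq_complex /= !(mul0r, mulr0, mul1r, addr0, add0r, subr0, oppr0) !eqxx.
  - exists (fun x => f1 x + g1 x), (fun x => f2 x + g2 x); split; try exact: polyfunD.
    by move=> x; rewrite E Ef Eg !rmorphD /=; ring.
  - exists (fun x : 'rV[R]_d => x 0 i * f1 x), (fun x : 'rV[R]_d => x 0 i * f2 x); split.
    + exact: polyfun_mul_var pf1 _.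
    + exact: polyfun_mul_var pf2 _.
    + by move=> x; rewrite E Ef /coordinate mxE !rmorphM /=; ring.
have [c1 H1] := Hf g1 p1; have [c2 H2] := Hf g2 p2.
exists (fun i => (c1 i)%:C%C + 'i%C * (c2 i)%:C%C) => _ [x Vx <-].
have rex : re (complex_point x) = x by apply/matrixP => i j; rewrite !mxE.
rewrite E H1 // H2 // !rmorph_sum mulr_sumr -big_split /=; apply: eq_bigr => i _.
by rewrite rex !rmorphM /=; ring.
Qed.

(** The real equations of [V], read with complex coefficients, hold on the complexification. *)
Lemma complex_point_mem V x : algebraic_variety V ->
  complexification V (complex_point x) -> V x.
Proof.
move=> [S ->] Hx p Sp.
pose pc : {mpoly C[d]} := \sum_(m <- msupp p) (p@_m)%:C%C *: 'X_[m].
have pcE y : mpoly_eval pc (complex_point y) = (mpoly_eval p y)%:C%C.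
  rewrite /mpoly_eval /pc raddf_sum [p.@[_]]mevalE [RHS]rmorph_sum; apply: eq_bigr => m _.
  rewrite /= mevalZ mevalX rmorphM rmorph_prod; congr (_ * _).
  by apply: eq_bigr => i _; rewrite mxE rmorphXn.
have : mpoly_eval pc (complex_point x) = 0.
  by apply: Hx => _ [y Vy <-]; rewrite pcE Vy.
by rewrite pcE => /eqP; rewrite fmorph_eq0 => /eqP.
Qed.

End RealToComplex.

Section Lines.
Variables (F : numFieldType) (d : nat).
Implicit Types (l : set 'rV[F]_d) (p v : 'rV[F]_d).

Definition line p v := [set x | exists t, x = p + t *: v].

Lemma line_flat p v : v != 0 -> is_flat 1 (line p v).
Proof.
move=> v0; exists p, v; split; first by rewrite /row_free rank_rV v0.
apply/seteqP; split=> x /= [c ->]; first by exists c%:M; rewrite mul_scalar_mx.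
by exists (c 0 0); rewrite [in LHS](mx11_scalar c) mul_scalar_mx.
Qed.

Lemma flat_line l p : is_flat 1 l -> l p -> exists2 v, v != 0 & l = line p v.
Proof.
move=> [a [v [fv ->]]] [c0 Ep].
have v0 : v != 0 by move: fv; rewrite /row_free rank_rV; case: (v != 0).
have E (c : 'rV[F]_1) : c *m v = c 0 0 *: v by rewrite {1}(mx11_scalar c) mul_scalar_mx.
exists v => //; apply/seteqP; split=> x /= [c ->].
  exists (c 0 0 - c0 0 0); rewrite Ep !E scalerBl -addrA; congr (_ + _).
  by rewrite addrC subrK.
by exists (c0 + c%:M); rewrite Ep mulmxDl mul_scalar_mx addrA.
Qed.

Lemma lines_row_free p v v' : v != 0 -> v' != 0 -> line p v <> line p v' ->
  row_free (col_mx v v').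
Proof.
move=> v0 v'0 ne; apply: contraT => nf; case: ne.
have /rowV0Pn[c /sub_kermxP cB c0] : kermx (col_mx v v') != 0 by rewrite kermx_eq0.
have E : c 0 (lshift 1 0) *: v + c 0 (rshift 1 0) *: v' = 0.
  rewrite -[RHS]cB -[c in RHS]hsubmxK mul_row_col.
  by rewrite [lsubmx c]mx11_scalar [rsubmx c]mx11_scalar !mul_scalar_mx !mxE.
set a := c 0 _ in E; set b := c 0 _ in E.
have a0 : a != 0.
  apply: contra_neq c0 => a0; move: E; rewrite a0 scale0r add0r => /eqP.
  rewrite scaler_eq0 (negPf v'0) orbF => /eqP b0.
  apply/rowP => i; rewrite mxE; case: (fintype.splitP i) => j Ej.
    by rewrite -[RHS]a0; congr (c _ _); apply: val_inj; rewrite /= Ej (ord1 j).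
  by rewrite -[RHS]b0; congr (c _ _); apply: val_inj; rewrite /= Ej (ord1 j).
have b0 : b != 0.
  apply: contraNneq v0 => b0; move: E; rewrite b0 scale0r addr0 => /eqP.
  by rewrite scaler_eq0 (negPf a0).
have Ev : v = (- (b / a)) *: v'.
  apply: (scalerI a0); rewrite scalerA mulrN mulrC divfK // scaleNr.
  by apply/eqP; rewrite -addr_eq0 E.
apply/seteqP; split=> x /= [t ->].
  by exists (t * - (b / a)); rewrite {1}Ev scalerA.
exists (t * - (a / b)); rewrite Ev scalerA !(mulrN, mulNr) opprK.
by rewrite -[t * _ * _]mulrA [a / b * _]mulrA divfK // mulfV // mulr1.
Qed.

End Lines.

Section ComplexLines.
Variables (R : realType) (d : nat).
Implicit Types (V l : set 'rV[R]_d) (p v : 'rV[R]_d).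
Local Notation C := R[i].

Lemma complexificationS V W : V `<=` W -> complexification V `<=` complexification W.
Proof.
move=> VW x Hx q Hq; apply: Hx => _ [y Vy <-]; apply: Hq.
by exists y => //; apply: VW.
Qed.

Lemma complexification_point V x : V x -> complexification V (complex_point x).
Proof. by move=> Vx q; apply; exists x. Qed.

Lemma complex_pointD x y : complex_point (x + y) = complex_point x + complex_point y :> 'rV[C]_d.
Proof. exact: map_mxD. Qed.

Lemma complex_pointZ t x : complex_point (t *: x) = t%:C%C *: complex_point x :> 'rV[C]_d.
Proof. exact: map_mxZ. Qed.

Lemma complex_point_eq0 v : (complex_point v == 0) = (v == 0).
Proof. exact: map_mx_eq0. Qed.

(** A complex polynomial that vanishes at the real points [p + i v], for all natural numbers [i],
    vanishes on the whole complex line. *)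
Lemma complexification_line p v : v != 0 ->
  complexification (line p v) = line (complex_point p) (complex_point v).
Proof.
move=> v0; apply/seteqP; split.
  apply: zariski_closure_min.
    by apply: (@flat_closed _ _ 1); apply: line_flat; rewrite complex_point_eq0.
  move=> _ [x lx <-]; case: lx => t ->; exists t%:C%C.
  by rewrite -[LHS]/(complex_point _) complex_pointD complex_pointZ.
move=> _ [t ->] q Hq.
have [r Hr] := lpoly_mpoly_eval q (complex_point p) (complex_point v).
rewrite Hr; suff -> : r = 0 by rewrite horner0.
apply/eqP; apply: contraT => r0.
suff : (size [seq i%:R : C | i <- iota 0 (size r)] < size r)%N by rewrite size_map size_iota ltnn.
apply: max_poly_roots => //.
  apply/allP => _ /mapP[i _ ->]; apply/rootP; rewrite -Hr; apply: Hq.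
  exists (p + i%:R *: v); first by exists i%:R.
  by rewrite -[LHS]/(complex_point _) complex_pointD complex_pointZ rmorph_nat.
rewrite map_inj_uniq ?iota_uniq // => i j /eqP; rewrite eqr_nat => /eqP//.
Qed.

End ComplexLines.

(** * Counting incidences *)

Section Counting.
Variables (R : realType) (d : nat).
Implicit Types (P : {fset 'rV[R]_d}) (L : {fset (set 'rV[R]_d)}).

Lemma cardfs_cover (T : choiceType) (I : eqType) (s : seq I) (X : {fset T}) (f : I -> {fset T}) :
  (forall x, x \in X -> exists2 i, i \in s & x \in f i) ->
  (#|` X| <= \sum_(i <- s) #|` f i|)%N.
Proof.
elim: s X => [|i s IH] X H.
  rewrite big_nil leqn0 cardfs_eq0; apply/eqP/fsetP => x; rewrite inE.
  by apply/negP => /H[].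
rewrite big_cons -(cardfsID (f i)) leq_add //.
  by apply: fsubset_leq_card; apply: fsubsetIr.
apply: IH => x; rewrite inE => /andP[xi /H[j]]; rewrite inE => /orP[/eqP->|js] xj.
  by rewrite xj in xi.
by exists j.
Qed.

Lemma incidences_cover (I : eqType) (s : seq I) (Ls : I -> {fset (set 'rV[R]_d)}) P L :
  (forall l, l \in L -> exists2 i, i \in s & l \in Ls i) ->
  (incidences P L <= \sum_(i <- s) incidences P (Ls i))%N.
Proof.
move=> cover; rewrite /incidences; apply: cardfs_cover => -[p l].
rewrite in_fset inE /= in_fsetM => /andP[/andP[pP lL] pl].
have [i si li] := cover l lL; exists i => //.
by rewrite in_fset inE /= in_fsetM pP li.
Qed.

Definition lines_through L p := [fset l in L | p \in (l : set 'rV[R]_d)]%fset.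

Lemma incidences_le P L : (incidences P L <= \sum_(p <- P) #|` lines_through L p|)%N.
Proof.
pose f p := [fset (p, l) | l in lines_through L p]%fset.
apply: leq_trans (@cardfs_cover _ _ P _ f _) _.
  move=> [p l]; rewrite !inE /= => /andP[/andP[pP lL] pl]; exists p => //.
  by apply/imfsetP; exists l; rewrite //= !inE lL.
apply: leq_sum => p _; rewrite card_imfset // => l l' [].
by [].
Qed.

Lemma incidences_bound P L B :
  (forall p p', p \in P -> p' \in P -> (B < #|` lines_through L p|)%N ->
     (B < #|` lines_through L p'|)%N -> p = p') ->
  (incidences P L <= B * #|` P| + #|` L|)%N.
Proof.
move=> H; apply: leq_trans (incidences_le P L) _.
have le p : (#|` lines_through L p| <= #|` L|)%N.
  by apply: fsubset_leq_card; apply/fsubsetP => l; rewrite inE => /andP[].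
have [[p0 p0P rich]|nr] := pselect (exists2 p, p \in P & (B < #|` lines_through L p|)%N).
  rewrite (bigD1_seq p0) //= addnC leq_add //.
  rewrite -sum1_size big_distrr /= muln1 [leqRHS](bigD1_seq p0) //= .
  apply: leq_trans (leq_addl _ _); rewrite big_seq_cond [leqRHS]big_seq_cond.
  apply: leq_sum => p /andP[pP pp0]; rewrite leqNgt; apply: contraNN pp0 => r.
  by apply/eqP; apply: H.
apply: leq_trans (leq_addr _ _); rewrite -sum1_size big_distrr /= muln1.
rewrite big_seq [leqRHS]big_seq; apply: leq_sum => p pP; rewrite leqNgt.
by apply/negP => r; apply: nr; exists p.
Qed.

End Counting.

(** A generic hyperplane is not parallel to the line [line p v], so it meets [W]. *)
Lemma curve_degree_gt0 (F : numClosedFieldType) d (W : set 'rV[F]_d) (p v : 'rV[F]_d) e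
    (gen : {mpoly F[d * 1 + 1]}) :
  gen != 0 -> v != 0 -> line p v `<=` W ->
  (forall (A : 'M[F]_(d, 1)) (b : 'rV[F]_1), mpoly_eval gen (row_mx (mxvec A) b) <> 0 ->
    (W `&` [set x | x *m A = b] #= `I_e)%card) -> (0 < e)%N.
Proof.
move=> gen0 v0 lW genP; have [u Hu] := mpoly_neq0_ex gen0.
pose b : 'rV[F]_1 := rsubmx u.
have [| | |A] := @lpoly_neq0M _ _ (fun A : 'M[F]_(d, 1) => (v *m A) 0 0)
    _ _ (lpoly_matrix_mpoly gen b).
- exact: (lpoly_coef (mulmx v : {linear 'M[F]_(d, 1) -> 'rV[F]_1}) 0 0).
- have /rV0Pn[i vi] := v0; exists (delta_mx i 0); rewrite mxE (bigD1 i) //= big1.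
    by rewrite mxE !eqxx mulr1 addr0.
  by move=> j ji; rewrite mxE (negPf ji) mulr0.
- by exists (vec_mx (lsubmx u)); rewrite vec_mxK hsubmxK.
rewrite mulf_eq0 negb_or => /andP[vA /eqP/genP]; rewrite lt0n; apply: contraPneq => ->.
rewrite II0 card_eq0 => /eqP/seteqP[/(_ (p + ((b - p *m A) 0 0 / (v *m A) 0 0) *: v))].
case; split; first by apply: lW; exists ((b - p *m A) 0 0 / (v *m A) 0 0).
set r := b - p *m A; rewrite /= mulmxDl -scalemxAl {2}[v *m A]mx11_scalar.
by rewrite scale_scalar_mx divfK // -mx11_scalar addrC subrK.
Qed.

(** * Incidences within one component *)

Section RichPoints.
Variables (R : realType) (d : nat).
Implicit Types (V : set 'rV[R]_d) (P : {fset 'rV[R]_d}) (L : {fset (set 'rV[R]_d)}).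
Local Notation C := R[i].

Lemma directions L p : (forall l, l \in L -> is_flat 1 l) ->
  exists vs : seq 'rV[R]_d,
    [/\ size vs = #|` lines_through L p|, uniq vs, {in vs, forall v, v != 0},
        {in vs, forall v, line p v \in L} &
        {in vs &, forall v v', v != v' -> row_free (col_mx v v')}].
Proof.
move=> fL; have /choice[f Hf] l : exists v, l \in lines_through L p -> v != 0 /\ l = line p v.
  have [|_] := boolP (l \in _); last by exists 0.
  by rewrite !inE => /andP[lL /set_mem/(flat_line (fL l lL))[v v0 E]]; exists v.
have injf : {in lines_through L p &, injective f}.
  by move=> l l' /Hf[_ E] /Hf[_ E'] ff; rewrite E E' ff.
exists (map f (lines_through L p)); split.
- by rewrite size_map.
- by rewrite map_inj_in_uniq.
- by move=> _ /mapP[l /Hf[v0 _] ->].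
- move=> _ /mapP[l lp ->]; have [_ <-] := Hf l lp.
  by move: lp; rewrite !inE => /andP[].
move=> _ _ /mapP[l lp ->] /mapP[l' lp' ->] ff.
have [n E] := Hf l lp; have [n' E'] := Hf l' lp'.
apply: (lines_row_free (p := p) n n'); rewrite -E -E' => ll.
by rewrite ll eqxx in ff.
Qed.

Lemma complex_point_inj : injective (@complex_point R d).
Proof. exact: map_mx_inj. Qed.

Lemma complex_row_free k (M : 'M[R]_(k, d)) :
  row_free (map_mx (real_complex R) M) = row_free M.
Proof. exact: row_free_map. Qed.

Lemma rich_point_unique V (W : set 'rV[C]_d) e (gen : {mpoly C[d * 2 + 2]}) L p p' :
  algebraic_variety V -> (forall F, is_flat 2 F -> ~ F `<=` V) ->
  irreducible_variety W -> W `<=` complexification V ->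
  growth W (@coordinate C d) 2 -> irreducible_chain W 2 -> gen != 0 ->
  (forall (A : 'M[C]_(d, 2)) (b : 'rV[C]_2), mpoly_eval gen (row_mx (mxvec A) b) <> 0 ->
    (W `&` [set x | x *m A = b] #= `I_e)%card) ->
  (forall l, l \in L -> is_flat 1 l) ->
  (forall l, l \in L -> complexification l `<=` W) -> (0 < e)%N ->
  (2 * e ^ 2 < #|` lines_through L p|)%N -> (2 * e ^ 2 < #|` lines_through L p'|)%N ->
  p = p'.
Proof.
move=> cV nV irW WV gW chW gen0 genP fL LW e0 rp rp'; apply/eqP; apply: contraT => pp'.
have [vs [svs uvs nvs Lvs rvs]] := directions p fL.
have [vs' [svs' uvs' nvs' Lvs' rvs']] := directions p' fL.
have lineW q v : v != 0 -> line q v \in L -> line (complex_point q) (complex_point v) `<=` W.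
  by move=> v0 /LW; rewrite complexification_line.
have onW q ws : {in ws, forall v, v != 0} -> {in ws, forall v, line q v \in L} ->
    forall v t, v \in map (@complex_point R d) ws -> W (complex_point q + t *: v).
  move=> nws Lws _ t /mapP[v vws ->]; apply: (lineW q v (nws v vws) (Lws v vws)).
  by exists t.
have nzC ws : {in ws, forall v, v != 0} -> {in map (@complex_point R d) ws, forall v, v != 0}.
  by move=> nws _ /mapP[v /nws v0 ->]; rewrite complex_point_eq0.
have rfC ws : {in ws &, forall v v', v != v' -> row_free (col_mx v v')} ->
    {in map (@complex_point R d) ws &, forall v v', v != v' -> row_free (col_mx v v')}.
  move=> H _ _ /mapP[v vws ->] /mapP[v' v'ws ->]; rewrite (inj_eq complex_point_inj) => vv'.
  by rewrite /complex_point -map_col_mx complex_row_free H.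
(* As [0 < e], at least three lines pass through [p]. *)
have [v1 [v2 [v1s v2s v12]]] : exists v1 v2, [/\ v1 \in vs, v2 \in vs & v1 != v2].
  have e2 : (0 < e ^ 2)%N by rewrite expn_gt0 e0.
  move: svs uvs; case: (vs) => [|v1 [|v2 ws]] /= svs;
    [by rewrite -svs in rp|by move: rp; rewrite -svs; lia|].
  by rewrite inE negb_or => /andP[/andP[v12 _] _]; exists v1, v2; rewrite !inE !eqxx orbT.
have plane := rich_points_coplanar irW gW chW gen0 genP
  (p := complex_point p) (p' := complex_point p')
  (vs := map (@complex_point R d) vs) (vs' := map (@complex_point R d) vs')
  (v1 := complex_point v1) (v2 := complex_point v2).
rewrite (inj_eq complex_point_inj) !size_map svs svs' in plane.
move: plane => /(_ pp' (onW _ _ nvs Lvs) (onW _ _ nvs' Lvs') (nzC _ nvs) (nzC _ nvs')).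
rewrite !(map_inj_uniq complex_point_inj) (inj_eq complex_point_inj).
move=> /(_ uvs uvs' (rfC _ rvs) (rfC _ rvs') rp rp').
move=> /(_ (map_f _ v1s) (map_f _ v2s) v12) plane.
pose M : 'M[R]_(2, d) := col_mx v1 v2; pose MC : 'M[C]_(2, d) := map_mx (real_complex R) M.
have MCE : MC = col_mx (complex_point v1) (complex_point v2).
  by exact: (map_col_mx (real_complex R) v1 v2).
have fM : row_free M by apply: rvs.
pose A := [set x | exists c : 'rV[C]_2, x = complex_point p + c *m MC].
(* [W] lies in this plane and strictly contains a line, so it is the whole plane; the directions
   [v1] and [v2] are real. *)
have AW : A `<=` W.
  apply: (@plane_sub_irreducible _ _ (line (complex_point p) (complex_point v1))) => //.
  - by apply: line_flat; rewrite complex_point_eq0 nvs.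
  - by exists (complex_point p), MC; split=> //; rewrite complex_row_free.
  - by apply: lineW; [apply: nvs|apply: Lvs].
  - move=> /(_ (complex_point p + complex_point v2)) /=.
    have Wp : W (complex_point p + complex_point v2).
      by rewrite -[complex_point v2]scale1r; apply: onW nvs Lvs _ _ (map_f _ v2s).
    move=> /(_ Wp)[t /addrI E].
    have : (row_mx t%:M (-1)%:M : 'rV_2) *m MC = 0.
      rewrite MCE (mul_row_col t%:M (-1)%:M (complex_point v1)).
      by rewrite !mul_scalar_mx E scaleN1r subrr.
    move/eqP; rewrite mulmx_free_eq0 ?complex_row_free //.
    move=> /eqP/(congr1 (fun c : 'rV_(1 + 1) => rsubmx c 0 0)).
    by rewrite row_mxKr !mxE eqxx mulr1n => /eqP; rewrite oppr_eq0 oner_eq0.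
  - move=> x /plane; rewrite -MCE => /submxP[c E]; exists c.
    by rewrite -E addrC subrK.
case: (nV [set x | exists c : 'rV[R]_2, x = p + c *m M]); first by exists p, M.
move=> _ [c ->]; apply: complex_point_mem cV _; apply: WV; apply: AW.
by exists (map_mx (real_complex R) c); rewrite complex_pointD /complex_point map_mxM.
Qed.

(** [k] is the dimension of [W]: a line inside excludes 0, and the quadratic growth excludes 3 and
    more. Positivity of [e] is proved along with the bound because it later limits the number of
    components that matter. *)
Lemma component_incidences V (W : set 'rV[C]_d) D e P L :
  algebraic_variety V -> ~ irreducible_chain V 3 ->
  (forall F, is_flat 2 F -> ~ F `<=` V) ->
  irreducible_variety W -> W `<=` complexification V ->
  has_irreducible_degree W e -> (e <= D)%N ->
  (forall l, l \in L -> is_flat 1 l) ->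
  (forall l, l \in L -> complexification l `<=` W) -> L != fset0 ->
  (0 < e)%N /\ (incidences P L <= (2 * D ^ 2 + 1) * #|` P| + #|` L|)%N.
Proof.
move=> cV dimV nV irW WV [k [[chW nchW] [gen [/eqP gen0 genP]]]] eD fL LW /fset0Pn[l0 l0L].
have gW : growth W (@coordinate C d) 2.
  exact: growth_sub WV (complex_growth (real_growth cV dimV)).
have Cline l : l \in L -> exists p v, [/\ v != 0, l = line p v &
    complexification l = line (complex_point p) (complex_point v)].
  move=> lL; have [p pl _] := line_above_point (fL l lL).
  have [v v0 E] := flat_line (fL l lL) pl.
  by exists p, v; rewrite {2}E complexification_line.
have flC l : l \in L -> is_flat 1 (complexification l).
  by move=> /Cline[p [v [v0 _ ->]]]; apply: line_flat; rewrite complex_point_eq0.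
case: k chW nchW gen gen0 genP => [|[|[|k]]] chW nchW gen gen0 genP.
- by case: nchW; apply: line_chain1 (flC _ l0L) (LW _ l0L).
- have [p [v [v0 _ E]]] := Cline l0 l0L.
  have e0 : (0 < e)%N.
    apply: (@curve_degree_gt0 _ _ W (complex_point p) (complex_point v) _ gen) => //.
      by rewrite complex_point_eq0.
    by rewrite -E; apply: LW.
  split=> //; have Wl l : l \in L -> W `<=` complexification l.
    move=> lL; apply: contrapT => nW; apply: nchW.
    exact: line_chain2 (flC _ lL) irW (LW _ lL) nW.
  have sub l l' : l \in L -> l' \in L -> l `<=` l'.
    move=> lL l'L x lx; apply: complex_point_mem (flat_closed (fL _ l'L)) _.
    by apply: (Wl l' l'L); apply: (LW l lL); apply: complexification_point.
  (* All lines of [L] coincide with [l0], so no point lies on two of them. *)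
  apply: leq_trans (@incidences_bound _ _ P L 1 _) _; last first.
    by rewrite leq_add2r leq_mul2r leq_addl orbT.
  move=> q q' _ _ + _; rewrite ltnNge => /negP[].
  apply: (@leq_trans #|` [fset l0]%fset|); last by rewrite cardfs1.
  apply: fsubset_leq_card; apply/fsubsetP => l.
  move=> lq; have lL : l \in L by move: lq; rewrite !inE => /andP[].
  by apply/fset1P/seteqP; split; apply: sub.
- have e0 : (0 < e)%N.
    (* Even for the zero form the equation has degree at least 1, and this degree is at most [e]. *)
    have [||A [g [_ indA sprime eqg]]] := surface_setup irW gW chW gen0 genP 0 (phi := fun=> 1).
    + exact: lpoly_cst.
    + by exists 0; rewrite oner_neq0.
    + by move: (size_surface_equation eqg); case: (size g) => [|[|n]]//= _; apply: leq_trans.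
  split=> //; apply: leq_trans (@incidences_bound _ _ P L (2 * e ^ 2) _) _.
    move=> p p' _ _ rp rp'; exact:
      (rich_point_unique cV nV irW WV gW chW gen0 genP fL LW e0 rp rp').
  rewrite leq_add2r leq_mul2r; apply/orP; right; apply: leq_trans (leq_addr _ _).
  by rewrite leq_mul2l leq_exp2r.
- by case: (chain_growth chW); apply: growth_leq gW.
Qed.

End RichPoints.

Local Close Scope ring_scope.
Local Open Scope fset_scope.
Local Open Scope classical_set_scope.

Theorem corollary3 (R : realType) (D : nat) :
  exists C : nat,
  forall (d : nat) (V : set 'rV[R]_d)
         (P : {fset 'rV[R]_d}) (L : {fset (set 'rV[R]_d)}),
    3 <= d ->
    algebraic_variety V ->
    has_dimension V 2 ->
    has_degree (complexification V) D ->
    (forall F : set 'rV[R]_d, is_flat 2 F -> ~ (F `<=` V)) ->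
    (forall p, p \in P -> V p) ->
    (forall l, l \in L -> is_flat 1 l /\ l `<=` V) ->
    incidences P L <= C * (#|` P| + #|` L|).
Proof.
(* [D] bounds the number of components containing lines; within one of them a point that is not
   exceptional counts at most [2 D^2] lines in the surface case and 1 in the curve case. *)
exists (D * (2 * D ^ 2 + 1)) => d V P L _ cV [_ dimV] [Ws [deg [WsP degP DE]]] nV _ HL.
pose LW W := [fset l in L | `[< complexification l `<=` W >]].
have cover l : l \in L -> exists2 W, W \in Ws & l \in LW W.
  move=> lL; have [fl lV] := HL l lL.
  have [p pl _] := line_above_point fl; have [v v0 lE] := flat_line fl pl.
  have [|||W /WsP WWs lW] := @component_above _ _ (complexification V) (complexification l).
  - exact: zariski_closure_closed.
  - rewrite lE complexification_line //; apply: (@flat_irreducible _ _ 1).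
    by apply: line_flat; rewrite complex_point_eq0.
  - exact: complexificationS.
  by exists W => //; rewrite !inE lL; apply/asboolP.
apply: leq_trans (incidences_cover P cover) _.
(* The factor [deg W] is at least 1 once [LW W] is nonempty, and it makes the sum over all
   components collapse to [D]. *)
have comp W : W \in Ws -> incidences P (LW W) <= deg W * ((2 * D ^ 2 + 1) * (#|` P| + #|` L|)).
  move=> WWs; have [irW WV _] := (WsP W).1 WWs.
  have degD : deg W <= D by rewrite DE (big_fsetD1 W) //= leq_addr.
  have LWL : #|` LW W| <= #|` L|.
    by apply: fsubset_leq_card; apply/fsubsetP => l; rewrite !inE => /andP[].
  have [E|LW0] := eqVneq (LW W) fset0.
    rewrite (_ : incidences P (LW W) = 0) //; apply/eqP; rewrite cardfs_eq0.
    by apply/eqP/fsetP => -[p l]; rewrite E !inE andbF.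
  have [||deg0 bound] := component_incidences P cV dimV nV irW WV (degP W WWs) degD _ _ LW0.
  - by move=> l; rewrite !inE => /andP[/HL[]].
  - by move=> l; rewrite !inE => /andP[_ /asboolP].
  apply: leq_trans bound _; apply: leq_trans _ (leq_pmull _ deg0).
  rewrite mulnDr leq_add2l; apply: leq_trans LWL _.
  by rewrite leq_pmull // addn1.
apply: (@leq_trans (\sum_(W <- Ws) deg W * ((2 * D ^ 2 + 1) * (#|` P| + #|` L|)))).
  by rewrite big_seq [leqRHS]big_seq; apply: leq_sum.
by rewrite -big_distrl /= -DE mulnA.
Qed.
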